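(* Let $(F^\bullet;N_1,\ldots,N_m)$ be an $\mathbb R$-split nilpotent orbit on a Mumford--Tate domain $D=G_{\mathbb R}/K^0_{\mathbb R}$ with nilpotent cone $\mathcal C=\{\sum_it^iN_i:t^i>0\}$, let $\mathfrak g_{\mathbb C}=\bigoplus I^{p,q}_{\mathfrak g}$ be the associated Deligne splitting, let $\mathfrak l_{\mathbb R}=\mathfrak g_{\mathbb R}\cap\bigoplus_pI^{p,p}_{\mathfrak g}$ (a Levi subalgebra of $\mathfrak g_{\mathbb R}$), and let $L_{\mathbb R}\subset G_{\mathbb R}$ be the connected Lie subgroup with Lie algebra $\mathfrak l_{\mathbb R}$. Let $Y\in\mathfrak l_{\mathbb R}$ be the grading element defined by $$Y\big|_{I^{p,p}_{\mathfrak g}}=2p$$ (that is, $\mathrm{ad}\,Y$ acts on $I^{p,p}_{\mathfrak g}$ by the scalar $2p$), and let $L^Y_{\mathbb R}$ denote the connected subgroup of $L_{\mathbb R}$ stabilizing $Y$ under the adjoint action. Then the Lie algebra $\mathfrak l^Y_{\mathbb R}=\{\xi\in\mathfrak l_{\mathbb R}:[\xi,Y]=0\}$ is a Levi subalgebra, and $\mathcal C\subset\mathrm{Nilp}(\mathfrak l_{\mathbb R})$ is contained in an $\mathrm{Ad}(L^Y_{\mathbb R})$-orbit.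
   Context: **Hodge representations.** $G_{\mathbb R}$ is a connected, non-compact, semisimple real algebraic group with maximal compact subgroup of equal rank; $G_{\mathbb C}$ is its complexification; $\mathbf i=\sqrt{-1}$. A Hodge representation of weight $n$ consists of a finite-dimensional real vector space $V_{\mathbb R}$, a nondegenerate $(-1)^n$-symmetric form $Q$, a homomorphism $\rho:G_{\mathbb R}\to\mathrm{Aut}(V_{\mathbb R},Q)$ of real algebraic groups with $d\rho$ injective, and a nonconstant homomorphism $\varphi:S^1\to G_{\mathbb R}$ such that $V^{p,q}=\{v\in V_{\mathbb C}:\rho(\varphi(z))v=z^{p-q}v\ \forall z\in S^1\}$ gives a Hodge decomposition $V_{\mathbb C}=\bigoplus_{p+q=n}V^{p,q}$ with $Q(\varphi(\mathbf i)v,\bar v)>0$ for $v\neq0$. With $F_\varphi^p=\bigoplus_{r\ge p}V^{r,n-r}$, $D=G_{\mathbb R}\cdot F_\varphi^\bullet$ is the Mumford--Tate domain, open in the compact dual $\check D=G_{\mathbb C}\cdot F_\varphi^\bullet$, and $K^0_{\mathbb R}$ is the (compact) stabilizer in $G_{\mathbb R}$ of $F_\varphi^\bullet$. $d\rho$ is suppressed. **Grading elements and Levi subalgebras.** A grading element of $\mathfrak g_{\mathbb C}$ is an element of a Cartan subalgebra on which all roots take integer values. A Levi subalgebra of $\mathfrak g_{\mathbb C}$ is the centralizer of a grading element; a Levi subalgebra of $\mathfrak g_{\mathbb R}$ is a real subalgebra whose complexification is a Levi subalgebra of $\mathfrak g_{\mathbb C}$. $\mathrm{Nilp}(\cdot)$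 is the set of nilpotent elements. **Nilpotent orbits.** A nilpotent orbit on $D$ is $(F^\bullet;N_1,\ldots,N_m)$ with $F^\bullet\in\check D$, $N_i\in\mathfrak g_{\mathbb R}$ commuting nilpotents, $N_iF^p\subset F^{p-1}$, and $\exp(\sum z^iN_i)F^\bullet\in D$ for all $\mathrm{Im}(z^i)\gg0$. For nilpotent $N$, $W_\bullet(N,V)$ is the unique increasing filtration with $NW_\ell\subset W_{\ell-2}$ and $N^\ell:\mathrm{Gr}_\ell\to\mathrm{Gr}_{-\ell}$ an isomorphism for $\ell\ge0$; it is independent of $N\in\mathcal C$. With $W_\ell=W_{\ell-n}(N,V_{\mathbb R})$ ($N\in\mathcal C$), $(F^\bullet,W_\bullet)$ is a mixed Hodge structure with Deligne splitting $V_{\mathbb C}=\bigoplus I^{p,q}$, $$I^{p,q}=F^p\cap W_{p+q}\cap\Big(\overline{F^q}\cap W_{p+q}+\sum_{j\ge1}\overline{F^{q-j}}\cap W_{p+q-j-1}\Big).$$ The nilpotent orbit is $\mathbb R$-split if $\overline{I^{p,q}}=I^{q,p}$ for all $p,q$. The induced splitting of $\mathfrak g_{\mathbb C}$ is $I^{p,q}_{\mathfrak g}=\{\xi\in\mathfrak g_{\mathbb C}:\xi(I^{r,s})\subset I^{p+r,q+s}\ \forall r,s\}$. *)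

(* Defs.v *)
From HB Require Import structures.
From mathcomp Require Import all_boot all_order all_algebra.
From mathcomp Require Import all_classical all_reals all_analysis.
From mathcomp Require Import complex.
(* The notations of [mpoly] clash with those of MathComp-Analysis. *)
From mathcomp Require Import -(notations) mpoly.
Set Implicit Arguments.
Unset Strict Implicit.
Unset Printing Implicit Defensive.
Import Order.TTheory GRing.Theory Num.Theory.
Import numFieldNormedType.Exports.
Local Open Scope classical_set_scope.
Local Open Scope ring_scope.

(* V_R = 'cV[R]_n, V_C = 'cV[R[i]]_n; the real group G_R consists of matrices
   in GL_k(R).  Subspaces, subgroups and subalgebras are classical sets. *)

Definition is_subspace {K : fieldType} {V : lmodType K} (S : set V) : Prop :=
  S 0 /\ forall (a : K) (u v : V), S u -> S v -> S (a *: u + v).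

(* The indices in s may repeat: the E i are meant to be subspaces. *)
Definition sumset {I : eqType} {V : zmodType} (P : I -> Prop) (E : I -> set V) :
    set V :=
  [set v | exists (s : seq I) (f : I -> V),
     (forall i, i \in s -> P i /\ E i (f i)) /\ v = \sum_(i <- s) f i].

Definition independent {I : eqType} {V : zmodType} (E : I -> set V) : Prop :=
  forall (s : seq I) (f : I -> V), uniq s ->
    (forall i, i \in s -> E i (f i)) -> \sum_(i <- s) f i = 0 ->
    forall i, i \in s -> f i = 0.

Definition is_direct_sum {I : eqType} {V : zmodType} (S : set V)
    (E : I -> set V) : Prop :=
  S = sumset (fun=> True) E /\ independent E.

Definition lieb {K : pzRingType} {k : nat} (A B : 'M[K]_k) : 'M[K]_k :=
  A *m B - B *m A.

Definition toC {R : realType} {m n : nat} (A : 'M[R]_(m, n)) :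
    'M[R[i]]_(m, n) := map_mx (fun x => x%:C%C) A.

Definition conjmx {R : realType} {m n : nat} (A : 'M[R[i]]_(m, n)) :
    'M[R[i]]_(m, n) := map_mx (fun z => z^*) A.

Definition conjset {R : realType} {m n : nat} (S : set 'M[R[i]]_(m, n)) :
    set 'M[R[i]]_(m, n) := conjmx @` S.

Definition cplx {R : realType} {m n : nat} (S : set 'M[R]_(m, n)) :
    set 'M[R[i]]_(m, n) :=
  [set toC A + 'i *: toC B | A in S & B in S].

Definition expmx {R : realType} {k : nat} (X : 'M[R]_k) : 'M[R]_k :=
  limn (series (fun j : nat => j`!%:R^-1 *: X ^+ j)).

Definition nilpotent_mx {K : pzRingType} {k : nat} (A : 'M[K]_k) : Prop :=
  exists j : nat, A ^+ j = 0.

(* The exponential of a nilpotent n x n matrix A; the omitted terms vanish,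
   because A ^+ n = 0. *)
Definition expnil {K : unitRingType} {n : nat} (A : 'M[K]_n) : 'M[K]_n :=
  \sum_(j < n.+1) j`!%:R^-1 *: A ^+ j.

(* Value at the matrix A of a polynomial in the k * k matrix entries, with
   coefficients pushed forward along f. *)
Definition peval {R S : nzRingType} (f : R -> S) {k : nat}
    (p : mpoly (k * k) R) (A : 'M[S]_k) : S :=
  mmap f (fun j => mxvec A 0 j) p.

Definition zeros {R : realType} {k : nat} (P : set (mpoly (k * k) R)) :
    set 'M[R]_k :=
  [set A | forall p, P p -> peval id p A = 0].

Definition is_subgroup {R : realType} {k : nat} (G : set 'M[R]_k) : Prop :=
  [/\ G `<=` [set A | A \in unitmx], G 1%:M,
      (forall A B, G A -> G B -> G (A *m B)) &
      (forall A, G A -> G (invmx A))].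

Definition is_algebraic_group {R : realType} {k : nat} (G : set 'M[R]_k) :
    Prop :=
  is_subgroup G /\
  exists P : set (mpoly (k * k) R), G = [set A | A \in unitmx] `&` zeros P.

(* Connected as an algebraic group, i.e. in the Zariski topology. *)
Definition zariski_connected {R : realType} {k : nat} (G : set 'M[R]_k) :
    Prop :=
  forall P1 P2 : set (mpoly (k * k) R),
    G `<=` zeros P1 `|` zeros P2 -> G `&` zeros P1 `&` zeros P2 = set0 ->
    G `<=` zeros P1 \/ G `<=` zeros P2.

(* G_C: the complex points of the Zariski closure of G. *)
Definition complex_points {R : realType} {k : nat} (G : set 'M[R]_k) :
    set 'M[R[i]]_k :=
  [set A | A \in unitmx /\
     forall p : mpoly (k * k) R, G `<=` [set B | peval id p B = 0] ->
       peval (fun x : R => x%:C%C) p A = 0].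

(* A regular map GL_k -> M_n defined over R: every entry is a polynomial in
   the matrix entries divided by the same power of the determinant. *)
Record regular_map (R : realType) (k n : nat) := RegularMap {
  reg_num : 'M[mpoly (k * k) R]_n;
  reg_exp : nat
}.

Definition reg_eval {R : realType} {S : comUnitRingType} (f : R -> S)
    {k n : nat} (r : regular_map R k n) (A : 'M[S]_k) : 'M[S]_n :=
  (\det A) ^- reg_exp r *: map_mx (fun p => peval f p A) (reg_num r).

Definition regR {R : realType} {k n : nat} (r : regular_map R k n) :
    'M[R]_k -> 'M[R]_n := reg_eval id r.

Definition regC {R : realType} {k n : nat} (r : regular_map R k n) :
    'M[R[i]]_k -> 'M[R[i]]_n := reg_eval (fun x : R => x%:C%C) r.

Definition lie_of {R : realType} {k : nat} (G : set 'M[R]_k) : set 'M[R]_k :=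
  [set X | forall t : R, G (expmx (t *: X))].

Definition regdiff {R : realType} {k n : nat} (r : regular_map R k n)
    (X : 'M[R]_k) : 'M[R]_n :=
  derive1 (fun t : R => regR r (expmx (t *: X))) 0.

Definition regdiffC {R : realType} {k n : nat} (r : regular_map R k n)
    (Z : 'M[R[i]]_k) : 'M[R[i]]_n :=
  toC (regdiff r (map_mx (@complex.Re R) Z)) +
  'i *: toC (regdiff r (map_mx (@complex.Im R) Z)).

(* Connected Lie subgroup with Lie algebra S: generated by exp S (closed under
   inverses, since S = - S). *)
Definition connected_lie_subgroup {R : realType} {k : nat} (S : set 'M[R]_k) :
    set 'M[R]_k :=
  [set g | exists s : seq 'M[R]_k,
     (forall X, X \in s -> S X) /\ g = \prod_(X <- s) expmx X].

Definition derived_alg {K : fieldType} {k : nat} (a : {vspace 'M[K]_k}) :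
    {vspace 'M[K]_k} :=
  <<[seq lieb X Y | X <- vbasis a, Y <- vbasis a]>>%VS.

Definition solvable_alg {K : fieldType} {k : nat} (a : {vspace 'M[K]_k}) :
    Prop :=
  exists m : nat, iter m derived_alg a = 0%VS.

Definition is_ideal {K : fieldType} {k : nat} (g : set 'M[K]_k)
    (a : {vspace 'M[K]_k}) : Prop :=
  (forall X, X \in a -> g X) /\
  (forall X Y, g X -> Y \in a -> lieb X Y \in a).

Definition semisimple_alg {K : fieldType} {k : nat} (g : set 'M[K]_k) : Prop :=
  forall a : {vspace 'M[K]_k}, is_ideal g a -> solvable_alg a -> a = 0%VS.

Definition ad_diagonalizable {K : fieldType} {k : nat} (g : set 'M[K]_k)
    (X : 'M[K]_k) : Prop :=
  g = sumset (fun=> True)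
        (fun a : K => [set Z | g Z /\ lieb X Z = a *: Z]).

Definition toral {K : fieldType} {k : nat} (g : set 'M[K]_k)
    (h : {vspace 'M[K]_k}) : Prop :=
  [/\ (forall X, X \in h -> g X),
      (forall X Y, X \in h -> Y \in h -> lieb X Y = 0) &
      (forall X, X \in h -> ad_diagonalizable g X)].

(* A maximal toral subalgebra: the usual definition for a complex reductive
   Lie algebra, which is the only case used. *)
Definition is_cartan {K : fieldType} {k : nat} (g : set 'M[K]_k)
    (h : {vspace 'M[K]_k}) : Prop :=
  toral g h /\ forall h', toral g h' -> (h <= h')%VS -> h' = h.

(* Only the restriction of alpha to h matters; its linearity there follows
   from the existence of a root vector. *)
Definition is_root {K : fieldType} {k : nat} (g : set 'M[K]_k)
    (h : {vspace 'M[K]_k}) (alpha : 'M[K]_k -> K) : Prop :=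
  (exists2 X, X \in h & alpha X != 0) /\
  exists Z, [/\ g Z, Z != 0 & forall X, X \in h -> lieb X Z = alpha X *: Z].

Definition is_grading {K : fieldType} {k : nat} (g : set 'M[K]_k)
    (E : 'M[K]_k) : Prop :=
  exists h : {vspace 'M[K]_k},
    [/\ is_cartan g h, E \in h &
        forall alpha, is_root g h alpha -> exists c : int, alpha E = c%:~R].

Definition is_levi {K : fieldType} {k : nat} (g l : set 'M[K]_k) : Prop :=
  exists2 E, is_grading g E & l = [set X | g X /\ lieb E X = 0].

Definition is_real_levi {R : realType} {k : nat} (g l : set 'M[R]_k) : Prop :=
  [/\ is_subspace l, (forall X Y, l X -> l Y -> l (lieb X Y)), l `<=` g &
      is_levi (cplx g) (cplx l)].

Definition has_rank {K : fieldType} {k : nat} (g : set 'M[K]_k) (r : nat) :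
    Prop :=
  exists2 h : {vspace 'M[K]_k}, is_cartan g h & \dim h = r.

Definition is_maximal_compact {R : realType} {k : nat} (G K : set 'M[R]_k) :
    Prop :=
  [/\ is_subgroup K, K `<=` G, compact K &
      forall K' : set 'M[R]_k, is_subgroup K' -> K' `<=` G -> compact K' ->
        K `<=` K' -> K' = K].

Definition admissible_group {R : realType} {k : nat} (G : set 'M[R]_k) : Prop :=
  [/\ is_algebraic_group G, zariski_connected G, ~ compact G,
      semisimple_alg (lie_of G) &
      exists2 K, is_maximal_compact G K &
        exists2 r, has_rank (cplx (lie_of G)) r & has_rank (cplx (lie_of K)) r].

Record hodge_datum (R : realType) (k n : nat) := HodgeDatum {
  hd_G : set 'M[R]_k;
  hd_rho : regular_map R k n;
  hd_Q : 'M[R]_n;            (* Gram matrix: Q(u, v) = u^T *m Q *m v *)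
  hd_wt : int;
  hd_phi : R[i] -> 'M[R]_k   (* only its values on the unit circle matter *)
}.

Section HodgeRepresentation.
Context {R : realType} {k n : nat} (H : hodge_datum R k n).

Let G := hd_G H.
Let rho := hd_rho H.
Let Q := hd_Q H.
Let w := hd_wt H.
Let phi := hd_phi H.

Definition hd_g : set 'M[R]_k := lie_of G.

Definition hd_gC : set 'M[R[i]]_k := cplx hd_g.

Definition hd_drho : 'M[R]_k -> 'M[R]_n := regdiff rho.

Definition hd_drhoC : 'M[R[i]]_k -> 'M[R[i]]_n := regdiffC rho.

Definition hodge_space (p q : int) : set 'cV[R[i]]_n :=
  [set v | p + q = w /\
     forall z : R[i], `|z| = 1 -> toC (regR rho (phi z)) *m v = z ^ (p - q) *: v].

Definition is_hodge_representation : Prop :=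
  [/\ [/\ Q \in unitmx, Q^T = (-1) ^ w *: Q,
          (forall A B, G A -> G B ->
             regR rho (A *m B) = regR rho A *m regR rho B),
          (forall A, G A ->
             regR rho A \in unitmx /\ (regR rho A)^T *m Q *m regR rho A = Q) &
          set_inj hd_g hd_drho],
      [/\ (forall z : R[i], `|z| = 1 -> G (phi z)),
          (forall y z : R[i], `|y| = 1 -> `|z| = 1 ->
             phi (y * z) = phi y *m phi z),
          {within [set z : R[i]^o | `|z| = 1],
             continuous (phi : R[i]^o -> 'M[R]_k)} &
          exists2 z : R[i], `|z| = 1 & phi z <> phi 1],
      is_direct_sum setT (fun p : int => hodge_space p (w - p)),
      (forall p q : int, conjset (hodge_space p q) = hodge_space q p) &
      (forall v : 'cV[R[i]]_n, v != 0 ->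
         0 < ((toC (regR rho (phi 'i)) *m v)^T *m toC Q *m conjmx v) 0 0)].

Definition hodge_flag (p : int) : set 'cV[R[i]]_n :=
  sumset (fun r : int => p <= r) (fun r => hodge_space r (w - r)).

Definition act_flag (A : 'M[R[i]]_n) (F : int -> set 'cV[R[i]]_n) :
    int -> set 'cV[R[i]]_n :=
  fun p => [set A *m v | v in F p].

Definition mt_domain : set (int -> set 'cV[R[i]]_n) :=
  [set act_flag (toC (regR rho g)) hodge_flag | g in G].

Definition compact_dual : set (int -> set 'cV[R[i]]_n) :=
  [set act_flag (regC rho g) hodge_flag | g in complex_points G].

(* g_R is regarded as a subalgebra of gl(V_R) through the injective d rho; for
   a subalgebra S this is nilpotency in g_R, not ad-nilpotency in S. *)
Definition Nilp (S : set 'M[R]_k) : set 'M[R]_k :=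
  [set X | S X /\ nilpotent_mx (hd_drho X)].

Definition is_nilpotent_orbit (m : nat) (F : int -> set 'cV[R[i]]_n)
    (N : 'I_m -> 'M[R]_k) : Prop :=
  [/\ compact_dual F,
      (forall i, Nilp hd_g (N i)),
      (forall i j, lieb (N i) (N j) = 0),
      (forall i p v, F p v -> F (p - 1) (toC (hd_drho (N i)) *m v)) &
      exists c : R, forall z : 'I_m -> R[i], (forall i, c < complex.Im (z i)) ->
        mt_domain (act_flag
          (expnil (\sum_i z i *: toC (hd_drho (N i)))) F)].

Definition nilpotent_cone (m : nat) (N : 'I_m -> 'M[R]_k) : set 'M[R]_k :=
  [set \sum_i t i *: N i | t in [set t : 'I_m -> R | forall i, 0 < t i]].

Definition is_increasing_filtration (W : int -> set 'cV[R]_n) : Prop :=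
  [/\ (forall l, is_subspace (W l)), (forall l, W l `<=` W (l + 1)),
      (exists l, W l = [set 0]) & (exists l, W l = setT)].

(* W = W(A, V_R); the last two clauses say that A ^+ l induces an injection,
   resp. a surjection, Gr_l -> Gr_{-l}. *)
Definition is_weight_filtration (A : 'M[R]_n) (W : int -> set 'cV[R]_n) : Prop :=
  [/\ is_increasing_filtration W,
      (forall l v, W l v -> W (l - 2) (A *m v)),
      (forall (l : nat) v, W l%:Z v ->
         W (- l%:Z - 1) (A ^+ l *m v) -> W (l%:Z - 1) v) &
      (forall (l : nat) u, W (- l%:Z) u ->
         exists2 v, W l%:Z v & W (- l%:Z - 1) (u - A ^+ l *m v))].

(* F induces on each (Gr^W_l)_C a Hodge structure of weight l, i.e.
   (Gr^W_l)_C is the direct sum of F^p Gr^W_l and of the conjugate of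
   F^{l+1-p} Gr^W_l, for all p. *)
Definition is_mixed_hodge (F : int -> set 'cV[R[i]]_n)
    (W : int -> set 'cV[R]_n) : Prop :=
  [/\ is_increasing_filtration W,
      [/\ (forall p, is_subspace (F p)), (forall p, F (p + 1) `<=` F p),
          (exists p, F p = setT) & (exists p, F p = [set 0])],
      (forall l p v, cplx (W l) v ->
         exists a b, [/\ (F p `&` cplx (W l)) a,
           (conjset (F (l + 1 - p)) `&` cplx (W l)) b &
           cplx (W (l - 1)) (v - (a + b))]) &
      (forall l p a b, (F p `&` cplx (W l)) a ->
         (conjset (F (l + 1 - p)) `&` cplx (W l)) b ->
         cplx (W (l - 1)) (a + b) -> cplx (W (l - 1)) a)].

Definition deligne (F : int -> set 'cV[R[i]]_n) (W : int -> set 'cV[R]_n)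
    (p q : int) : set 'cV[R[i]]_n :=
  F p `&` cplx (W (p + q)) `&`
  [set a + b |
     a in conjset (F q) `&` cplx (W (p + q)) &
     b in sumset (fun j : nat => (1 <= j)%N)
            (fun j => conjset (F (q - j%:Z)) `&` cplx (W (p + q - j%:Z - 1)))].

(* The weight filtration W(A, V_R) does not depend on A in the cone; W is its
   shift W_l = W_{l - w}(A, V_R), with which F forms a mixed Hodge structure. *)
Definition is_Rsplit_nilpotent_orbit (m : nat) (F : int -> set 'cV[R[i]]_n)
    (N : 'I_m -> 'M[R]_k) (W : int -> set 'cV[R]_n) : Prop :=
  [/\ is_nilpotent_orbit F N,
      (forall A, nilpotent_cone N A ->
         is_weight_filtration (hd_drho A) (fun l => W (l + w))),
      is_mixed_hodge F W &
      forall p q, conjset (deligne F W p q) = deligne F W q p].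

Section Splitting.
Variables (F : int -> set 'cV[R[i]]_n) (W : int -> set 'cV[R]_n).

Definition deligne_g (p q : int) : set 'M[R[i]]_k :=
  [set xi | hd_gC xi /\
     forall r s v, deligne F W r s v ->
       deligne F W (p + r) (q + s) (hd_drhoC xi *m v)].

Definition levi_l : set 'M[R]_k :=
  [set X | hd_g X /\ sumset (fun=> True) (fun p : int => deligne_g p p) (toC X)].

Definition levi_L : set 'M[R]_k := connected_lie_subgroup levi_l.

Definition levi_lY (Y : 'M[R]_k) : set 'M[R]_k :=
  [set X | levi_l X /\ lieb X Y = 0].

(* Identity component for the topology induced by M_k(R). *)
Definition levi_LY (Y : 'M[R]_k) : set 'M[R]_k :=
  connected_component [set g | levi_L g /\ g *m Y *m invmx g = Y] 1%:M.

End Splitting.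

End HodgeRepresentation.

(* Main.v *)
Require Import Defs.
From HB Require Import structures.
From mathcomp Require Import all_boot all_order all_algebra.
From mathcomp Require Import all_classical all_reals all_analysis.
From mathcomp Require Import complex ring lra zify.
From mathcomp Require Import (coercions) mpoly.
(* The name conjmx, which mxpoly uses as well, denotes the entrywise conjugate. *)
Import Defs.
Set Implicit Arguments.
Unset Strict Implicit.
Unset Printing Implicit Defensive.
Import Order.TTheory GRing.Theory Num.Theory.
Import numFieldNormedType.Exports.
Local Open Scope classical_set_scope.
Local Open Scope ring_scope.

(** The nilpotent cone is convex and lies in a vector space l_(-2) on which
    L^Y acts; the theorem holds because each orbit meeting the cone is open in
    l_(-2).  Openness comes from sl2-theory, and the sl2-triples have to be
    found inside g_R, although only the operators d rho(A), for A in the cone,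
    and the filtrations on V are given.

    Grading elements.  As the splitting is defined over R, V_C is the direct
    sum of the spaces I^(p,q) = F^p /\ conj F^q /\ W_(p+q).  Let T act on
    I^(p,q) by p - q and Y by p + q - w, and put N = d rho(A).  By hard
    Lefschetz, which is what the weight filtration says, tr (Y Z) = 0 for every
    Z that commutes with N, so that [X, N] = Y has a solution; its component of
    type (1,1) can be made real.  This gives a raising operator N+
    (exists_sl2_raising).  The sl2-relations imply that
    T + (i y)^-1 N+ + i y N respects the filtration exp(i y N) F, on which it
    is 2 p - w modulo F^(p+1), and it is the opposite of its own conjugate;
    hence it is the Hodge grading at the point exp(i y N) F, which belongs to D
    for large y (Hgr_mem).  At the base point, i times the Hodge grading is the
    differential of phi (hodge_generator), and the points of D are translates
    of the base point; therefore i T + y^-1 N+ - y N is in d rho(g_R) for all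
    large y, and two values of y suffice to conclude that i T and N+, and with
    them Y = [N+, N], come from g_R (orbit_grading_elements).

    Levi subalgebras.  Write T and Y for the elements of g_R with images i T
    and Y.  On I_g^(a,b) they act by i (a - b) and a + b, so that ad E, for
    E = K Y - i T with a large integer K, separates the types (a, b), and g_C
    is the sum of the I_g^(a,b) (gC_decompose).  It follows that l_R is the
    centralizer of T, that l_R^Y is the centralizer l_0 of T and Y, and that
    its complexification is the centralizer of the grading element E
    (levi_lP, levi_lY_levi).

    Orbits.  Every A in the cone is the lowering operator of a triple
    (N+, Y, A) in l_R with the same Y.  Hence X |-> [X, A] maps l_0 onto the
    space l_(-2) where ad Y is -2 (ad_lowering_surjective), and by a
    contraction argument exp(l_0) moves A to all nearby points of l_(-2)
    (local_conj_surjective).  A segment in the cone therefore stays in one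
    orbit of the group generated by exp(l_0) (expconj_convex), and the elements
    of this group are joined to 1 in the stabilizer of Y by scaling their
    logarithms (expprod_component).

    All the Lie theory used (the Lie algebra of an algebraic group is a Lie
    algebra, representations commute with exp, continuous one-parameter groups
    are exponentials) is deduced from one limit: if n (B_n - 1) tends to X,
    then B_n^n tends to exp X (expmx_pow_cvg). *)

(** * Matrix norms and the matrix exponential *)

Section MatrixNorm.
Context {R : realType}.

Lemma mx_norm_le m n (A : 'M[R]_(m, n)) (c : R) :
  0 <= c -> (forall i j, `|A i j| <= c) -> `|A| <= c.
Proof.
move=> c0 h; rewrite /Num.Def.normr/= mx_normrE; apply: bigmax_le => // -[i j] _.
Qed.

Lemma mx_entry_le m n (A : 'M[R]_(m, n)) i j : `|A i j| <= `|A|.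
Proof.
rewrite [in leRHS]/Num.Def.normr/= mx_normrE.
exact: (le_bigmax _ (fun ij => `|A ij.1 ij.2|) (i, j)).
Qed.

Lemma mx_normM m n p (A : 'M[R]_(m, n)) (B : 'M[R]_(n, p)) :
  `|A *m B| <= `|A| * (n%:R * `|B|).
Proof.
apply: mx_norm_le => [|i j]; first by rewrite !mulr_ge0.
rewrite mxE; apply: le_trans (ler_norm_sum _ _ _) _.
apply: (@le_trans _ _ (\sum_(l < n) `|A| * `|B|)).
  by apply: ler_sum => l _; rewrite normrM ler_pM// mx_entry_le.
by rewrite sumr_const card_ord -[leLHS]mulr_natl mulrCA.
Qed.

Lemma cvg_mxP {T : Type} {D : set_system T} {FD : Filter D} m n
    (f : T -> 'M[R]_(m, n)) (l : 'M[R]_(m, n)) :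
  f @ D --> l <-> forall i j, f x i j @[x --> D] --> l i j.
Proof.
split=> [fl i j|fl].
  apply/cvgrPdist_le => e e0; move/cvgrPdist_le : fl => /(_ e e0).
  apply: filterS => x; apply: le_trans.
  by have := mx_entry_le (l - f x) i j; rewrite !mxE.
apply/cvgrPdist_le => e e0.
have : \forall x \near D, forall ij : 'I_m * 'I_n,
    `|l ij.1 ij.2 - f x ij.1 ij.2| <= e.
  apply: filter_forall => -[i j].
  by have /cvgrPdist_le := fl i j; exact.
apply: filterS => x h; apply: mx_norm_le => [|i j]; first exact: ltW.
by have := h (i, j); rewrite !mxE.
Qed.

Lemma cvg_sum {T : Type} {D : set_system T} {FD : Filter D}
    (V : normedModType R) (I : Type) (r : seq I) (f : I -> T -> V) (l : I -> V) :
  (forall i, f i @ D --> l i) ->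
  (\sum_(i <- r) f i x) @[x --> D] --> \sum_(i <- r) l i.
Proof.
move=> fl; elim: r => [|i r ih].
  rewrite big_nil; under eq_fun do rewrite big_nil; exact: cvg_cst.
rewrite big_cons; under eq_fun do rewrite big_cons.
exact: cvgD.
Qed.

Lemma cvg_mulmx {T : Type} {D : set_system T} {FD : Filter D} m n p
    (f : T -> 'M[R]_(m, n)) (g : T -> 'M[R]_(n, p)) (a : 'M[R]_(m, n)) (b : 'M[R]_(n, p)) :
  f @ D --> a -> g @ D --> b -> (f x *m g x) @[x --> D] --> a *m b.
Proof.
move=> fa gb; apply/cvg_mxP => i j; rewrite mxE.
under eq_fun do rewrite mxE.
apply: cvg_sum => l; apply: cvgM.
- by move/cvg_mxP : fa; exact.
- by move/cvg_mxP : gb; exact.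
Qed.

Lemma cvg_mx_exp {T : Type} {D : set_system T} {FD : Filter D} k
    (f : T -> 'M[R]_k) (a : 'M[R]_k) j :
  f @ D --> a -> (f x ^+ j) @[x --> D] --> a ^+ j.
Proof.
move=> fa; elim: j => [|j ih].
  by rewrite expr0; under eq_fun do rewrite expr0; exact: cvg_cst.
by rewrite exprS; under eq_fun do rewrite exprS; exact: cvg_mulmx.
Qed.

Lemma mx_norm1 k : `|1%:M : 'M[R]_k| <= 1.
Proof.
apply: mx_norm_le => // i j; rewrite mxE.
by case: (i == j); rewrite ?normr0 ?normr1.
Qed.

(** The norm is the maximum of the entries, which is submultiplicative only up to
    the factor k; hence the hypotheses of the form k |A| <= c. *)
Lemma mx_norm_mulX m k (B : 'M[R]_(m, k)) (A : 'M[R]_k) (c : R) j :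
  k%:R * `|A| <= c -> `|B *m A ^+ j| <= `|B| * c ^+ j.
Proof.
move=> Ac; have c0 : 0 <= c by apply: le_trans Ac; rewrite mulr_ge0.
elim: j => [|j ih]; first by rewrite !expr0 mulmx1 mulr1.
rewrite exprSr mulmxA; apply: le_trans (mx_normM _ _) _.
by rewrite exprSr [leRHS]mulrA ler_pM// mulr_ge0.
Qed.

Lemma mx_normX k (A : 'M[R]_k) (c : R) j : k%:R * `|A| <= c -> `|A ^+ j| <= c ^+ j.
Proof.
move=> Ac; have c0 : 0 <= c by apply: le_trans Ac; rewrite mulr_ge0.
rewrite -[A ^+ j]mul1mx; apply: le_trans (mx_norm_mulX _ _ Ac) _.
by rewrite ler_piMl ?mx_norm1// exprn_ge0.
Qed.

Lemma mx_normXB k (A B : 'M[R]_k) (c : R) j :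
  k%:R * `|A| <= c -> k%:R * `|B| <= c ->
  `|A ^+ j - B ^+ j| <= j%:R * c ^+ j.-1 * `|A - B|.
Proof.
move=> Ac Bc; have c0 : 0 <= c by apply: le_trans Ac; rewrite mulr_ge0.
elim: j => [|j ih]; first by rewrite !expr0 subrr normr0 !mul0r.
have -> : A ^+ j.+1 - B ^+ j.+1 = (A ^+ j - B ^+ j) *m A + B ^+ j *m (A - B).
  by rewrite !exprSr mulmxBl mulmxBr addrA subrK.
apply: le_trans (ler_normD _ _) _.
have h1 : `|(A ^+ j - B ^+ j) *m A| <= j%:R * c ^+ j * `|A - B|.
  apply: le_trans (mx_normM _ _) _.
  case: j ih => [|j] ih; first by rewrite !expr0 subrr normr0 !mul0r.
  apply: (@le_trans _ _ ((j.+1%:R * c ^+ j * `|A - B|) * c)).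
    by apply: ler_pM => //; rewrite mulr_ge0.
  by rewrite exprSr; lra.
have h2 : `|B ^+ j *m (A - B)| <= c ^+ j * `|A - B|.
  elim: j {ih h1} => [|j ih]; first by rewrite !expr0 mul1mx mul1r.
  rewrite exprS -mulmxA; apply: le_trans (mx_normM _ _) _.
  by rewrite mulrA (mulrC `|B|) exprS -(mulrA c) ler_pM// mulr_ge0.
apply: le_trans (lerD h1 h2) _; rewrite /= -mulrDl -{2}[c ^+ j]mul1r -mulrDl.
by rewrite natr1.
Qed.

End MatrixNorm.

Lemma mx_mulE (K : pzSemiRingType) k (A B : 'M[K]_k) : A * B = A *m B.
Proof. by []. Qed.

Lemma mx_exprZ (K : comPzRingType) k (a : K) (A : 'M[K]_k) j :
  (a *: A) ^+ j = a ^+ j *: A ^+ j.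
Proof.
elim: j => [|j ih]; first by rewrite !expr0 scale1r.
by rewrite !exprS ih !mx_mulE -scalemxAl -scalemxAr scalerA.
Qed.

(* Completeness is joined to the norm of matrices, so that absolutely
   convergent series of matrices converge. *)
HB.instance Definition _ (R : realType) (m n : nat) :=
  Complete.on 'M[R]_(m, n).

Section Exponential.
Context {R : realType} {k : nat}.
Implicit Types (X Y A B : 'M[R]_k) (c : R).

Definition expterm X (j : nat) : 'M[R]_k := j`!%:R^-1 *: X ^+ j.

Lemma norm_expterm X c j : k%:R * `|X| <= c -> `|expterm X j| <= exp_coeff c j.
Proof.
move=> Xc; rewrite /expterm normrZ ger0_norm ?invr_ge0// /exp_coeff/= mulrC.
by apply: ler_wpM2r; rewrite ?invr_ge0// mx_normX.
Qed.

Lemma normed_series_expterm X :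
  cvgn [normed series (expterm X)].
Proof.
apply: (@series_le_cvg _ _ (exp_coeff (k%:R * `|X|))) => [j|j|j|].
- exact: normr_ge0.
- by apply: exp_coeff_ge0; rewrite mulr_ge0.
- exact: norm_expterm.
- exact: is_cvg_series_exp_coeff.
Qed.

Lemma cvg_series_expterm X : series (expterm X) @ \oo --> expmx X.
Proof.
exact: (normed_cvg (@normed_series_expterm X)).
Qed.

Lemma series_expterm_sub X c (J n : nat) : k%:R * `|X| <= c -> (J <= n)%N ->
  `|series (expterm X) n - series (expterm X) J| <=
  series (exp_coeff c) n - series (exp_coeff c) J.
Proof.
move=> Xc Jn; rewrite /series/=.
rewrite !(big_cat_nat (leq0n J) Jn)/= ![_ + \sum_(J <= _ < _) _]addrC !addrK.
apply: le_trans (ler_norm_sum _ _ _) _; apply: ler_sum => i _.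
exact: norm_expterm.
Qed.

Lemma expmx_tail X c (J : nat) : k%:R * `|X| <= c ->
  `|expmx X - series (expterm X) J| <= expR c - series (exp_coeff c) J.
Proof.
move=> Xc.
have h1 : `|series (expterm X) n - series (expterm X) J| @[n --> \oo] -->
    `|expmx X - series (expterm X) J|.
  by apply: cvg_norm; apply: cvgB; [exact: cvg_series_expterm|exact: cvg_cst].
have h2 : series (exp_coeff c) n - series (exp_coeff c) J @[n --> \oo] -->
    expR c - series (exp_coeff c) J.
  by apply: cvgB; [exact: is_cvg_series_exp_coeff|exact: cvg_cst].
apply: (ler_cvg_to h1 h2); near=> n; apply: series_expterm_sub => //.
by near: n; exact: nbhs_infty_ge.
Unshelve. all: by end_near. Qed.

(** By mx_normXB, the terms of degree at least 2 of the exponential series have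
    Lipschitz constants on the set k |X| <= c that add up to at most e c. *)
Lemma expmx_lipschitz X Y c : c <= 1 -> k%:R * `|X| <= c -> k%:R * `|Y| <= c ->
  `|expmx X - expmx Y - (X - Y)| <= expR 1 * c * `|X - Y|.
Proof.
move=> c1 Xc Yc; have c0 : 0 <= c by apply: le_trans Xc; rewrite mulr_ge0.
have h1 : `|series (expterm X) n - series (expterm Y) n - (X - Y)|
     @[n --> \oo] --> `|expmx X - expmx Y - (X - Y)|.
  apply: cvg_norm; apply: cvgB; last exact: cvg_cst.
  by apply: cvgB; exact: cvg_series_expterm.
apply: (ler_cvg_to h1 (cvg_cst _)); exists 2%N => // -[|[|n]]// _.
rewrite /series/= -sumrB !big_nat_recl//= /expterm !expr0 !expr1 !fact0 !factS.
rewrite fact0 muln1 invr1 !scale1r subrr add0r [X in `|X|]addrC addKr.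
apply: le_trans (ler_norm_sum _ _ _) _.
apply: (@le_trans _ _ (\sum_(0 <= i < n) exp_coeff 1 i * (c * `|X - Y|))).
  apply: ler_sum => i _; rewrite -scalerBr normrZ ger0_norm ?invr_ge0//.
  apply: le_trans (_ : _ <= i.+2`!%:R^-1 * (i.+2%:R * c ^+ i.+1 * `|X - Y|)) _.
    by apply: ler_wpM2l; rewrite ?invr_ge0// mx_normXB.
  have -> : i.+2`!%:R^-1 * (i.+2%:R * c ^+ i.+1 * `|X - Y|) =
      (i.+1`!%:R^-1 * c ^+ i.+1) * `|X - Y|.
    have f0 : (i.+1`!%:R : R) != 0 by rewrite pnatr_eq0 -lt0n fact_gt0.
    have i0 : (i.+2%:R : R) != 0 by rewrite pnatr_eq0.
    rewrite factS natrM; move: (i.+1`!%:R : R) (i.+2%:R : R) f0 i0 => x y x0 y0.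
    by field; rewrite x0 y0.
  rewrite mulrA ler_wpM2r// /exp_coeff/= expr1n mul1r ler_pM ?exprn_ge0//.
    by rewrite lef_pV2 ?posrE ?ltr0n ?fact_gt0// ler_nat factS leq_pmull.
  by rewrite exprS ler_piMr// exprn_ile1.
rewrite -mulr_suml mulrA ler_wpM2r// ler_wpM2r//.
apply: (@nondecreasing_cvgn_le _ (series (exp_coeff 1))).
  by apply: nondecreasing_series => j _ _; exact: exp_coeff_ge0.
exact: is_cvg_series_exp_coeff.
Qed.

Lemma binomial_ratio_le (j n : nat) :
  'C(n, j)%:R / n%:R ^+ j <= j`!%:R^-1 :> R.
Proof.
case: n => [|n].
  case: j => [|j]; first by rewrite bin0 expr0 divr1 fact0 invr1.
  by rewrite bin0n mul0r invr_ge0.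
rewrite ler_pdivrMr ?exprn_gt0// mulrC ler_pdivlMr ?ltr0n ?fact_gt0//.
rewrite -natrX -natrM ler_nat bin_ffact.
elim: j => [|j ih]; first by rewrite ffactn0.
by rewrite ffactnSr expnSr leq_mul// leq_subr.
Qed.

Lemma cvg_invn : (n%:R^-1 : R) @[n --> \oo] --> (0 : R).
Proof.
rewrite -(cvg_shiftS (fun n => n%:R^-1 : R)); exact: cvg_harmonic.
Qed.

Lemma cvg_binomial_ratio (j : nat) :
  ('C(n, j)%:R / n%:R ^+ j : R) @[n --> \oo] --> (j`!%:R^-1 : R).
Proof.
elim: j => [|j ih].
  under eq_fun do rewrite bin0 expr0 divr1.
  by rewrite fact0 invr1; exact: cvg_cst.
have h : (1 - j%:R * n%:R^-1 : R) @[n --> \oo] --> (1 - j%:R * 0 : R).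
  apply: cvgB; first exact: cvg_cst.
  apply: cvgM; first exact: cvg_cst.
  exact: cvg_invn.
have : ('C(n, j)%:R / n%:R ^+ j * (1 - j%:R * n%:R^-1) * j.+1%:R^-1 : R)
    @[n --> \oo] --> (j`!%:R^-1 * (1 - j%:R * 0) * j.+1%:R^-1 : R).
  by apply: cvgM; [apply: cvgM | exact: cvg_cst].
rewrite mulr0 subr0 mulr1 factS natrM invfM [X in _ --> X]mulrC.
apply: cvg_trans; apply: near_eq_cvg; exists j.+1 => // n /= jn.
have n0 : (n%:R : R) != 0 by rewrite pnatr_eq0 -lt0n (leq_trans _ jn).
have j0 : (j.+1%:R : R) != 0 by rewrite pnatr_eq0.
have e : (j.+1%:R * 'C(n, j.+1)%:R : R) = (n%:R - j%:R) * 'C(n, j)%:R.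
  by rewrite -natrB 1?ltnW// -!natrM mul_bin_left.
rewrite -[in RHS](mulKf j0 'C(n, j.+1)%:R) e exprS.
have x0 := expf_neq0 j n0; move: x0 n0 j0 {e}.
move: (j.+1%:R : R) (n%:R : R) (n%:R ^+ j : R) => z y x x0 y0 z0.
by field; rewrite x0 y0 z0.
Qed.

(** Write B_n = 1 + Z_n / n with Z_n -> X and expand the power: the coefficient
    of Z_n^j is at most 1 / j! and tends to it, so that the limit can be taken
    term by term. *)
Lemma expmx_pow_cvg (B : nat -> 'M[R]_k) X :
  (n%:R *: (B n - 1)) @[n --> \oo] --> X ->
  (B n ^+ n) @[n --> \oo] --> expmx X.
Proof.
move=> BX; pose Z n : 'M[R]_k := n%:R *: (B n - 1).
(* c bounds k |Z_n| for all large n, since Z_n tends to X. *)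
pose c := k%:R * `|X| + 1.
have Xc : k%:R * `|X| <= c by rewrite lerDl.
have c0 : 0 <= c by apply: le_trans Xc; rewrite mulr_ge0.
have Zc : \forall n \near \oo, k%:R * `|Z n| <= c.
  have h : k%:R * `|Z n| @[n --> \oo] --> k%:R * `|X|.
    by apply: cvgM; [exact: cvg_cst | exact: cvg_norm].
  move/cvgrPdist_le : h => /(_ _ ltr01); apply: filterS => n.
  by rewrite ler_norml => /andP[]; rewrite /c; lra.
pose b n i : R := 'C(n, i)%:R / n%:R ^+ i.
have BE n : (0 < n)%N -> B n ^+ n = \sum_(0 <= i < n.+1) b n i *: Z n ^+ i.
  move=> n0; have n0' : (n%:R : R) != 0 by rewrite pnatr_eq0 -lt0n.
  have -> : B n = n%:R^-1 *: Z n + 1.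
    by rewrite /Z scalerA mulVf// scale1r subrK.
  rewrite exprD1n big_mkord; apply: eq_bigr => i _.
  by rewrite mx_exprZ -scaler_nat scalerA exprVn.
apply/cvgrPdist_le => e e0.
have e4 : 0 < e / 4 by rewrite divr_gt0.
have [J tailJ] : exists J, expR c - series (exp_coeff c) J <= e / 4.
  have /cvgrPdist_le/(_ _ e4) [J _ /(_ J (leqnn J))] := @is_cvg_series_exp_coeff R c.
  by move=> h; exists J; apply: le_trans h; exact: ler_norm.
have partJ : (\sum_(0 <= i < J) b n i *: Z n ^+ i) @[n --> \oo] -->
    series (expterm X) J.
  by apply: cvg_sum => i; apply: cvgZ; [exact: cvg_binomial_ratio | exact: cvg_mx_exp].
move/cvgrPdist_le : partJ => /(_ _ e4) partJ.
near=> n.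
have Jn : (J <= n.+1)%N by rewrite leqW//; near: n; exact: nbhs_infty_ge.
have -> : expmx X - B n ^+ n = (expmx X - series (expterm X) J) +
    (series (expterm X) J - \sum_(0 <= i < J) b n i *: Z n ^+ i) -
    \sum_(J <= i < n.+1) b n i *: Z n ^+ i.
  rewrite BE; last by near: n; exact: nbhs_infty_gt.
  by rewrite (big_cat_nat (leq0n J) Jn)/= addrA subrK opprD addrA.
apply: le_trans (ler_normB _ _) _.
have t1 : `|expmx X - series (expterm X) J| <= e / 4.
  exact: le_trans (expmx_tail _ Xc) tailJ.
have t2 : `|series (expterm X) J - \sum_(0 <= i < J) b n i *: Z n ^+ i| <= e / 4.
  by near: n.
have t3 : `|\sum_(J <= i < n.+1) b n i *: Z n ^+ i| <= e / 4.
  apply: le_trans tailJ.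
  apply: (@le_trans _ _ (series (exp_coeff c) n.+1 - series (exp_coeff c) J)).
    rewrite /series/= (big_cat_nat (leq0n J) Jn)/= [X in _ <= X - _]addrC addrK.
    apply: le_trans (ler_norm_sum _ _ _) _; apply: ler_sum => i _.
    rewrite normrZ ger0_norm ?divr_ge0 ?exprn_ge0// /exp_coeff/= mulrC.
    apply: ler_pM; rewrite ?divr_ge0 ?exprn_ge0//; last exact: binomial_ratio_le.
    by apply: mx_normX; near: n.
  rewrite lerB//; apply: (@nondecreasing_cvgn_le _ (series (exp_coeff c))).
    by apply: nondecreasing_series => j _ _; exact: exp_coeff_ge0.
  exact: is_cvg_series_exp_coeff.
have := ler_normD (expmx X - series (expterm X) J)
  (series (expterm X) J - \sum_(0 <= i < J) b n i *: Z n ^+ i).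
lra.
Unshelve. all: by end_near. Qed.

Lemma cvg_natZ_eq (B : nat -> 'M[R]_k) (D : nat -> 'M[R]_k) X :
  (forall n, (0 < n)%N -> B n = 1 + n%:R^-1 *: D n) -> D @ \oo --> X ->
  (n%:R *: (B n - 1)) @[n --> \oo] --> X.
Proof.
move=> BE; apply: cvg_trans; apply: near_eq_cvg; exists 1%N => // n /= n0.
by rewrite BE// addrC addKr scalerA divff ?scale1r// pnatr_eq0 -lt0n.
Qed.

Lemma cvg_invnZ (X : 'M[R]_k) : (n%:R^-1 *: X) @[n --> \oo] --> (0 : 'M[R]_k).
Proof.
by rewrite -[X in _ --> X](scale0r X); apply: cvgZ; [exact: cvg_invn | exact: cvg_cst].
Qed.

Lemma expmx_euler X : ((1 + n%:R^-1 *: X) ^+ n) @[n --> \oo] --> expmx X.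
Proof.
apply: expmx_pow_cvg; apply: (@cvg_natZ_eq _ (fun=> X)) => //.
exact: cvg_cst.
Qed.

Lemma expmx0 : expmx (0 : 'M[R]_k) = 1.
Proof.
have h := @expmx_euler 0; apply/esym; apply: (cvg_unique _ _ h) => //.
have -> : (fun n => (1 + n%:R^-1 *: (0 : 'M[R]_k)) ^+ n) = fun=> 1.
  by apply/funext => n; rewrite scaler0 addr0 expr1n.
exact: cvg_cst.
Qed.

Lemma expmxD X Y : X *m Y = Y *m X -> expmx (X + Y) = expmx X *m expmx Y.
Proof.
move=> XY; pose B n : 'M[R]_k := (1 + n%:R^-1 *: X) *m (1 + n%:R^-1 *: Y).
have h1 : (B n ^+ n) @[n --> \oo] --> expmx (X + Y).
  apply: expmx_pow_cvg.
  apply: (@cvg_natZ_eq _ (fun n => X + Y + n%:R^-1 *: (X *m Y))) => [n n0|].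
    rewrite /B mulmxDl mul1mx mulmxDr mulmx1 -scalemxAl -scalemxAr !scalerDr.
    by rewrite -!addrA [X in 1 + X]addrCA.
  rewrite -[X in _ --> X]addr0; apply: cvgD; first exact: cvg_cst.
  exact: cvg_invnZ.
apply: (cvg_unique _ h1) => //.
have -> : (fun n => B n ^+ n) =
    (fun n => (1 + n%:R^-1 *: X) ^+ n *m (1 + n%:R^-1 *: Y) ^+ n).
  apply/funext => n; rewrite /B -!mx_mulE exprMn_comm//.
  rewrite /GRing.comm !mx_mulE !mulmxDl !mulmxDr -!scalemxAl -!scalemxAr XY.
  by rewrite !mulmx1 !mul1mx; do 2!rewrite addrA; congr (_ + _); rewrite addrAC.
by apply: cvg_mulmx; exact: expmx_euler.
Qed.

Lemma expmxNr X : expmx X *m expmx (- X) = 1%:M.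
Proof. by rewrite -expmxD ?subrr ?expmx0// mulmxN mulNmx. Qed.

Lemma expmx_unit X : expmx X \in unitmx.
Proof. by case: (mulmx1_unit (expmxNr X)). Qed.

Lemma invmx_expmx X : invmx (expmx X) = expmx (- X).
Proof.
by rewrite -[LHS]mulmx1 -(expmxNr X) mulmxA mulVmx ?expmx_unit// mul1mx.
Qed.

Lemma expmx_comm A X : A *m X = X *m A -> A *m expmx X = expmx X *m A.
Proof.
move=> AX; have hl : (A *m (1 + n%:R^-1 *: X) ^+ n) @[n --> \oo] --> A *m expmx X.
  by apply: cvg_mulmx; [exact: cvg_cst | exact: expmx_euler].
apply: (cvg_unique _ hl) => //.
have -> : (fun n => A *m (1 + n%:R^-1 *: X) ^+ n) =
    (fun n => (1 + n%:R^-1 *: X) ^+ n *m A).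
  apply/funext => n; rewrite -!mx_mulE; apply: commrX.
  by rewrite /GRing.comm !mx_mulE mulmxDl mulmxDr mulmx1 mul1mx -scalemxAl -scalemxAr AX.
by apply: cvg_mulmx; [exact: expmx_euler | exact: cvg_cst].
Qed.

Lemma mx_conjX (g A : 'M[R]_k) n : g \in unitmx ->
  (g *m A *m invmx g) ^+ n = g *m A ^+ n *m invmx g.
Proof.
move=> gu; elim: n => [|n ih]; first by rewrite !expr0 mulmx1 mulmxV.
by rewrite !exprS !mx_mulE ih !mulmxA mulmxKV.
Qed.

Lemma expmx_conj g X : g \in unitmx ->
  expmx (g *m X *m invmx g) = g *m expmx X *m invmx g.
Proof.
move=> gu; have h := @expmx_euler (g *m X *m invmx g).
apply: (cvg_unique _ h) => //.
have -> : (fun n => (1 + n%:R^-1 *: (g *m X *m invmx g)) ^+ n) =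
    (fun n => g *m (1 + n%:R^-1 *: X) ^+ n *m invmx g).
  apply/funext => n; rewrite -mx_conjX//; congr (_ ^+ _).
  by rewrite mulmxDr mulmxDl mulmx1 mulmxV// -scalemxAr -scalemxAl.
apply: cvg_mulmx; last exact: cvg_cst.
by apply: cvg_mulmx; [exact: cvg_cst | exact: expmx_euler].
Qed.

End Exponential.

(** * Linear maps between matrix spaces *)

Section LinearMaps.
Context {R : realType}.

Definition linear_mx m n m' n' (f : 'M[R]_(m, n) -> 'M[R]_(m', n')) : Prop :=
  forall a X Y, f (a *: X + Y) = a *: f X + f Y.

Lemma linear_mx0 m n m' n' (f : 'M[R]_(m, n) -> 'M[R]_(m', n')) :
  linear_mx f -> f 0 = 0.
Proof.
move=> lf; have := lf (-1) 0 0; rewrite scaler0 addr0 scaleN1r addNr.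
by [].
Qed.

Lemma linear_mxD m n m' n' (f : 'M[R]_(m, n) -> 'M[R]_(m', n')) X Y :
  linear_mx f -> f (X + Y) = f X + f Y.
Proof. by move=> lf; rewrite -[X in f (X + _)]scale1r lf scale1r. Qed.

Lemma linear_mxZ m n m' n' (f : 'M[R]_(m, n) -> 'M[R]_(m', n')) a X :
  linear_mx f -> f (a *: X) = a *: f X.
Proof. by move=> lf; rewrite -[_ *: X]addr0 lf (linear_mx0 lf) addr0. Qed.

Lemma linear_mxB m n m' n' (f : 'M[R]_(m, n) -> 'M[R]_(m', n')) X Y :
  linear_mx f -> f (X - Y) = f X - f Y.
Proof. by move=> lf; rewrite -scaleN1r addrC lf scaleN1r addrC. Qed.

Lemma linear_mx_sum m n m' n' (f : 'M[R]_(m, n) -> 'M[R]_(m', n')) (I : Type)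
    (r : seq I) (F : I -> 'M[R]_(m, n)) :
  linear_mx f -> f (\sum_(i <- r) F i) = \sum_(i <- r) f (F i).
Proof.
move=> lf; elim: r => [|i r ih]; first by rewrite !big_nil linear_mx0.
by rewrite !big_cons linear_mxD// ih.
Qed.

Lemma linear_mx_delta m n m' n' (f : 'M[R]_(m, n) -> 'M[R]_(m', n')) X :
  linear_mx f -> f X = \sum_i \sum_j X i j *: f (delta_mx i j).
Proof.
move=> lf; rewrite [X in LHS]matrix_sum_delta linear_mx_sum//.
apply: eq_bigr => i _; rewrite linear_mx_sum//.
by apply: eq_bigr => j _; rewrite linear_mxZ.
Qed.

Lemma linear_mx_cvg m n m' n' (f : 'M[R]_(m, n) -> 'M[R]_(m', n'))
    {T : Type} {D : set_system T} {FD : Filter D} (g : T -> 'M[R]_(m, n)) X :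
  linear_mx f -> g @ D --> X -> f (g x) @[x --> D] --> f X.
Proof.
move=> lf gX; rewrite (linear_mx_delta X lf).
have -> : (fun x => f (g x)) =
    (fun x => \sum_i \sum_j g x i j *: f (delta_mx i j)).
  by apply/funext => x; rewrite (linear_mx_delta (g x) lf).
apply: cvg_sum => i; apply: cvg_sum => j; apply: cvgZ; last exact: cvg_cst.
by move/cvg_mxP : gX; exact.
Qed.

Lemma linear_mx_bounded m n m' n' (f : 'M[R]_(m, n) -> 'M[R]_(m', n')) :
  linear_mx f -> exists2 c : R, 0 <= c & forall X, `|f X| <= c * `|X|.
Proof.
move=> lf; exists (\sum_(i < m) \sum_(j < n) `|f (delta_mx i j)|).
  by apply: sumr_ge0 => i _; apply: sumr_ge0.
move=> X; rewrite (linear_mx_delta X lf) mulr_suml.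
apply: le_trans (ler_norm_sum _ _ _) _; apply: ler_sum => i _.
rewrite mulr_suml; apply: le_trans (ler_norm_sum _ _ _) _; apply: ler_sum => j _.
by rewrite normrZ mulrC ler_wpM2l// mx_entry_le.
Qed.

Lemma linear_mx_continuous k (f : 'M[R]_k -> 'M[R]_k) : linear_mx f -> continuous f.
Proof.
move=> lf x.
have h := @linear_mx_cvg k k k k f 'M[R]_k (nbhs x) (nbhs_filter x) id x lf.
by apply: h; exact: cvg_id.
Qed.

End LinearMaps.

(** * The Lie algebra of a real algebraic group *)

Section AlgebraicGroup.
Context {R : realType} {k : nat}.
Implicit Types (X Y A : 'M[R]_k) (G : set 'M[R]_k) (B : R -> 'M[R]_k).

Lemma cvg_prod {T : Type} {D : set_system T} {FD : Filter D} (I : Type)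
    (r : seq I) (f : I -> T -> R) (l : I -> R) :
  (forall i, f i @ D --> l i) ->
  (\prod_(i <- r) f i x) @[x --> D] --> \prod_(i <- r) l i.
Proof.
move=> fl; elim: r => [|i r ih].
  rewrite big_nil; under eq_fun do rewrite big_nil; exact: cvg_cst.
rewrite big_cons; under eq_fun do rewrite big_cons.
exact: cvgM.
Qed.

Lemma cvg_exprn {T : Type} {D : set_system T} {FD : Filter D} (f : T -> R)
    (l : R) (j : nat) : f @ D --> l -> (f x ^+ j) @[x --> D] --> l ^+ j.
Proof.
move=> fl; elim: j => [|j ih].
  by rewrite expr0; under eq_fun do rewrite expr0; exact: cvg_cst.
by rewrite exprS; under eq_fun do rewrite exprS; exact: cvgM.
Qed.

Lemma cvg_peval {T : Type} {D : set_system T} {FD : Filter D}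
    (p : mpoly.mpoly (k * k) R) (f : T -> 'M[R]_k) A :
  f @ D --> A -> peval id p (f x) @[x --> D] --> peval id p A.
Proof.
move=> fA; rewrite /peval /mpoly.mmap; apply: cvg_sum => m.
apply: cvgM; first exact: cvg_cst.
rewrite /mpoly.mmap1; apply: cvg_prod => i; apply: cvg_exprn.
case/mxvec_indexP: i => a b; rewrite mxvecE; under eq_fun do rewrite mxvecE.
by move/cvg_mxP : fA; exact.
Qed.

(** Polynomial equations pass to the limit, so an algebraic group is closed in
    GL_k. *)
Lemma algebraic_group_limit G (A_ : nat -> 'M[R]_k) A :
  is_algebraic_group G -> (forall n, G (A_ n)) -> A_ @ \oo --> A ->
  A \in unitmx -> G A.
Proof.
move=> [_ [P GE]] GA AA Au; rewrite GE; split=> // p Pp.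
have h := @cvg_peval _ _ _ p _ _ AA.
suff h0 : peval id p (A_ n) @[n --> \oo] --> (0 : R).
  exact: (cvg_unique (@Rhausdorff R) (h _) h0).
have -> : (fun n => peval id p (A_ n)) = fun=> 0.
  by apply/funext => n; have := GA n; rewrite GE => -[_]; exact.
exact: cvg_cst.
Qed.

Lemma group_exp G A n : is_subgroup G -> G A -> G (A ^+ n).
Proof.
move=> [_ G1 GM _] GA; elim: n => [|n ih]; first by rewrite expr0.
by rewrite exprS; exact: GM.
Qed.

(** B^n stays in the group and tends to exp (t X).  All the closure properties of
    the Lie algebra are proved by giving such a sequence. *)
Lemma lie_of_seq G (B : R -> nat -> 'M[R]_k) X : is_algebraic_group G ->
  (forall t n, G (B t n)) ->
  (forall t, (n%:R *: (B t n - 1)) @[n --> \oo] --> t *: X) -> lie_of G X.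
Proof.
move=> hG GB BX t; apply: (algebraic_group_limit hG _ (expmx_pow_cvg (BX t))).
  by move=> n; apply: group_exp; [case: hG | exact: GB].
exact: expmx_unit.
Qed.

Lemma expmx_quotient_le X (s : R) : s != 0 -> k%:R * (`|s| * `|X|) <= 1 ->
  `|X - s^-1 *: (expmx (s *: X) - 1)| <= `|s| * (expR 1 * (k%:R * `|X|) * `|X|).
Proof.
move=> s0 kX; have kZ : k%:R * `|s *: X| <= k%:R * (`|s| * `|X|) by rewrite normrZ.
have k0 : k%:R * `|0 : 'M[R]_k| <= k%:R * (`|s| * `|X|) by rewrite normr0 mulr0 !mulr_ge0.
have := expmx_lipschitz kX kZ k0; rewrite expmx0 subr0 => H.
have -> : X - s^-1 *: (expmx (s *: X) - 1) = - (s^-1 *: (expmx (s *: X) - 1 - s *: X)).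
  by rewrite [in RHS]scalerBr scalerA mulVf// scale1r opprB.
rewrite normrN normrZ normfV ler_pdivrMl ?normr_gt0//.
apply: le_trans H _; rewrite normrZ le_eqVlt; apply/orP; left; apply/eqP; ring.
Qed.

Lemma cvg_expmx_quotient X :
  (h^-1 *: (expmx (h *: X) - 1)) @[h --> (0 : R)^'] --> X.
Proof.
apply/cvgrPdist_le => e e0.
pose c := k%:R * `|X|; have c0 : 0 <= c by rewrite mulr_ge0.
pose d := expR 1 * c * `|X|; have d0 : 0 <= d by rewrite !mulr_ge0// expR_ge0.
near=> h.
have h0 : h != 0 by near: h; exact: nbhs_dnbhs_neq.
have hc : `|h| * (c + 1) <= 1.
  rewrite -ler_pdivlMr ?ltr_wpDl//; near: h; apply: dnbhs0_le.
  by rewrite divr_gt0// ltr_wpDl.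
have hd : `|h| * (d + 1) <= e.
  rewrite -ler_pdivlMr ?ltr_wpDl//; near: h; apply: dnbhs0_le.
  by rewrite divr_gt0// ltr_wpDl.
apply: le_trans (expmx_quotient_le h0 _) _.
  by rewrite mulrCA; apply: le_trans hc; rewrite mulrDr mulr1 lerDl.
by apply: le_trans hd; rewrite mulrDr mulr1 lerDl.
Unshelve. all: by end_near. Qed.

Lemma cvg_natZ_expmx (X_ : nat -> 'M[R]_k) X : X_ @ \oo --> X ->
  (n%:R *: (expmx (n%:R^-1 *: X_ n) - 1)) @[n --> \oo] --> X.
Proof.
move=> XX; pose M := `|X| + 1; have M0 : 0 <= M by rewrite addr_ge0.
apply/cvgrPdist_le => e e0.
pose c := k%:R * M; have c0 : 0 <= c by rewrite mulr_ge0.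
pose d := expR 1 * c * M; have d0 : 0 <= d by rewrite !mulr_ge0// expR_ge0.
have invn_le (a : R) : 0 < a -> \forall n \near \oo, n%:R^-1 <= a.
  move=> a0; have /cvgrPdist_le/(_ _ a0) := @cvg_invn R.
  by apply: filterS => n; rewrite sub0r normrN ger0_norm.
near=> n.
have n0 : (n%:R^-1 : R) != 0.
  by rewrite invr_eq0 pnatr_eq0 -lt0n; near: n; exact: nbhs_infty_gt.
have XnM : `|X_ n| <= M.
  by near: n; move/cvgr_norm_le : XX; apply; rewrite ltrDl.
have XnX : `|X - X_ n| <= e / 2.
  by near: n; move/cvgrPdist_le : XX; apply; rewrite divr_gt0.
have hc : n%:R^-1 * (c + 1) <= 1.
  rewrite -ler_pdivlMr ?ltr_wpDl//; near: n; apply: invn_le.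
  by rewrite divr_gt0// ltr_wpDl.
have hd : n%:R^-1 * (d + 1) <= e / 2.
  rewrite -ler_pdivlMr ?ltr_wpDl//; near: n; apply: invn_le.
  by rewrite divr_gt0 ?divr_gt0// ltr_wpDl.
have kX : k%:R * `|X_ n| <= c by rewrite ler_wpM2l.
have q := expmx_quotient_le (X := X_ n) n0; rewrite invrK ger0_norm ?invr_ge0// in q.
rewrite -[X](subrK (X_ n)) -addrA.
apply: le_trans (ler_normD _ _) _; rewrite (splitr e) lerD//.
apply: le_trans (q _) _.
  rewrite mulrCA; apply: le_trans hc; rewrite ler_wpM2l ?invr_ge0//.
  by apply: le_trans kX _; rewrite lerDl.
apply: le_trans hd; rewrite ler_wpM2l ?invr_ge0//.
apply: (@le_trans _ _ d); last by rewrite lerDl.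
by rewrite ler_pM// ?mulr_ge0 ?expR_ge0// ler_wpM2l// expR_ge0.
Unshelve. all: by end_near. Qed.

Lemma lie_of_limit G (X_ : nat -> 'M[R]_k) X : is_algebraic_group G ->
  (forall n, lie_of G (X_ n)) -> X_ @ \oo --> X -> lie_of G X.
Proof.
move=> hG GX XX; apply: (lie_of_seq (B := fun t n => expmx (n%:R^-1 *: (t *: X_ n)))) => //.
  by move=> t n; rewrite scalerA; exact: GX.
by move=> t; apply: cvg_natZ_expmx; apply: cvgZ => //; exact: cvg_cst.
Qed.

Lemma cvg_expmx_invn X : expmx (n%:R^-1 *: X) @[n --> \oo] --> (1 : 'M[R]_k).
Proof.
have h := cvg_natZ_expmx (cvg_cst X).
have : (1 + n%:R^-1 *: (n%:R *: (expmx (n%:R^-1 *: X) - 1)) : 'M[R]_k)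
    @[n --> \oo] --> (1 + (0 : R) *: X : 'M[R]_k).
  apply: cvgD; first exact: cvg_cst.
  by apply: cvgZ; [exact: cvg_invn | exact: h].
rewrite scale0r addr0; apply: cvg_trans; apply: near_eq_cvg.
exists 1%N => // n /= n0.
by rewrite scalerA mulVf ?scale1r ?pnatr_eq0 -?lt0n// addrC subrK.
Qed.

Lemma lie_of_scale G X a : lie_of G X -> lie_of G (a *: X).
Proof. by move=> h t; rewrite scalerA; exact: h. Qed.

Lemma lie_of_add G X Y : is_algebraic_group G ->
  lie_of G X -> lie_of G Y -> lie_of G (X + Y).
Proof.
move=> hG GX GY.
pose B t n : 'M[R]_k := expmx (n%:R^-1 *: (t *: X)) *m expmx (n%:R^-1 *: (t *: Y)).
apply: (lie_of_seq (B := B)) => // [t n|t].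
  by case: hG => -[_ _ GM _] _; apply: GM; rewrite scalerA; [exact: GX|exact: GY].
have -> : (fun n => n%:R *: (B t n - 1)) = (fun n =>
    (n%:R *: (expmx (n%:R^-1 *: (t *: X)) - 1)) *m expmx (n%:R^-1 *: (t *: Y)) +
    n%:R *: (expmx (n%:R^-1 *: (t *: Y)) - 1)).
  apply/funext => n; rewrite /B -scalemxAl -scalerDr mulmxBl mul1mx addrA.
  by rewrite subrK.
rewrite scalerDr -[X in _ --> X + _]mulmx1; apply: cvgD.
  apply: cvg_mulmx; last exact: cvg_expmx_invn.
  by apply: cvg_natZ_expmx; exact: cvg_cst.
by apply: cvg_natZ_expmx; exact: cvg_cst.
Qed.

Lemma lie_of_sub G X Y : is_algebraic_group G ->
  lie_of G X -> lie_of G Y -> lie_of G (X - Y).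
Proof.
move=> hG GX GY; rewrite -[- Y]scaleN1r.
by apply: lie_of_add => //; exact: lie_of_scale.
Qed.

Lemma lie_of_0 G : is_subgroup G -> lie_of G 0.
Proof. by move=> [_ G1 _ _] t; rewrite scaler0 expmx0. Qed.

Lemma lie_of_subspace G : is_algebraic_group G -> is_subspace (lie_of G).
Proof.
move=> hG; split; first by apply: lie_of_0; case: hG.
by move=> a X Y GX GY; apply: lie_of_add => //; exact: lie_of_scale.
Qed.

Lemma lie_of_conj G g X : is_subgroup G -> G g -> lie_of G X ->
  lie_of G (g *m X *m invmx g).
Proof.
move=> [Gu _ GM GV] Gg GX t; have gu := Gu _ Gg.
rewrite scalemxAl scalemxAr expmx_conj//.
by apply: (GM); [apply: (GM) => //; exact: GX | exact: GV].
Qed.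

(** The derivative at 0 of s |-> exp(s X) Y exp(- s X), along s = 1 / n. *)
Lemma cvg_conj_quotient X Y :
  (n%:R *: (expmx (n%:R^-1 *: X) *m Y *m expmx (n%:R^-1 *: - X) - Y))
    @[n --> \oo] --> lieb X Y.
Proof.
pose E (X : 'M[R]_k) n : 'M[R]_k := expmx (n%:R^-1 *: X).
rewrite -/(E X) -/(E (- X)).
have -> : (fun n => n%:R *: (E X n *m Y *m E (- X) n - Y)) = (fun n =>
    (n%:R *: (E X n - 1)) *m Y *m E (- X) n + Y *m (n%:R *: (E (- X) n - 1))).
  apply/funext => n; rewrite -!scalemxAl -scalemxAr -scalerDr mulmxBr mulmx1.
  by rewrite !mulmxBl mul1mx addrA subrK.
have -> : lieb X Y = X *m Y *m 1 + Y *m (- X) by rewrite mulmx1 mulmxN.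
have hE (Z : 'M[R]_k) : (n%:R *: (E Z n - 1)) @[n --> \oo] --> Z.
  by apply: cvg_natZ_expmx; exact: cvg_cst.
apply: cvgD.
  apply: cvg_mulmx; last exact: cvg_expmx_invn.
  by apply: cvg_mulmx; [exact: hE | exact: cvg_cst].
by apply: cvg_mulmx; [exact: cvg_cst | exact: hE].
Qed.

Lemma lie_of_lieb G X Y : is_algebraic_group G ->
  lie_of G X -> lie_of G Y -> lie_of G (lieb X Y).
Proof.
move=> hG GX GY; apply: (lie_of_limit hG _ (@cvg_conj_quotient X Y)) => n.
apply: lie_of_scale; apply: lie_of_sub => //.
by rewrite scalerN -invmx_expmx; apply: lie_of_conj => //; case: hG.
Qed.

End AlgebraicGroup.

(** * Differentials of regular maps at the identity *)

Section RegularMaps.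
Context {R : realType} {k : nat}.
Implicit Types (X Y A : 'M[R]_k) (B : R -> 'M[R]_k).

Definition curve_at1 B X : Prop :=
  B 0 = 1%:M /\ forall i j, is_derive (0 : R) (1 : R) (fun t => B t i j) (X i j).

(** Differentiability at 1, with differential l, tested on curves only: this is
    all that the chain rule along one-parameter groups asks for, and it passes
    to polynomials and quotients by easy algebra. *)
Definition diff_at1 (f : 'M[R]_k -> R) (l : 'M[R]_k -> R) : Prop :=
  (forall a X Y, l (a *: X + Y) = a * l X + l Y) /\
  forall B X, curve_at1 B X -> is_derive (0 : R) (1 : R) (fun t => f (B t)) (l X).

Lemma diff_at1_cst a : diff_at1 (fun=> a) (fun=> 0).
Proof.
split=> [b X Y|B X hB]; first by rewrite mulr0 addr0.
exact: is_derive_cst.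
Qed.

Lemma diff_at1_coord i j : diff_at1 (fun A => A i j) (fun X => X i j).
Proof. by split=> [b X Y|B X [_]]; [rewrite !mxE|exact]. Qed.

Lemma diff_at1_add f g l m : diff_at1 f l -> diff_at1 g m ->
  diff_at1 (fun A => f A + g A) (fun X => l X + m X).
Proof.
move=> [lin1 d1] [lin2 d2]; split=> [b X Y|B X hB].
  by rewrite lin1 lin2 mulrDr addrACA.
by apply: is_deriveD; [exact: d1|exact: d2].
Qed.

Lemma diff_at1_mul f g l m : diff_at1 f l -> diff_at1 g m ->
  diff_at1 (fun A => f A * g A) (fun X => f 1%:M * m X + g 1%:M * l X).
Proof.
move=> [lin1 d1] [lin2 d2]; split=> [b X Y|B X hB].
  by rewrite lin1 lin2; ring.
have := @is_deriveM R R^o _ _ 0 1 _ _ (d1 _ _ hB) (d2 _ _ hB).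
by case: hB => -> _.
Qed.

Lemma diff_at1_sum (I : Type) (r : seq I) (f : I -> 'M[R]_k -> R) :
  (forall i, exists l, diff_at1 (f i) l) ->
  exists l, diff_at1 (fun A => \sum_(i <- r) f i A) l.
Proof.
move=> h; elim: r => [|i r [l hl]].
  by exists (fun=> 0); under eq_fun do rewrite big_nil; exact: diff_at1_cst.
have [m hm] := h i; eexists; under eq_fun do rewrite big_cons.
exact: diff_at1_add hm hl.
Qed.

Lemma diff_at1_prod (I : Type) (r : seq I) (f : I -> 'M[R]_k -> R) :
  (forall i, exists l, diff_at1 (f i) l) ->
  exists l, diff_at1 (fun A => \prod_(i <- r) f i A) l.
Proof.
move=> h; elim: r => [|i r [l hl]].
  by exists (fun=> 0); under eq_fun do rewrite big_nil; exact: diff_at1_cst.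
have [m hm] := h i; eexists; under eq_fun do rewrite big_cons.
exact: diff_at1_mul hm hl.
Qed.

Lemma diff_at1_exprn f l n : diff_at1 f l -> exists m, diff_at1 (fun A => f A ^+ n) m.
Proof.
move=> h; elim: n => [|n [m hm]].
  by exists (fun=> 0); exact: diff_at1_cst.
by eexists; under eq_fun do rewrite exprS; exact: diff_at1_mul h hm.
Qed.

Lemma diff_at1_inv f l : f 1%:M != 0 -> diff_at1 f l ->
  exists m, diff_at1 (fun A => (f A)^-1) m.
Proof.
move=> f1 [lin d]; exists (fun X => - (f 1%:M) ^- 2 * l X); split=> [b X Y|B X hB].
  by rewrite lin; ring.
have fB : f (B 0) != 0 by case: hB => ->.
have := is_deriveV fB (d _ _ hB).
by case: hB => -> _.
Qed.

Lemma diff_at1_peval (p : mpoly.mpoly (k * k) R) : exists l, diff_at1 (peval id p) l.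
Proof.
apply: diff_at1_sum => m.
have [l hl] : exists l, diff_at1 (fun A : 'M[R]_k => mpoly.mmap1 (fun j => mxvec A 0 j) m) l.
  apply: diff_at1_prod => i; case/mxvec_indexP: i => a b.
  have -> : (fun A : 'M[R]_k => mxvec A 0 (mxvec_index a b) ^+ m (mxvec_index a b)) =
      (fun A => A a b ^+ m (mxvec_index a b)) by apply/funext => A; rewrite mxvecE.
  exact: diff_at1_exprn (diff_at1_coord a b).
by eexists; exact: diff_at1_mul (diff_at1_cst _) hl.
Qed.

Lemma diff_at1_det : exists l, diff_at1 (fun A => \det A) l.
Proof.
apply: diff_at1_sum => s.
have [l hl] : exists l, diff_at1 (fun A : 'M[R]_k => \prod_i A i (perm.fun_of_perm s i)) l.
  by apply: diff_at1_prod => i; eexists; exact: diff_at1_coord.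
by eexists; exact: diff_at1_mul (diff_at1_cst _) hl.
Qed.

Lemma diff_at1_regR n (r : regular_map R k n) i j :
  exists l, diff_at1 (fun A => regR r A i j) l.
Proof.
have [l hl] : exists l, diff_at1 (fun A : 'M[R]_k => (\det A) ^+ reg_exp r) l.
  by have [l hl] := diff_at1_det; exact: diff_at1_exprn hl.
have [l' hl'] : exists l, diff_at1 (fun A : 'M[R]_k => (\det A) ^- reg_exp r) l.
  by apply: diff_at1_inv hl; rewrite det1 expr1n oner_neq0.
have [m hm] := diff_at1_peval (reg_num r i j).
eexists; under eq_fun do rewrite /regR /reg_eval !mxE.
exact: diff_at1_mul hl' hm.
Qed.

Lemma curve_expmx X : curve_at1 (fun t => expmx (t *: X)) X.
Proof.
split=> [|i j]; first by rewrite scale0r expmx0.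
have /cvg_mxP/(_ i j) h := @cvg_expmx_quotient R k X.
have {}h : (h^-1 *: ((fun t => expmx (t *: X) i j) (h *: 1 + 0) -
    (fun t => expmx (t *: X) i j) 0)) @[h --> (0 : R)^'] --> X i j.
  apply: cvg_trans h; apply: near_eq_cvg; near=> t.
  by rewrite /= scale0r expmx0 addr0 [t *: 1]mulr1 !mxE.
by split; [apply/cvg_ex; exists (X i j) | apply/cvg_lim].
Unshelve. all: by end_near. Qed.

Lemma regdiff_coord n (r : regular_map R k n) i j :
  diff_at1 (fun A => regR r A i j) (fun X => regdiff r X i j).
Proof.
have regdiffE X i' j' l : diff_at1 (fun A => regR r A i' j') l -> regdiff r X i' j' = l X.
  move=> [_ d]; rewrite /regdiff derive1E derive_mx.
    by rewrite mxE; have [_ <-] := d _ _ (curve_expmx X).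
  apply/derivable_mxP => a b; have [m [_ dm]] := diff_at1_regR r a b.
  by case: (dm _ _ (curve_expmx X)).
have [l hl] := diff_at1_regR r i j.
have e : (fun X => regdiff r X i j) = l by apply/funext => X; exact: regdiffE.
by rewrite e.
Qed.

Lemma regdiff_linear n (r : regular_map R k n) : linear_mx (regdiff r).
Proof.
move=> a X Y; apply/matrixP => i j; have [lin _] := regdiff_coord r i j.
by rewrite lin !mxE.
Qed.

End RegularMaps.

(** * The differential of a representation *)

Section Differential.
Context {R : realType}.

Lemma cvg_invn_dnbhs : (n%:R^-1 : R) @[n --> \oo] --> (0 : R)^'.
Proof.
move=> A [e /= e0 eA]; change (\forall n \near \oo, A (n%:R^-1)); near=> n.
have n0 : (0 < n)%N by near: n; exact: nbhs_infty_gt.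
apply: eA => /=; last by rewrite invr_eq0 pnatr_eq0 -lt0n.
by near: n; have /cvgrPdist_lt := @cvg_invn R; exact.
Unshelve. all: by end_near. Qed.

Lemma is_derive_seq (f : R -> R) (d : R) : is_derive (0 : R) (1 : R) f d ->
  (n%:R * (f n%:R^-1 - f 0)) @[n --> \oo] --> d.
Proof.
move=> [/cvg_ex[/= l fl] <-].
have -> : 'D_1 f 0 = l by apply/cvg_lim => //; exact: Rhausdorff.
have := cvg_comp _ _ cvg_invn_dnbhs fl.
apply: cvg_trans; apply: near_eq_cvg; near=> n => /=.
by rewrite invrK addr0 [_ *: 1]mulr1.
Unshelve. all: by end_near. Qed.

Context {k n : nat} (G : set 'M[R]_k) (r : regular_map R k n).
Hypothesis hG : is_algebraic_group G.
Hypothesis rM : forall A B, G A -> G B -> regR r (A *m B) = regR r A *m regR r B.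
Hypothesis rU : forall A, G A -> regR r A \in unitmx.

Lemma regR1 : regR r 1%:M = 1%:M.
Proof.
have G1 : G 1%:M by case: hG => -[].
have := rM G1 G1; rewrite mulmx1 => /(congr1 (fun A => invmx (regR r 1%:M) *m A)).
by rewrite mulmxA !mulVmx ?mul1mx ?rU.
Qed.

Lemma regRV A : G A -> regR r (invmx A) = invmx (regR r A).
Proof.
move=> GA; have [Gu G1 GM GV] := hG.1.
have := rM (GV _ GA) GA; rewrite mulVmx ?regR1; last exact: Gu.
move=> /(congr1 (fun B => B *m invmx (regR r A))).
by rewrite mul1mx mulmxK ?rU// => ->.
Qed.

Lemma regRX A j : G A -> regR r (A ^+ j) = regR r A ^+ j.
Proof.
move=> GA; elim: j => [|j ih]; first by rewrite !expr0 regR1.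
by rewrite !exprS !mx_mulE rM ?ih//; apply: group_exp => //; case: hG.
Qed.

Lemma cvg_regR_quotient X :
  (j%:R *: (regR r (expmx (j%:R^-1 *: X)) - 1)) @[j --> \oo] --> regdiff r X.
Proof.
apply/cvg_mxP => a b.
have := is_derive_seq ((regdiff_coord r a b).2 _ _ (curve_expmx X)).
apply: cvg_trans; apply: near_eq_cvg; near=> j.
by rewrite scale0r expmx0 regR1 !mxE.
Unshelve. all: by end_near. Qed.

Lemma scale_conjB1 m (a : R) (P A Q : 'M[R]_m) : P *m Q = 1%:M ->
  a *: (P *m A *m Q - 1) = P *m (a *: (A - 1)) *m Q.
Proof.
by move=> PQ; rewrite -scalemxAr -scalemxAl mulmxBr mulmxBl mulmx1 PQ.
Qed.

Lemma expmxMn m (X : 'M[R]_m) j : expmx X ^+ j = expmx (j%:R *: X).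
Proof.
elim: j => [|j ih]; first by rewrite scale0r expmx0.
rewrite exprS mx_mulE ih -expmxD ?scalemxAr ?scalemxAl//.
by rewrite -{1}[X]scale1r -scalerDl nat1r.
by rewrite -scalemxAr -scalemxAl.
Qed.

(** Both sides are the limit of the n-th powers of r (exp (X / n)). *)
Lemma regR_expmx X : lie_of G X -> regR r (expmx X) = expmx (regdiff r X).
Proof.
move=> GX; have h := expmx_pow_cvg (@cvg_regR_quotient X).
apply: (cvg_unique _ _ h) => //.
apply: cvg_near_cst.
exists 1%N => // j /= j0; rewrite -regRX; last exact: GX.
by rewrite expmxMn scalerA divff ?scale1r// pnatr_eq0 -lt0n.
Qed.

Lemma regdiff_conj g X : G g -> lie_of G X ->
  regdiff r (g *m X *m invmx g) = regR r g *m regdiff r X *m invmx (regR r g).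
Proof.
move=> Gg GX; have [Gu G1 GM GV] := hG.1; have gu := Gu _ Gg.
apply: (cvg_unique _ (@cvg_regR_quotient _)) => //.
have -> : (fun j => j%:R *: (regR r (expmx (j%:R^-1 *: (g *m X *m invmx g))) - 1)) =
    (fun j => regR r g *m (j%:R *: (regR r (expmx (j%:R^-1 *: X)) - 1)) *m
      invmx (regR r g)).
  apply/funext => j; rewrite scalemxAl scalemxAr expmx_conj//.
  have GE : G (expmx (j%:R^-1 *: X)) by exact: GX.
  rewrite !rM ?regRV//; last 2 first.
    exact: GM.
    exact: GV.
  by rewrite scale_conjB1// mulmxV ?rU.
apply: cvg_mulmx; last exact: cvg_cst.
by apply: cvg_mulmx; [exact: cvg_cst | exact: cvg_regR_quotient].
Qed.

(** Differentiate the equivariance regdiff_conj along exp (s X). *)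
Lemma regdiff_lieb X Y : lie_of G X -> lie_of G Y ->
  regdiff r (lieb X Y) = lieb (regdiff r X) (regdiff r Y).
Proof.
move=> GX GY.
have h := linear_mx_cvg (regdiff_linear r) (@cvg_conj_quotient R k X Y).
apply: (cvg_unique _ (h _)) => //.
have -> : (fun j => regdiff r (j%:R *: (expmx (j%:R^-1 *: X) *m Y *m
      expmx (j%:R^-1 *: - X) - Y))) =
    (fun j => j%:R *: (expmx (j%:R^-1 *: regdiff r X) *m regdiff r Y *m
      expmx (j%:R^-1 *: - regdiff r X) - regdiff r Y)).
  apply/funext => j; rewrite (linear_mxZ _ _ (regdiff_linear r)); congr (_ *: _).
  have GE : G (expmx (j%:R^-1 *: X)) by exact: GX.
  rewrite -[- Y]scaleN1r linear_mxD ?(linear_mxZ _ _ (regdiff_linear r)) ?scaleN1r//; last first.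
    exact: regdiff_linear.
  rewrite !scalerN -!invmx_expmx regdiff_conj// regR_expmx; last exact: lie_of_scale.
  by rewrite (linear_mxZ _ _ (regdiff_linear r)).
exact: cvg_conj_quotient.
Qed.

End Differential.

(** * One-parameter groups are exponentials *)

Section OneParameter.
Context {R : realType}.

Lemma is_derive0_eq (f : R -> R) (a b : R) : a < b ->
  (forall x, x \in `[a, b] -> is_derive x (1 : R) f 0) -> f a = f b.
Proof.
move=> ab df.
have h1 x : x \in `]a, b[ -> is_derive x (1 : R) f 0.
  by move=> xab; apply: df; exact: subset_itv_oo_cc.
have h2 : {within `[a, b], continuous f}.
  by apply: derivable_within_continuous => x xab; case: (df _ xab).
have [x _ e] := MVT ab h1 h2.
by move: e; rewrite mul0r => /subr0_eq.
Qed.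

Lemma exists_primitive (f : R -> R) (a b : R) : continuous f ->
  exists F : R -> R, forall x, a < x -> x < b -> is_derive x (1 : R) F (f x).
Proof.
move=> cf; exists (fun x => \int[lebesgue_measure]_(t in `[a, x]) f t)%R => x ax xb.
have [] := @continuous_FTC1_closed R f a x b xb _ ax (cf x).
  apply: continuous_compact_integrable; first exact: segment_compact.
  exact: continuous_subspaceT.
move=> dF F'; apply: (DeriveDef dF); rewrite -derive1E; exact: F'.
Qed.

Lemma cvg_det {T : Type} {D : set_system T} {FD : Filter D} k
    (f : T -> 'M[R]_k) (l : 'M[R]_k) :
  f @ D --> l -> \det (f x) @[x --> D] --> \det l.
Proof.
move=> fl; rewrite /determinant; apply: cvg_sum => s.
apply: cvgM; first exact: cvg_cst.
by apply: cvg_prod => i; move/cvg_mxP : fl; exact.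
Qed.

Lemma is_derive_curve_seq k (c : R -> 'M[R]_k) X :
  curve_at1 c X -> (n%:R *: (c n%:R^-1 - 1)) @[n --> \oo] --> X.
Proof.
move=> [c0 dc]; apply/cvg_mxP => i j.
have := is_derive_seq (dc i j); rewrite c0.
apply: cvg_trans; apply: near_eq_cvg; near=> n.
by rewrite !mxE.
Unshelve. all: by end_near. Qed.

Lemma is_derive_mulmx_cst m k p (A : 'M[R]_(m, k)) (c : R -> 'M[R]_(k, p))
    (X : 'M[R]_(k, p)) (x : R) :
  (forall i j, is_derive x (1 : R) (fun t => c t i j) (X i j)) ->
  forall i j, is_derive x (1 : R) (fun t => (A *m c t) i j) ((A *m X) i j).
Proof.
move=> dc i j; rewrite mxE; under eq_fun do rewrite mxE.
have := @is_derive_sum R R R^o k (fun l t => A i l * c t l j) x 1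
  (fun l => A i l * X l j).
move=> H.
have {}H : is_derive x 1 (\sum_(l < k) (fun t => A i l * c t l j))
    (\sum_(l < k) A i l * X l j).
  by apply: H => l; have := @is_deriveZ R R R^o _ (A i l) x 1 _ (dc l j).
rewrite (_ : \sum_(l < k) _ = fun t => \sum_(l < k) A i l * c t l j) in H => //.
by apply/funext => t; rewrite fct_sumE.
Qed.

Lemma is_derive_mulmxr_cst m k p (A : 'M[R]_(k, p)) (c : R -> 'M[R]_(m, k))
    (X : 'M[R]_(m, k)) (x : R) :
  (forall i j, is_derive x (1 : R) (fun t => c t i j) (X i j)) ->
  forall i j, is_derive x (1 : R) (fun t => (c t *m A) i j) ((X *m A) i j).
Proof.
move=> dc i j.
have -> : (fun t => (c t *m A) i j) = (fun t => (A^T *m (c t)^T) j i).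
  by apply/funext => t; rewrite -trmx_mul [in RHS]mxE.
have -> : (X *m A) i j = (A^T *m X^T) j i by rewrite -trmx_mul [in RHS]mxE.
apply: is_derive_mulmx_cst => a b; rewrite mxE.
by under eq_fun do rewrite mxE.
Qed.

(** If F is a primitive of c, then (F s - F 0) c(t) = F (s + t) - F t; for small
    s > 0 the factor F s - F 0 is invertible, being close to s times the
    identity, and so c is differentiable. *)
Theorem one_parameter_group k (c : R -> 'M[R]_k) :
  (forall s t, c (s + t) = c s *m c t) -> c 0 = 1%:M ->
  (forall i j, continuous (fun t => c t i j)) ->
  exists X, curve_at1 c X /\ forall t, c t = expmx (t *: X).
Proof.
move=> cD c0 cc.
have exF i j := exists_primitive (-1) 2 (cc i j).
pose F t : 'M[R]_k := \matrix_(i, j) projT1 (cid (exF i j)) t.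
have dF (x : R) : -1 < x -> x < 2 ->
    forall i j, is_derive x (1 : R) (fun t => F t i j) (c x i j).
  move=> x1 x2 i j; under eq_fun do rewrite mxE.
  by apply: (projT2 (cid (exF i j))).
move: F dF => F dF.
have FD (s t : R) : 0 < s -> s < 1 -> -1 < t -> t < 1 ->
    (F s - F 0) *m c t = F (s + t) - F t.
  move=> s0 s1 t1 t2; apply/matrixP => i j.
  pose h x := F (x + t) i j - (F x *m c t) i j.
  have : h 0 = h s.
    apply: is_derive0_eq => // x; rewrite in_itv/= => /andP[x0 xs].
    have d1 : is_derive x (1 : R) (fun x => F (x + t) i j) (c (x + t) i j).
      have := @is_derive1_comp R (fun x => F x i j) (shift t) x _ _
        (dF (x + t) _ _ i j) (is_derive_shift x 1 t).
      rewrite mulr1; apply; lra.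
    have d2 : is_derive x (1 : R) (fun x => (F x *m c t) i j) ((c x *m c t) i j).
      by apply: is_derive_mulmxr_cst; apply: dF; lra.
    by have := is_deriveB d1 d2; rewrite cD subrr.
  rewrite /h add0r mulmxBl !mxE; lra.
have [s [s0 s1 sU]] : exists s, [/\ 0 < s, s < 1 & F s - F 0 \in unitmx].
  have h : (h^-1 *: (F h - F 0)) @[h --> (0 : R)^'] --> (1%:M : 'M[R]_k).
    apply/cvg_mxP => i j.
    have [/cvg_ex[/= l hl]] := dF 0 (ltrN10 R) (ltr0Sn R 1) i j.
    have -> : 'D_1 (fun t => F t i j) 0 = l by apply/cvg_lim => //; exact: Rhausdorff.
    rewrite c0 => <-; apply: cvg_trans hl; apply: near_eq_cvg; near=> t.
    by rewrite addr0 [_ *: 1]mulr1 !mxE.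
  have hdet : \det (s^-1 *: (F s - F 0)) @[s --> (0 : R)^'+] --> \det (1%:M : 'M[R]_k).
    by apply: cvg_dnbhs_at_right; exact: cvg_det.
  move/cvgrPdist_lt : hdet => /(_ _ ltr01) hd.
  near (0 : R)^'+ => s; exists s; split.
  - by near: s; exact: nbhs_right_gt.
  - by near: s; apply: nbhs_right_lt.
  - have : `|\det (1%:M : 'M[R]_k) - \det (s^-1 *: (F s - F 0))| < 1 by near: s.
    rewrite det1 detZ unitmxE unitfE; apply: contraTneq => ->.
    by rewrite mulr0 subr0 normr1 ltxx.
have cE (t : R) : -1 < t -> t < 1 -> c t = invmx (F s - F 0) *m (F (s + t) - F t).
  by move=> t1 t2; rewrite -FD// mulKmx.
pose X := invmx (F s - F 0) *m (c s - c 0).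
have dc : curve_at1 c X.
  split=> // i j.
  have d : is_derive (0 : R) (1 : R)
      (fun t => (invmx (F s - F 0) *m (F (s + t) - F t)) i j) (X i j).
    apply: is_derive_mulmx_cst => a b.
    have d1 : is_derive (0 : R) (1 : R) (fun x => F (s + x) a b) (c s a b).
      have := @is_derive1_comp R (fun x => F x a b) (shift s) 0 _ _
        (dF (0 + s) _ _ a b) (is_derive_shift 0 1 s).
      have -> : (fun x => F (s + x) a b) = (fun x => F x a b) \o shift s.
        by apply/funext => x /=; rewrite addrC.
      rewrite mulr1 add0r; apply; lra.
    have d2 := dF 0 (ltrN10 R) (ltr0Sn R 1) a b.
    have -> : (c s - c 0) a b = c s a b - c 0 a b by rewrite !mxE.
    have -> : (fun t => (F (s + t) - F t) a b) =
        (fun t => F (s + t) a b) - (fun t => F t a b).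
      by apply/funext => t; rewrite !mxE.
    exact: is_deriveB.
  apply: (near_eq_is_derive _ d); near=> t.
  have t1 : t < 1 by near: t; apply: lt_nbhsl; exact: ltr01.
  have t2 : - t < 1 by near: t; apply: Nlt_nbhsl; rewrite oppr0; exact: ltr01.
  by rewrite cE// ltrNl.
exists X; split=> // t.
have h : (n%:R *: (c (n%:R^-1 * t) - 1)) @[n --> \oo] --> t *: X.
  apply: (@is_derive_curve_seq _ (fun u => c (u * t))); split=> [|i j].
    by rewrite mul0r.
  have du : is_derive (0 : R) (1 : R) (fun u : R => u * t) t.
    have := @is_deriveZ R R R^o id t 0 1 1 (is_derive_id _ _).
    rewrite (_ : t *: (1 : R^o) = t) ?[_ *: _]mulr1//.
    by rewrite (_ : t \*: id = ( *%R^~ t))//; apply/funext => u /=; exact: mulrC.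
  have := @is_derive1_comp R (fun x => c x i j) (fun u => u * t) 0 _ _ _ du.
  by rewrite mul0r mxE mulrC; apply; exact: dc.2.
apply/esym; apply: (cvg_unique _ (expmx_pow_cvg h)) => //.
apply: cvg_near_cst; exists 1%N => // n /= n0.
(* c (t / n)^n is c t, and it tends to exp (t X). *)
have cX u m : c u ^+ m = c (m%:R * u).
  elim: m => [|m ih]; first by rewrite mul0r c0.
  by rewrite exprS ih mx_mulE -cD mulrS mulrDl mul1r.
by rewrite cX mulrA divff ?mul1r// pnatr_eq0 -lt0n.
Unshelve. all: by end_near. Qed.

End OneParameter.

(** * The unit circle *)

Section Circle.
Context {R : realType}.

Definition cis (t : R) : R[i] := (cos t +i* sin t)%C.

Lemma cis0 : cis 0 = 1.
Proof. by rewrite /cis cos0 sin0. Qed.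

Lemma cisD s t : cis (s + t) = cis s * cis t.
Proof. by rewrite /cis cosD sinD; congr (_ +i* _)%C; rewrite addrC. Qed.

Lemma norm_cis t : `|cis t| = 1.
Proof. by rewrite normc_def /= cos2Dsin2 sqrtr1. Qed.

Lemma cis_neq0 t : cis t != 0.
Proof. by rewrite -normr_eq0 norm_cis oner_neq0. Qed.

Lemma cisN t : cis (- t) = (cis t)^-1.
Proof.
by apply: (mulfI (cis_neq0 t)); rewrite -cisD subrr cis0 mulfV// cis_neq0.
Qed.

Lemma cis_exprz t (d : int) : cis t ^ d = cis (d%:~R * t).
Proof.
have nat_case (j : nat) : cis t ^+ j = cis (j%:R * t).
  elim: j => [|j ih]; first by rewrite mul0r cis0.
  by rewrite exprS ih -cisD mulrS mulrDl mul1r.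
case: d => j; first exact: nat_case.
by rewrite NegzE -exprnN nat_case -cisN mulrNz mulNr.
Qed.

Lemma cis_continuous (t : R) : (cis s : R[i]^o) @[s --> t] --> (cis t : R[i]^o).
Proof.
apply/cvgrPdist_lt => -[e e']; rewrite ltcE/= => /andP[/eqP e'0 e0]; rewrite e'0.
have e2 : 0 < e / 2 by rewrite divr_gt0.
have /cvgrPdist_lt/(_ _ e2) hc := @continuous_cos R t.
have /cvgrPdist_lt/(_ _ e2) hs := @continuous_sin R t.
near=> s.
rewrite normc_def ltcE/= eqxx/=.
have h1 : `|cos t - cos s| < e / 2 by near: s.
have h2 : `|sin t - sin s| < e / 2 by near: s.
rewrite -(ltr_sqr (sqrtr_ge0 _)) ?nnegrE ?ltW//.
rewrite sqr_sqrtr ?addr_ge0 ?sqr_ge0//.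
rewrite -[_ ^+ 2 in X in X + _](real_normK (num_real _)).
rewrite -[_ ^+ 2 in X in _ + X](real_normK (num_real _)).
have := normr_ge0 (cos t - cos s); have := normr_ge0 (sin t - sin s).
nra.
Unshelve. all: by end_near. Qed.

Lemma continuous_circle k (phi : R[i] -> 'M[R]_k) :
  {within [set z : R[i]^o | `|z| = 1], continuous (phi : R[i]^o -> 'M[R]_k)} ->
  forall i j, continuous (fun t => phi (cis t) i j).
Proof.
move=> /subspace_continuousP h i j t.
have /cvg_mxP/(_ i j) := h (cis t) (norm_cis t).
apply: (@cvg_comp _ _ _ cis (fun z => phi z i j)) => B /= hB.
have h1 : \forall s \near t, `|cis s| = 1 -> B (cis s) := @cis_continuous t _ hB.
by apply: (filterS _ h1) => s; apply; exact: norm_cis.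
Qed.

End Circle.

(** * Real and imaginary parts of complex matrices *)

Section Complexification.
Context {R : realType}.

Definition reC m n (A : 'M[R[i]]_(m, n)) : 'M[R]_(m, n) := map_mx (@complex.Re R) A.
Definition imC m n (A : 'M[R[i]]_(m, n)) : 'M[R]_(m, n) := map_mx (@complex.Im R) A.

Lemma imaginaryE : 'i = ('i)%C :> R[i].
Proof. by []. Qed.

Lemma toCE m n (A : 'M[R[i]]_(m, n)) : A = toC (reC A) + 'i *: toC (imC A).
Proof.
apply/matrixP => a b; rewrite !mxE imaginaryE.
by case: (A a b) => x y; apply/eqP; rewrite eq_complex /=; apply/andP; split; apply/eqP; ring.
Qed.

Lemma reC_toC m n (A B : 'M[R]_(m, n)) : reC (toC A + 'i *: toC B) = A.
Proof. by apply/matrixP => a b; rewrite !mxE imaginaryE /=; ring. Qed.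

Lemma imC_toC m n (A B : 'M[R]_(m, n)) : imC (toC A + 'i *: toC B) = B.
Proof. by apply/matrixP => a b; rewrite !mxE imaginaryE /=; ring. Qed.

Lemma toC_mul m n p (A : 'M[R]_(m, n)) (B : 'M[R]_(n, p)) :
  toC (A *m B) = toC A *m toC B.
Proof. exact: map_mxM. Qed.

Lemma toCD m n (A B : 'M[R]_(m, n)) : toC (A + B) = toC A + toC B.
Proof. exact: map_mxD. Qed.

Lemma toCN m n (A : 'M[R]_(m, n)) : toC (- A) = - toC A.
Proof. exact: map_mxN. Qed.

Lemma toCB m n (A B : 'M[R]_(m, n)) : toC (A - B) = toC A - toC B.
Proof. by rewrite toCD toCN. Qed.

Lemma toCZ m n a (A : 'M[R]_(m, n)) : toC (a *: A) = a%:C%C *: toC A.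
Proof. exact: map_mxZ. Qed.

Lemma toC0 m n : toC (0 : 'M[R]_(m, n)) = 0.
Proof. exact: map_mx0. Qed.

Lemma toC1 n : toC (1%:M : 'M[R]_n) = 1%:M.
Proof. exact: map_mx1. Qed.

Lemma toC_inj m n : injective (@toC R m n).
Proof.
move=> A B AB; have := congr1 (@reC m n) AB.
by rewrite -[toC A]addr0 -[toC B]addr0 -(scaler0 _ 'i) -toC0 !reC_toC.
Qed.

Lemma conjmxD m n (A B : 'M[R[i]]_(m, n)) : conjmx (A + B) = conjmx A + conjmx B.
Proof. by apply/matrixP => a b; rewrite !mxE rmorphD. Qed.

Lemma conjmxN m n (A : 'M[R[i]]_(m, n)) : conjmx (- A) = - conjmx A.
Proof. by apply/matrixP => a b; rewrite !mxE rmorphN. Qed.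

Lemma conjmxZ m n a (A : 'M[R[i]]_(m, n)) : conjmx (a *: A) = a^* *: conjmx A.
Proof. by apply/matrixP => a' b; rewrite !mxE rmorphM. Qed.

Lemma conjmx_mul m n p (A : 'M[R[i]]_(m, n)) (B : 'M[R[i]]_(n, p)) :
  conjmx (A *m B) = conjmx A *m conjmx B.
Proof.
apply/matrixP => a b; rewrite !mxE rmorph_sum.
by apply: eq_bigr => l _; rewrite !mxE rmorphM.
Qed.

Lemma conjmx0 m n : conjmx (0 : 'M[R[i]]_(m, n)) = 0.
Proof. by apply/matrixP => a b; rewrite !mxE rmorph0. Qed.

Lemma conjmxK m n (A : 'M[R[i]]_(m, n)) : conjmx (conjmx A) = A.
Proof. by apply/matrixP => a b; rewrite !mxE conjCK. Qed.

Lemma conjmx_toC m n (A : 'M[R]_(m, n)) : conjmx (toC A) = toC A.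
Proof. by apply/matrixP => a b; rewrite !mxE conj_Creal// complex_real. Qed.

Lemma conjmx_real m n (A : 'M[R[i]]_(m, n)) : conjmx A = A -> toC (reC A) = A.
Proof.
move=> AA; apply/matrixP => a b; have := congr1 (fun B : 'M[R[i]]_(m, n) => B a b) AA.
rewrite !mxE; case: (A a b) => x y /= -[] yy.
by rewrite (_ : y = 0)//; lra.
Qed.

Lemma conjmx_sum m n (I : Type) (r : seq I) (P : pred I)
    (F : I -> 'M[R[i]]_(m, n)) :
  conjmx (\sum_(i <- r | P i) F i) = \sum_(i <- r | P i) conjmx (F i).
Proof. exact: (big_morph _ (@conjmxD m n) (@conjmx0 m n)). Qed.

End Complexification.

(** * The Hodge grading at the base point *)

Section HodgeGrading.
Context {R : realType} {k n : nat} (H : hodge_datum R k n).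
Hypothesis hG : is_algebraic_group (hd_G H).
Hypothesis hH : is_hodge_representation H.

Lemma hodge_regRM A B : hd_G H A -> hd_G H B ->
  regR (hd_rho H) (A *m B) = regR (hd_rho H) A *m regR (hd_rho H) B.
Proof. by case: hH => -[_ _ h _ _] _ _ _ _; exact: h. Qed.

Lemma hodge_regR_unit A : hd_G H A -> regR (hd_rho H) A \in unitmx.
Proof. by case: hH => -[_ _ _ h _] _ _ _ _ /h[]. Qed.

Lemma is_derive_cosZ (d : R) : is_derive (0 : R) (1 : R) (fun t => cos (d * t)) 0.
Proof.
have du := @is_deriveZ R R R^o id d 0 1 1 (is_derive_id _ _).
have := @is_derive1_comp R cos (fun u => d * u) 0 _ _ (is_derive_cos _) du.
by rewrite mulr0 sin0 oppr0 mul0r.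
Qed.

Lemma is_derive_sinZ (d : R) : is_derive (0 : R) (1 : R) (fun t => sin (d * t)) d.
Proof.
have du := @is_deriveZ R R R^o id d 0 1 1 (is_derive_id _ _).
have := @is_derive1_comp R sin (fun u => d * u) 0 _ _ (is_derive_sin _) du.
by rewrite mulr0 cos0 mul1r [_ *: _]mulr1.
Qed.

Lemma is_derive_cos_sin (d a b : R) :
  is_derive (0 : R) (1 : R) (fun t => cos (d * t) * a + sin (d * t) * b) (d * b).
Proof.
have h1 := @is_deriveZ R R R^o _ a 0 1 _ (is_derive_cosZ d).
have h2 := @is_deriveZ R R R^o _ b 0 1 _ (is_derive_sinZ d).
have := @is_deriveD R R R^o _ _ 0 1 _ _ h1 h2.
rewrite scaler0 add0r [_ *: _]mulrC; congr (is_derive _ _ _ _).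
apply/funext => t.
by change (a * cos (d * t) + b * sin (d * t) = cos (d * t) * a + sin (d * t) * b); ring.
Qed.

(** The curve phi (e^(i t)) is a one-parameter group exp (t X); differentiate its
    action e^(i (p - q) t) on V^(p,q). *)
Lemma hodge_generator : exists2 X, hd_g H X &
  forall p q v, hodge_space H p q v ->
    toC (hd_drho H X) *m v = ('i * (p - q)%:~R) *: v.
Proof.
have [_ [phiG phiM phic _] _ _ _] := hH.
pose c t := hd_phi H (cis t).
have cD s t : c (s + t) = c s *m c t by rewrite /c cisD phiM// norm_cis.
have cU t : c t \in unitmx.
  by have [[Gu _ _ _] _] := hG; apply: Gu; apply: phiG; rewrite norm_cis.
have c0 : c 0 = 1%:M.
  have := cD 0 0; rewrite addr0 => /(congr1 (mulmx (invmx (c 0)))).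
  by rewrite mulKmx// mulVmx.
have [X [_ cE]] := one_parameter_group cD c0 (continuous_circle phic).
exists X => [t|p q v [_ hv]].
  by rewrite -cE; apply: phiG; rewrite norm_cis.
pose d : R := (p - q)%:~R.
pose a := reC v; pose b := imC v.
have vE : v = toC a + 'i *: toC b by exact: toCE.
have hX t : toC (regR (hd_rho H) (expmx (t *: X))) *m v = cis (d * t) *: v.
  by rewrite -cE /c hv ?norm_cis// cis_exprz.
have rhoab t : regR (hd_rho H) (expmx (t *: X)) *m a =
      cos (d * t) *: a - sin (d * t) *: b /\
    regR (hd_rho H) (expmx (t *: X)) *m b =
      cos (d * t) *: b + sin (d * t) *: a.
  have := hX t; rewrite vE mulmxDr -scalemxAr -!toC_mul => e.
  have {}e : toC (regR (hd_rho H) (expmx (t *: X)) *m a) +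
      'i *: toC (regR (hd_rho H) (expmx (t *: X)) *m b) =
      toC (cos (d * t) *: a - sin (d * t) *: b) +
      'i *: toC (cos (d * t) *: b + sin (d * t) *: a).
    rewrite e; apply/matrixP => i j; rewrite !mxE imaginaryE /cis.
    by apply/eqP; rewrite eq_complex /=; apply/andP; split; apply/eqP; ring.
  by split; [have := congr1 (@reC R n 1) e; rewrite !reC_toC
            |have := congr1 (@imC R n 1) e; rewrite !imC_toC].
have dr : forall i j, is_derive (0 : R) (1 : R)
    (fun t => regR (hd_rho H) (expmx (t *: X)) i j) (hd_drho H X i j).
  by move=> i j; apply: (regdiff_coord _ i j).2; exact: curve_expmx.
have ea : hd_drho H X *m a = - (d *: b).
  apply/matrixP => i j; have [_ <-] := is_derive_mulmxr_cst a dr i j.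
  have -> : (fun t => (regR (hd_rho H) (expmx (t *: X)) *m a) i j) =
      (fun t => cos (d * t) * a i j + sin (d * t) * (- b i j)).
    by apply/funext => t; rewrite (rhoab t).1 !mxE mulrN.
  by have [_ ->] := is_derive_cos_sin d (a i j) (- b i j); rewrite !mxE mulrN.
have eb : hd_drho H X *m b = d *: a.
  apply/matrixP => i j; have [_ <-] := is_derive_mulmxr_cst b dr i j.
  have -> : (fun t => (regR (hd_rho H) (expmx (t *: X)) *m b) i j) =
      (fun t => cos (d * t) * b i j + sin (d * t) * a i j).
    by apply/funext => t; rewrite (rhoab t).2 !mxE.
  by have [_ ->] := is_derive_cos_sin d (b i j) (a i j); rewrite !mxE.
rewrite vE mulmxDr -scalemxAr -!toC_mul ea eb; apply/matrixP => i j.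
have -> : (p - q)%:~R = d%:C%C :> R[i] by rewrite /d rmorph_int.
rewrite !mxE imaginaryE; apply/eqP; rewrite eq_complex /=.
by apply/andP; split; apply/eqP; ring.
Qed.

End HodgeGrading.

(** * Subspaces and graded spaces *)

Section Subspaces.
Context {K : fieldType} {V : lmodType K}.

Lemma subspace0 (S : set V) : is_subspace S -> S 0.
Proof. by case. Qed.

Lemma subspace_sum (S : set V) (J : Type) (r : seq J) (P : pred J)
    (f : J -> V) :
  is_subspace S -> (forall j, P j -> S (f j)) -> S (\sum_(j <- r | P j) f j).
Proof.
move=> [S0 Slin] Sf; elim/big_rec: _ => // j x /Sf Sfj Sx.
by rewrite -[f j]scale1r; exact: Slin.
Qed.

Lemma subspaceZ (S : set V) a v : is_subspace S -> S v -> S (a *: v).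
Proof. by move=> [S0 Slin] Sv; rewrite -[_ *: _]addr0; exact: Slin. Qed.

Lemma subspaceD (S : set V) u v : is_subspace S -> S u -> S v -> S (u + v).
Proof. by move=> [S0 Slin] Su Sv; rewrite -[u]scale1r; exact: Slin. Qed.

Lemma subspaceN (S : set V) v : is_subspace S -> S v -> S (- v).
Proof. by move=> hS Sv; rewrite -scaleN1r; exact: subspaceZ. Qed.

Lemma subspaceB (S : set V) u v : is_subspace S -> S u -> S v -> S (u - v).
Proof. by move=> hS Su Sv; apply: subspaceD => //; exact: subspaceN. Qed.

Lemma subspaceI (S T : set V) : is_subspace S -> is_subspace T ->
  is_subspace (S `&` T).
Proof.
move=> [S0 Sl] [T0 Tl]; split=> // a u v [Su Tu] [Sv Tv].
by split; [exact: Sl | exact: Tl].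
Qed.

(** Terms with the same index can be merged, as each E i is a subspace. *)
Lemma sumset_uniq (I : eqType) (P : I -> Prop) (E : I -> set V) v :
  (forall i, is_subspace (E i)) -> sumset P E v ->
  exists s f, [/\ uniq s, (forall i, i \in s -> P i /\ E i (f i)) &
    v = \sum_(i <- s) f i].
Proof.
move=> Esub [s [f [hf ->]]].
exists (undup s), (fun i => f i *+ count_mem i s); split.
- exact: undup_uniq.
- move=> i; rewrite mem_undup => /hf[Pi Ei]; split=> //.
  by rewrite -scaler_nat; exact: subspaceZ.
- by rewrite -[LHS]big_undup_iterop_count.
Qed.

Lemma sumset_subspace (I : eqType) (P : I -> Prop) (E : I -> set V) :
  (forall i, is_subspace (E i)) -> is_subspace (sumset P E).
Proof.
move=> Esub; split; first by exists [::], (fun=> 0); rewrite big_nil.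
move=> a u v /(sumset_uniq Esub)[s [f [us hf ->]]] /(sumset_uniq Esub)[t [g [ut hg ->]]].
pose f' i := if i \in s then f i else 0; pose g' i := if i \in t then g i else 0.
exists (undup (s ++ t)), (fun i => a *: f' i + g' i); split=> [i|].
  rewrite mem_undup mem_cat /f' /g'; case: (boolP (i \in s)) => [/hf[Pi Efi]|_] /=.
    case: (boolP (i \in t)) => [/hg[_ Egi]|_]; split=> //; last by rewrite addr0; exact: subspaceZ.
    by apply: subspaceD => //; exact: subspaceZ.
  by move=> it; rewrite it; have [Pi Egi] := hg _ it; split=> //; rewrite scaler0 add0r.
have sumE (r : seq I) (h : I -> V) : uniq r -> {subset r <= s ++ t} ->
    \sum_(i <- undup (s ++ t)) (if i \in r then h i else 0) = \sum_(i <- r) h i.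
  move=> ur rst; rewrite -big_mkcond -big_filter; apply: perm_big; apply: uniq_perm => //.
    by rewrite filter_uniq// undup_uniq.
  move=> i; rewrite mem_filter mem_undup; case: (boolP (i \in r)) => //= ir.
  by rewrite rst.
rewrite big_split/= -scaler_sumr !sumE// => i it; rewrite mem_cat it ?orbT//.
Qed.

Lemma sumset_mem (I : eqType) (P : I -> Prop) (E : I -> set V) i v :
  P i -> E i v -> sumset P E v.
Proof.
by move=> Pi Ei; exists [:: i], (fun=> v); rewrite big_seq1; split=> // j; rewrite inE => /eqP ->.
Qed.

End Subspaces.

Section Graded.
Context {K : fieldType} {n : nat} {I : eqType}.
Variables (E : I -> set 'cV[K]_n) (s : seq I).
Hypothesis Esub : forall i, is_subspace (E i).
Hypothesis Es : forall i v, E i v -> v != 0 -> i \in s.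
Hypothesis Eind : independent E.
Hypothesis su : uniq s.
Hypothesis Espan : forall v, exists2 f : I -> 'cV[K]_n,
  (forall i, E i (f i)) & v = \sum_(i <- s) f i.

Lemma graded_component (f : I -> 'cV[K]_n) i v : (forall j, E j (f j)) -> E i v ->
  v = \sum_(j <- s) f j -> forall j, j \in s -> f j = (j == i)%:R *: v.
Proof.
move=> Ef Ev ve j js; apply/eqP; rewrite -subr_eq0; apply/eqP.
apply: (Eind (f := fun j => f j - (j == i)%:R *: v) su) => //.
  move=> l _; have [->|_] := eqVneq l i.
    by rewrite scale1r; exact: subspaceB.
  by rewrite scale0r subr0.
rewrite sumrB -ve.
have [v0|v0] := eqVneq v 0.
  by rewrite v0 sub0r -scaler_suml scaler0 oppr0.
have is_ := Es Ev v0.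
rewrite (bigD1_seq i)//= eqxx scale1r big1 ?addr0 ?subrr// => l /negPf ->.
by rewrite scale0r.
Qed.

Lemma graded_operator (c : I -> K) :
  exists M : 'M[K]_n, forall i v, E i v -> M *m v = c i *: v.
Proof.
have /choice[f hf] : forall j : 'I_n, exists f : I -> 'cV[K]_n,
    (forall i, E i (f i)) /\ delta_mx j 0 = \sum_(i <- s) f i.
  by move=> j; have [f] := Espan (delta_mx j 0); exists f.
exists (\matrix_(a, j) (\sum_(i <- s) c i *: f j i) a 0) => i v Ev.
pose g l := \sum_j v j 0 *: f j l.
have Eg l : E l (g l).
  by apply: subspace_sum => // j _; apply: subspaceZ => //; exact: (hf j).1.
have vg : v = \sum_(l <- s) g l.
  rewrite /g exchange_big/=.
  have -> : \sum_j \sum_(l <- s) v j 0 *: f j l = \sum_j v j 0 *: delta_mx j 0.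
    by apply: eq_bigr => j _; rewrite -scaler_sumr -(hf j).2.
  rewrite [LHS]matrix_sum_delta; apply: eq_bigr => j _.
  by rewrite big_ord1.
have gE := graded_component Eg Ev vg.
have -> : (\matrix_(a, j) (\sum_(i <- s) c i *: f j i) a 0) *m v =
    \sum_(l <- s) c l *: g l.
  apply/matrixP => a b; rewrite ord1 !mxE summxE.
  under [RHS]eq_bigr do rewrite mxE summxE mulr_sumr.
  rewrite exchange_big/=; apply: eq_bigr => j _; rewrite mxE summxE mulr_suml.
  by apply: eq_bigr => l _; rewrite !mxE; ring.
rewrite [RHS](_ : _ = c i *: \sum_(l <- s) g l); last by rewrite -vg.
rewrite scaler_sumr !big_seq; apply: eq_bigr => l ls; rewrite gE//.
by have [->//|_] := eqVneq l i; rewrite scale0r !scaler0.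
Qed.

Lemma graded_eq m (A B : 'M[K]_(m, n)) :
  (forall i v, E i v -> A *m v = B *m v) -> A = B.
Proof.
move=> AB; apply/matrixP => a b.
have e : A *m delta_mx b (0 : 'I_1) = B *m delta_mx b 0.
  have [f Ef ->] := Espan (delta_mx b 0).
  by rewrite !mulmx_sumr; apply: eq_bigr => i _; exact: AB.
have := congr1 (fun M : 'cV[K]_m => M a 0) e.
rewrite !mxE (bigD1 b)//= mxE !eqxx mulr1 big1 ?addr0 => [|i /negPf ib]; last first.
  by rewrite mxE ib mulr0.
rewrite (bigD1 b)//= mxE !eqxx mulr1 big1 ?addr0// => i /negPf ib.
by rewrite mxE ib mulr0.
Qed.

End Graded.

(** * The Deligne splitting of an R-split mixed Hodge structure *)

Section ComplexSets.
Context {R : realType} {m n : nat}.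
Implicit Types (S : set 'M[R]_(m, n)) (v : 'M[R[i]]_(m, n)).

Lemma cplxP S v : cplx S v <-> S (reC v) /\ S (imC v).
Proof.
split=> [[A SA [B SB <-]]|[h1 h2]]; first by rewrite reC_toC imC_toC.
by exists (reC v) => //; exists (imC v) => //; rewrite -toCE.
Qed.

Lemma cplx_toC S (A : 'M[R]_(m, n)) : is_subspace S -> cplx S (toC A) <-> S A.
Proof.
move=> [S0 _]; rewrite cplxP -[toC A]addr0 -(scaler0 _ 'i) -toC0 reC_toC imC_toC.
by split=> [[]|].
Qed.

Lemma reC_lin (a b : R) u v :
  reC ((a +i* b)%C *: u + v) = a *: reC u + (reC v - b *: imC u).
Proof.
apply/matrixP => i j; rewrite !mxE.
by case: (u i j) (v i j) => x y [z t] /=; ring.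
Qed.

Lemma imC_lin (a b : R) u v :
  imC ((a +i* b)%C *: u + v) = a *: imC u + (b *: reC u + imC v).
Proof.
apply/matrixP => i j; rewrite !mxE.
by case: (u i j) (v i j) => x y [z t] /=; ring.
Qed.

Lemma cplx_subspace S : is_subspace S -> is_subspace (cplx S).
Proof.
move=> hS; have [S0 Slin] := hS; split.
  by rewrite -toC0 cplx_toC.
move=> [a b] u v /cplxP[u1 u2] /cplxP[v1 v2]; apply/cplxP.
rewrite reC_lin imC_lin; split; apply: (Slin) => //; last exact: Slin.
by rewrite addrC -scaleNr; exact: Slin.
Qed.

Lemma cplx_mono S S' : S `<=` S' -> cplx S `<=` cplx S'.
Proof. by move=> SS v /cplxP[v1 v2]; apply/cplxP; split; exact: SS. Qed.

Lemma conjsetP (S : set 'M[R[i]]_(m, n)) v : conjset S v <-> S (conjmx v).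
Proof.
split=> [[u Su <-]|Sv]; first by rewrite conjmxK.
by exists (conjmx v) => //; rewrite conjmxK.
Qed.

Lemma conjset_subspace (S : set 'M[R[i]]_(m, n)) : is_subspace S -> is_subspace (conjset S).
Proof.
move=> [S0 Sl]; split; first by apply/conjsetP; rewrite conjmx0.
move=> a u v /conjsetP Su /conjsetP Sv; apply/conjsetP.
by rewrite conjmxD conjmxZ; exact: Sl.
Qed.

End ComplexSets.

Lemma int_chain_le (T : Type) (S : int -> set T) :
  (forall l, S l `<=` S (l + 1)) -> forall l l', l <= l' -> S l `<=` S l'.
Proof.
move=> h l l' ll'; have [d ->] : exists d : nat, l' = l + d%:Z.
  by exists `|l' - l|%N; lia.
elim: d => [|d ih]; first by rewrite addr0.
apply: subset_trans ih _; have -> : l + d.+1%:Z = l + d%:Z + 1 by lia.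
exact: h.
Qed.

Section DeligneSplitting.
Context {R : realType} {n : nat}.
Variables (F : int -> set 'cV[R[i]]_n) (W : int -> set 'cV[R]_n).
Hypothesis hM : is_mixed_hodge F W.

Let WC l := cplx (W l).

Lemma mhs_Wsub l : is_subspace (WC l).
Proof. by case: hM => -[h _ _ _] _ _ _; exact: cplx_subspace. Qed.

Lemma mhs_Fsub p : is_subspace (F p).
Proof. by case: hM => _ [h _ _ _] _ _. Qed.

Lemma mhs_Wle l l' : l <= l' -> WC l `<=` WC l'.
Proof.
case: hM => -[_ h _ _] _ _ _ ll'; apply: cplx_mono.
by apply: int_chain_le.
Qed.

Lemma mhs_Fle p p' : p <= p' -> F p' `<=` F p.
Proof.
case: hM => _ [_ h _ _] _ _ pp'.
have := @int_chain_le _ (fun q => F (- q)) _ (- p') (- p); rewrite !opprK.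
by apply=> [l|]; [have := h (- l - 1); rewrite opprD subrK | lia].
Qed.

Lemma mhs_F_top : exists p, forall v, F p v.
Proof. by case: hM => _ [_ _ [p Fp] _] _ _; exists p => v; rewrite Fp. Qed.

Lemma mhs_F_bottom : exists p, forall p' v, p <= p' -> F p' v -> v = 0.
Proof.
case: (hM) => _ [_ _ _ [p Fp]] _ _; exists p => p' v pp' /(mhs_Fle pp').
by rewrite Fp.
Qed.

Lemma mhs_W_top : exists l, forall v, WC l v.
Proof.
case: hM => -[_ _ _ [l Wl]] _ _ _; exists l => v; apply/cplxP.
by rewrite Wl.
Qed.

Lemma mhs_W_bottom : exists l, forall l' v, l' <= l -> WC l' v -> v = 0.
Proof.
case: (hM) => -[_ _ [l Wl] _] _ _ _; exists l => l' v ll' /(mhs_Wle ll').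
move=> /cplxP; rewrite Wl /= => -[v1 v2].
by rewrite [v]toCE v1 v2 toC0 scaler0 addr0.
Qed.

Lemma mhs_decompose l p v : WC l v -> exists a b,
  [/\ F p a, WC l a, F (l + 1 - p) (conjmx b), WC l b & WC (l - 1) (v - (a + b))].
Proof.
case: (hM) => _ _ h _ /h-/(_ p)[a [b [[Fa Wa] [/conjsetP Fb Wb] Wv]]].
by exists a, b.
Qed.

Lemma mhs_disjoint l p a b : F p a -> WC l a -> F (l + 1 - p) (conjmx b) -> WC l b ->
  WC (l - 1) (a + b) -> WC (l - 1) a.
Proof.
case: (hM) => _ _ _ h Fa Wa Fb Wb; apply: (h l p a b) => //.
by split=> //; apply/conjsetP.
Qed.

(** Decompose the error v - b in successively lower weights: its part in F^p is
    subtracted from v, and the other part fits in conj F^q or in the correction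
    term of the definition of I^(p,q).  The error reaches 0 because W is
    bounded below. *)
Lemma deligne_lift p q v b : F p v -> WC (p + q) v ->
  F q (conjmx b) -> WC (p + q) b -> WC (p + q - 1) (v - b) ->
  exists2 u, deligne F W p q u & WC (p + q - 1) (v - u).
Proof.
move=> Fv Wv Fb Wb Wvb.
have step (j : nat) : exists a b' c w,
   [/\ [/\ F p a, WC (p + q - 1) a & v = a + b' + c + w],
       F q (conjmx b') /\ WC (p + q) b',
       sumset (fun j : nat => (1 <= j)%N)
         (fun j => conjset (F (q - j%:Z)) `&` WC (p + q - j%:Z - 1)) c &
       WC (p + q - 1 - j%:Z) w].
  elim: j => [|j [a [b' [c [w [[Fa Wa ve] [Fb' Wb'] hc Ww]]]]]].
    exists 0, b, 0, (v - b); split=> //.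
    - split; [exact: subspace0 (mhs_Fsub p)|exact: subspace0 (mhs_Wsub _)|].
      by rewrite add0r addr0 addrC subrK.
    - by exists [::], (fun=> 0); rewrite big_nil.
    - by rewrite subr0.
  have [a1 [b1 [Fa1 Wa1 Fb1 Wb1 Ww1]]] := mhs_decompose p Ww.
  have {}Fb1 : F (q - j%:Z) (conjmx b1).
    by have -> : q - j%:Z = p + q - 1 - j%:Z + 1 - p by lia.
  have Fa' : F p (a + a1) by apply: subspaceD => //; exact: mhs_Fsub.
  have Wa' : WC (p + q - 1) (a + a1).
    apply: subspaceD => //; first exact: mhs_Wsub.
    by apply: mhs_Wle Wa1; lia.
  have Ww' : WC (p + q - 1 - j.+1%:Z) (w - (a1 + b1)).
    by have -> : p + q - 1 - j.+1%:Z = p + q - 1 - j%:Z - 1 by lia.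
  case: j Ww Wa1 Fb1 Wb1 Ww1 Ww' => [|j] Ww Wa1 Fb1 Wb1 Ww1 Ww'.
    exists (a + a1), (b' + b1), c, (w - (a1 + b1)); split=> //.
    - split=> //; rewrite ve; apply/matrixP => x y; rewrite !mxE; ring.
    - split.
        by rewrite conjmxD; apply: subspaceD; [exact: mhs_Fsub| |rewrite -[q]subr0].
      by apply: subspaceD => //; [exact: mhs_Wsub|apply: mhs_Wle Wb1; lia].
  exists (a + a1), b', (c + b1), (w - (a1 + b1)); split=> //.
    split=> //; rewrite ve; apply/matrixP => x y; rewrite !mxE; ring.
  apply: subspaceD => //.
    apply: sumset_subspace => i; apply: subspaceI; last exact: mhs_Wsub.
    exact: conjset_subspace (mhs_Fsub _).
  apply: (@sumset_mem _ _ _ _ _ j.+1) => //; split; first exact/conjsetP.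
  by have -> : p + q - j.+1%:Z - 1 = p + q - 1 - j.+1%:Z by lia.
have [l0 hl0] := mhs_W_bottom.
have [a [b' [c [w [[Fa Wa ve] [Fb' Wb'] hc Ww]]]]] := step (absz (p + q - 1 - l0)%R).
have w0 : w = 0 by apply: hl0 Ww; lia.
exists (v - a); last by rewrite subKr.
split.
  split; first by apply: subspaceB => //; exact: mhs_Fsub.
  apply: subspaceB => //; first exact: mhs_Wsub.
  by apply: mhs_Wle Wa; lia.
exists b'; first by split=> //; apply/conjsetP.
by exists c => //; rewrite ve w0 addr0 -(addrA a) [a + _]addrC addrK.
Qed.

Hypothesis hR : forall p q, conjset (deligne F W p q) = deligne F W q p.

Let I p q := deligne F W p q.

(** As I^(p,q) is the conjugate of I^(q,p), it is contained in conj F^q, and the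
    correction term of its definition can be dropped. *)
Lemma deligneE p q v : I p q v <-> [/\ F p v, F q (conjmx v) & WC (p + q) v].
Proof.
split=> [Iv|[Fv Fcv Wv]].
  have : I q p (conjmx v) by rewrite /I -hR; exists v.
  by case: Iv => -[Fv Wv] _ [[Fcv _] _].
split; first by [].
exists v; first by split=> //; exact/conjsetP.
by exists 0; [exists [::], (fun=> 0); rewrite big_nil|rewrite addr0].
Qed.

Lemma deligne_subspace p q : is_subspace (I p q).
Proof.
split=> [|a u v /deligneE[Fu cu Wu] /deligneE[Fv cv Wv]]; apply/deligneE.
  rewrite conjmx0; split; [exact: subspace0 (mhs_Fsub p)|
    exact: subspace0 (mhs_Fsub q)|exact: subspace0 (mhs_Wsub _)].
rewrite conjmxD conjmxZ; split.
- by have [_] := mhs_Fsub p; apply.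
- by have [_] := mhs_Fsub q; apply.
- by have [_] := mhs_Wsub (p + q); apply.
Qed.

Lemma deligne_conj p q v : I p q v -> I q p (conjmx v).
Proof. by move=> Iv; rewrite /I -hR; exists v. Qed.

Lemma deligne_F p q v : I p q v -> F p v.
Proof. by case/deligneE. Qed.

Lemma deligne_W p q v : I p q v -> WC (p + q) v.
Proof. by case/deligneE. Qed.

Definition int_box (B : nat) : seq int := [seq x%:Z - B%:Z | x <- iota 0 B.*2.+1].

(** A finite set of types: I^(p,q) = 0 outside of a large enough box
    (deligne_bounded), so that sums over all the types can be taken over it. *)
Definition box (B : nat) : seq (int * int) :=
  [seq (p, q) | p <- int_box B, q <- int_box B].

Lemma mem_int_box B p : (p \in int_box B) = (`|p| <= B%:Z).
Proof.
apply/mapP/idP => [[x]|pB]; first by rewrite mem_iota => xB ->; lia.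
by exists (absz (p + B%:Z)%R); rewrite ?mem_iota; lia.
Qed.

Lemma mem_box B i : (i \in box B) = (`|i.1| <= B%:Z) && (`|i.2| <= B%:Z).
Proof.
case: i => p q; apply/allpairsP/andP => [[[a b] /= [ha hb [-> ->]]]|[hp hq]].
  by rewrite -!mem_int_box.
by exists (p, q); rewrite /= !mem_int_box.
Qed.

Lemma int_box_uniq B : uniq (int_box B).
Proof. by rewrite map_inj_uniq ?iota_uniq// => x y /addIr[]. Qed.

Lemma box_uniq B : uniq (box B).
Proof.
have u := int_box_uniq B.
by apply: allpairs_uniq => // -[a b] [c d].
Qed.

Lemma deligne_bounded : exists B : nat, forall i v, I i.1 i.2 v -> v != 0 ->
  i \in box B.
Proof.
have [P hP] := mhs_F_bottom; have [l hl] := mhs_W_bottom.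
exists (absz P + absz l)%N => -[p q] v /= Iv v0; rewrite mem_box /=.
have p1 : p < P.
  by rewrite ltNge; apply: contra v0 => Pp; rewrite (hP _ _ Pp (deligne_F Iv)).
have q1 : q < P.
  rewrite ltNge; apply: contra v0 => Pq.
  by rewrite -[v]conjmxK (hP _ _ Pq (deligne_F (deligne_conj Iv))) conjmx0.
have l1 : l < p + q.
  by rewrite ltNge; apply: contra v0 => lpq; rewrite (hl _ _ lpq (deligne_W Iv)).
lia.
Qed.

(** In each weight l < p + q, the spaces F^p and conj F^q meet trivially in
    Gr^W_l; hence v descends through the weight filtration to 0. *)
Lemma deligne_strict p q l v : I p q v -> l < p + q -> WC l v -> v = 0.
Proof.
move=> /deligneE[Fv Fcv _] lpq Wv; have [l0 hl0] := mhs_W_bottom.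
have [d] : exists d : nat, l <= l0 + d%:Z by exists (absz (l - l0)%R); lia.
elim: d l lpq Wv => [|d ih] l lpq Wv ld; first by apply: hl0 Wv; lia.
apply: (ih (l - 1)); [lia| |lia].
apply: (@mhs_disjoint l p v (- v)) => //.
- by rewrite conjmxN; apply: subspaceN; [exact: mhs_Fsub|apply: mhs_Fle Fcv; lia].
- by apply: subspaceN => //; exact: mhs_Wsub.
- by rewrite subrr; exact: subspace0 (mhs_Wsub _).
Qed.

Lemma seq_argmax (T : eqType) (key : T -> int) (s : seq T) : s != [::] ->
  exists2 x, x \in s & forall y, y \in s -> key y <= key x.
Proof.
elim: s => // a [_ _|b s ih _]; first by exists a; rewrite ?inE// => y; rewrite inE => /eqP ->.
have [//|x xs hx] := ih; have [ax|xa] := leP (key a) (key x).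
  by exists x; [rewrite inE xs orbT|move=> y; rewrite inE => /orP[/eqP ->|/hx]].
exists a; first exact: mem_head.
move=> y; rewrite inE => /orP[/eqP ->//|/hx yx]; exact: le_trans yx (ltW xa).
Qed.

(** Among the terms of largest weight take the one with the largest p, say of type
    (p, q): the other terms of that weight lie in conj F^(q+1), so that it is 0
    modulo lower weights, hence 0 by deligne_strict. *)
Lemma deligne_independent : independent (fun i : int * int => I i.1 i.2).
Proof.
move=> s; move: {2}(size s) (erefl (size s)) => d.
elim: d s => [|d ih] s sd f us If sum0; first by rewrite (size0nil sd).
have s0 : s != [::] by rewrite -size_eq0 sd.
(* the largest weight, and there the largest p *)
have [j0 j0s hj0] := seq_argmax (fun i : int * int => i.1 + i.2) s0.
pose l := j0.1 + j0.2.
pose sl := [seq i <- s | i.1 + i.2 == l].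
have sl0 : sl != [::].
  have : j0 \in sl by rewrite mem_filter eqxx.
  by case: (sl).
have [i0 i0sl hi0] := seq_argmax (fun i : int * int => i.1) sl0.
have [/eqP i0l i0s] : i0.1 + i0.2 == l /\ i0 \in s by move: i0sl; rewrite mem_filter => /andP.
have fi0 : f i0 = 0.
  have sumW (P : pred (int * int)) :
      (forall i, P i -> i \in s -> i.1 + i.2 <= l - 1) ->
      WC (l - 1) (\sum_(i <- s | P i) f i).
    move=> hP; rewrite big_seq_cond; apply: subspace_sum; first exact: mhs_Wsub.
    by move=> i /andP[is_ Pi]; apply: mhs_Wle (deligne_W (If _ is_)); exact: hP.
  pose b := \sum_(i <- s | (i != i0) && (i.1 + i.2 == l)) f i.
  pose c := \sum_(i <- s | (i != i0) && ~~ (i.1 + i.2 == l)) f i.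
  have e : f i0 + b = - c.
    apply/eqP; rewrite -addr_eq0; apply/eqP; rewrite -[RHS]sum0.
    by rewrite (bigD1_seq i0)//= (bigID (fun i => i.1 + i.2 == l))/= addrA.
  have [Fi0 Fci0 Wi0] := (deligneE _ _ _).1 (If _ i0s).
  have hb i : i \in s -> (i != i0) && (i.1 + i.2 == l) -> i0.2 + 1 <= i.2.
    move=> is_ /andP[ii0 /eqP il].
    have : i.1 <= i0.1 by apply: hi0; rewrite mem_filter il eqxx.
    have : i.1 != i0.1.
      apply: contra ii0 => /eqP e1; apply/eqP; case: (i) (i0) e1 il i0l => [a1 a2] [b1 b2] /=.
      by move=> -> ? ?; congr pair; lia.
    by lia.
  apply: (deligne_strict (If _ i0s) (l := l - 1)); first by rewrite i0l; lia.
  apply: (@mhs_disjoint l i0.1 (f i0) b) => //.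
  - by rewrite -i0l.
  - rewrite conjmx_sum big_seq_cond; apply: subspace_sum; first exact: mhs_Fsub.
    move=> i /andP[is_ hi]; apply: mhs_Fle (deligne_F (deligne_conj (If _ is_))).
    have := hb _ is_ hi; have -> : i0.2 + 1 = l + 1 - i0.1.
      by rewrite -i0l [RHS]addrAC [i0.1 + _]addrC addrK.
    by [].
  - rewrite /b big_seq_cond; apply: subspace_sum; first exact: mhs_Wsub.
    by move=> i /and3P[is_ _ /eqP <-]; exact: deligne_W (If _ is_).
  - rewrite e; apply: subspaceN; first exact: mhs_Wsub.
    apply: sumW => i /andP[_ il] is_; by rewrite lerBrDr lezD1 lt_neqAle il; exact: hj0.
move=> i is_; have [->//|ii0] := eqVneq i i0.
apply: (ih (rem i0 s)) => //.
- by rewrite size_rem// sd.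
- exact: rem_uniq.
- by move=> j /mem_rem; exact: If.
- by rewrite -[RHS]sum0 [in RHS](big_rem i0)//= fi0 add0r.
- by rewrite mem_rem_uniq// inE ii0.
Qed.

Definition deligne_below p l : set 'cV[R[i]]_n :=
  sumset (fun i : int * int => p <= i.1 /\ i.1 + i.2 <= l) (fun i => I i.1 i.2).

Lemma deligne_below_subspace p l : is_subspace (deligne_below p l).
Proof. by apply: sumset_subspace => i; exact: deligne_subspace. Qed.

Lemma deligne_below_mono p p' l l' : p <= p' -> l' <= l ->
  deligne_below p' l' `<=` deligne_below p l.
Proof.
move=> pp' ll' v [s [f [hf ->]]]; exists s, f; split=> // i /hf[[h1 h2] If].
by split=> //; split; [exact: le_trans h1 | exact: le_trans ll'].
Qed.

Lemma deligne_below_F p l v : deligne_below p l v -> F p v.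
Proof.
move=> [s [f [hf ->]]]; rewrite big_seq; apply: subspace_sum; first exact: mhs_Fsub.
by move=> i /hf[[pi _] If]; exact: mhs_Fle (deligne_F If).
Qed.

(** Descending induction on p: on Gr^W_l, F^p is the sum of F^(p+1) and of its
    part of type (p, l - p), and the latter lifts to I^(p, l-p) by
    deligne_lift. *)
Lemma deligne_graded_span p l v : F p v -> WC l v ->
  exists2 u, deligne_below p l u & WC (l - 1) (v - u).
Proof.
have [P hP] := mhs_F_bottom.
have [d] : exists d : nat, P <= p + d%:Z by exists (absz (P - p)%R); lia.
elim: d p v => [|d ih] p v pd Fv Wv.
  have v0 : v = 0 by apply: (hP p) => //; rewrite -[p]addr0.
  exists 0; first exact: subspace0 (deligne_below_subspace _ _).
  by rewrite v0 subrr; exact: subspace0 (mhs_Wsub _).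
have [a [b [Fa Wa Fb Wb Wvab]]] := mhs_decompose (p + 1) Wv.
have [|u1 u1p Wu1] := ih (p + 1) a _ Fa Wa; first by lia.
have lp : p + (l - p) = l by rewrite addrC subrK.
have [|||||u2 u2I Wu2] := @deligne_lift p (l - p) (v - a) b.
- by apply: subspaceB => //; [exact: mhs_Fsub | apply: mhs_Fle Fa; lia].
- by rewrite lp; apply: subspaceB => //; exact: mhs_Wsub.
- by move: Fb; have -> : l + 1 - (p + 1) = l - p by lia.
- by rewrite lp.
- by rewrite lp -addrA -opprD.
exists (u1 + u2).
  apply: subspaceD; first exact: deligne_below_subspace.
    by apply: deligne_below_mono u1p => //; lia.
  by apply: (@sumset_mem _ _ _ _ _ (p, l - p)) => //=; rewrite lp.
have -> : v - (u1 + u2) = (a - u1) + (v - a - u2).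
  by apply/matrixP => x y; rewrite !mxE; ring.
by apply: subspaceD => //; [exact: mhs_Wsub | rewrite -{1}lp].
Qed.

Lemma deligne_filtered_span p l v : F p v -> WC l v -> deligne_below p l v.
Proof.
have [l0 hl0] := mhs_W_bottom.
have [d] : exists d : nat, l <= l0 + d%:Z by exists (absz (l - l0)%R); lia.
elim: d l v => [|d ih] l v ld Fv Wv.
  have -> : v = 0 by apply: hl0 Wv; rewrite -[l0]addr0.
  exact: subspace0 (deligne_below_subspace _ _).
have [u hu Wu] := deligne_graded_span Fv Wv.
rewrite -[v](subrK u) addrC; apply: subspaceD => //; first exact: deligne_below_subspace.
apply: (@deligne_below_mono p p l (l - 1)) => //; first by lia.
apply: ih => //; first by lia.
by apply: subspaceB => //; [exact: mhs_Fsub | exact: deligne_below_F hu].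
Qed.

Lemma deligne_F_span p v : F p v ->
  sumset (fun i : int * int => p <= i.1) (fun i => I i.1 i.2) v.
Proof.
have [l Wl] := mhs_W_top => Fv; have [s [f [hf ->]]] := deligne_filtered_span Fv (Wl v).
by exists s, f; split=> // i /hf[[]].
Qed.

Lemma deligne_W_span l v : WC l v ->
  sumset (fun i : int * int => i.1 + i.2 <= l) (fun i => I i.1 i.2) v.
Proof.
have [p Fp] := mhs_F_top => Wv; have [s [f [hf ->]]] := deligne_filtered_span (Fp v) Wv.
by exists s, f; split=> // i /hf[[]].
Qed.

Lemma deligne_box_span B : (forall i v, I i.1 i.2 v -> v != 0 -> i \in box B) ->
  forall v, exists2 f : int * int -> 'cV[R[i]]_n,
    (forall i, I i.1 i.2 (f i)) & v = \sum_(i <- box B) f i.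
Proof.
move: (box B) (box_uniq B) => bx bx_uniq hB v; have [p Fp] := mhs_F_top.
have := deligne_F_span (Fp v).
move=> /(sumset_uniq (fun i => deligne_subspace i.1 i.2))[s [f [us hf ->]]].
exists (fun i => if i \in s then f i else 0) => [i|].
  by case: ifPn => [/hf[]//|_]; exact: subspace0 (deligne_subspace _ _).
rewrite -big_mkcond -big_filter [LHS](bigID (fun i => i \in bx))/= [X in _ + X]big1_seq.
  rewrite addr0 -big_filter; apply: perm_big; apply: uniq_perm.
  - exact: filter_uniq.
  - exact: filter_uniq.
  - by move=> i; rewrite !mem_filter andbC.
move=> i /andP[ib is_]; apply/eqP; apply: contraNT ib; apply: hB.
by have [] := hf _ is_.
Qed.

(** By deligneE, since A is real and so shifts the conjugate of F too. *)
Lemma deligne_shift (A : 'M[R]_n) p q v :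
  (forall p v, F p v -> F (p - 1) (toC A *m v)) ->
  (forall l v, W l v -> W (l - 2) (A *m v)) ->
  I p q v -> I (p - 1) (q - 1) (toC A *m v).
Proof.
move=> AF AW /deligneE[Fv Fcv /cplxP[W1 W2]]; apply/deligneE; split.
- exact: AF.
- by rewrite conjmx_mul conjmx_toC; exact: AF.
- have -> : p - 1 + (q - 1) = p + q - 2 by lia.
  rewrite [v]toCE mulmxDr -scalemxAr -!toC_mul; apply/cplxP.
  by rewrite reC_toC imC_toC; split; exact: AW.
Qed.

End DeligneSplitting.

(** * Operators of the splitting, and the raising operator *)

Section TraceDuality.
Context {K : fieldType} {n : nat}.

(** The image of f is the annihilator of its annihilator for the trace form. *)
Lemma trace_fredholm (f : {linear 'M[K]_n -> 'M[K]_n}) (b : 'M[K]_n) :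
  (forall Z, (forall X, \tr (f X *m Z) = 0) -> \tr (b *m Z) = 0) ->
  exists X, f X = b.
Proof.
move=> h; pose M := lin_mx f.
have bM : (mxvec b <= M)%MS.
  rewrite submxE; apply/eqP/rowP => j.
  pose Z := (vec_mx (col j (cokermx M))^T)^T.
  have trE (A : 'M[K]_n) : \tr (A *m Z) = (mxvec A *m cokermx M) 0 j.
    rewrite [RHS]mxE (reindex _ (curry_mxvec_bij _ _)) /=.
    rewrite (eq_bigr (fun p => mxvec A 0 (mxvec_index p.1 p.2) *
      cokermx M (mxvec_index p.1 p.2) j)); last by case.
    rewrite -(pair_bigA _ (fun a c => mxvec A 0 (mxvec_index a c) *
      cokermx M (mxvec_index a c) j)) /=.
    apply: eq_bigr => a _; rewrite mxE; apply: eq_bigr => c _.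
    by rewrite mxvecE !mxE.
  rewrite -trE h ?mxE// => X; rewrite trE -mul_vec_lin -mulmxA mulmx_coker.
  by rewrite mulmx0 mxE.
have [D hD] := submxP bM; exists (vec_mx D).
by apply: (can_inj mxvecK); rewrite -mul_vec_lin vec_mxK -hD.
Qed.

(** B is an isomorphism, with inverse M, from the image of the projector P to that
    of the projector P', and it carries the compression of Z to the former to
    the compression to the latter. *)
Lemma trace_intertwine (P P' B M Z : 'M[K]_n) : M *m B = P -> B *m M = P' ->
  P *m P = P -> P' *m P' = P' -> B *m (Z *m P) = P' *m (Z *m B) ->
  \tr (P *m Z) = \tr (P' *m Z).
Proof.
move=> MB BM PP P'P' BZP.
rewrite -PP -mulmxA mxtrace_mulC -mulmxA -{1}MB -mulmxA BZP.
by rewrite !mulmxA mxtrace_mulC !mulmxA BM P'P'.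
Qed.

Lemma mxtrace_nondegenerate (D : 'M[K]_n) :
  (forall X, \tr (X *m D) = 0) -> D = 0.
Proof.
move=> h; apply/matrixP => i j; rewrite mxE -(h (delta_mx j i)) /mxtrace.
rewrite (bigD1 j)//= mxE (bigD1 i)//= mxE !eqxx mul1r big1 ?addr0; last first.
  by move=> l /negPf li; rewrite mxE li andbF mul0r.
rewrite big1 ?addr0// => l /negPf lj; rewrite mxE big1// => x _.
by rewrite mxE lj mul0r.
Qed.

End TraceDuality.

Section Lefschetz.
Context {R : realType} {n : nat}.
Variables (F : int -> set 'cV[R[i]]_n) (W : int -> set 'cV[R]_n) (w : int).
Hypothesis hM : is_mixed_hodge F W.
Hypothesis hR : forall p q, conjset (deligne F W p q) = deligne F W q p.

Local Notation C := R[i].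
Let I p q := deligne F W p q.
Let WC l := cplx (W l).

Lemma deligne_operator (c : int * int -> C) :
  exists M : 'M[C]_n, forall p q v, I p q v -> M *m v = c (p, q) *: v.
Proof.
have [B hB] := deligne_bounded hM hR.
have [M hMc] := graded_operator (fun i => deligne_subspace hM hR i.1 i.2) hB
  (deligne_independent hM hR) (box_uniq B) (deligne_box_span hM hR hB) c.
by exists M => p q v Iv; exact: (hMc (p, q)).
Qed.

Lemma deligne_eq m (A A' : 'M[C]_(m, n)) :
  (forall p q v, I p q v -> A *m v = A' *m v) -> A = A'.
Proof.
have [B hB] := deligne_bounded hM hR => h.
apply: (@graded_eq _ n _ (fun i : int * int => I i.1 i.2) (box B)).
  exact: deligne_box_span.
by move=> -[p q] v; exact: h.
Qed.

(** The operator that acts on I^(p,q) as the scalar c (p, q). *)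
Definition dop (c : int * int -> C) : 'M[C]_n := projT1 (cid (deligne_operator c)).

Lemma dopE c p q v : I p q v -> dop c *m v = c (p, q) *: v.
Proof. by move=> Iv; rewrite (projT2 (cid (deligne_operator c)) _ _ _ Iv). Qed.

Lemma dop_conj c : conjmx (dop c) = dop (fun i => (c (i.2, i.1))^*).
Proof.
apply: deligne_eq => p q v Iv; rewrite (dopE _ Iv) -[v in LHS]conjmxK -conjmx_mul.
by rewrite (dopE _ (deligne_conj hR Iv)) conjmxZ conjmxK.
Qed.

Lemma dop_mul c d : dop c *m dop d = dop (fun i => c i * d i).
Proof.
apply: deligne_eq => p q v Iv; rewrite -mulmxA !(dopE _ Iv) -scalemxAr (dopE _ Iv).
by rewrite scalerA mulrC.
Qed.

Lemma dopD c d : dop c + dop d = dop (fun i => c i + d i).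
Proof.
by apply: deligne_eq => p q v Iv; rewrite mulmxDl !(dopE _ Iv) scalerDl.
Qed.

Lemma dopZ a c : a *: dop c = dop (fun i => a * c i).
Proof.
by apply: deligne_eq => p q v Iv; rewrite -scalemxAl !(dopE _ Iv) scalerA.
Qed.

Lemma dop_sum (J : Type) (r : seq J) (c : J -> int * int -> C) :
  \sum_(j <- r) dop (c j) = dop (fun i => \sum_(j <- r) c j i).
Proof.
apply: deligne_eq => p q v Iv; rewrite mulmx_suml (dopE _ Iv) scaler_suml.
by apply: eq_bigr => j _; rewrite (dopE _ Iv).
Qed.

Lemma dop_shift (A : 'M[C]_n) (a b : int) c :
  (forall p q v, I p q v -> I (p + a) (q + b) (A *m v)) ->
  dop c *m A = A *m dop (fun i => c (i.1 + a, i.2 + b)).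
Proof.
move=> hA; apply: deligne_eq => p q v Iv.
by rewrite -!mulmxA (dopE _ (hA _ _ _ Iv)) (dopE _ Iv) -scalemxAr.
Qed.

Definition proj_I (i : int * int) : 'M[C]_n := dop (fun j => (j == i)%:R).

Lemma proj_I_mem i v : I i.1 i.2 (proj_I i *m v).
Proof.
have [B hB] := deligne_bounded hM hR.
have [f If ->] := deligne_box_span hM hR hB v.
rewrite mulmx_sumr; apply: subspace_sum; first exact: deligne_subspace.
move=> [p q] _; rewrite (dopE _ (If (p, q))).
have [<-|_] := eqVneq; first by rewrite scale1r; exact: If.
by rewrite scale0r; exact: subspace0 (deligne_subspace hM hR _ _).
Qed.

(** The component of type a of the operator Z. *)
Lemma deligne_component (a : int * int) (Z : 'M[C]_n) : exists Za : 'M[C]_n,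
  forall p q v, I p q v -> Za *m v = proj_I (a.1 + p, a.2 + q) *m (Z *m v).
Proof.
have [bx bxu hbx] : exists2 bx : seq (int * int), uniq bx &
    forall i v, I i.1 i.2 v -> v != 0 -> i \in bx.
  by have [B hB] := deligne_bounded hM hR; exists (box B); [exact: box_uniq|].
exists (\sum_(i <- bx) proj_I (a.1 + i.1, a.2 + i.2) *m Z *m proj_I i) => p q v Iv.
have [->|v0] := eqVneq v 0; first by rewrite !mulmx0.
rewrite mulmx_suml (bigD1_seq (p, q))/=; last 2 first.
  exact: (hbx (p, q) v).
  exact: bxu.
rewrite big1 => [|[p' q'] /negPf pq]; last first.
  by rewrite -!mulmxA (dopE _ Iv) eq_sym pq scale0r !mulmx0.
by rewrite -!mulmxA (dopE _ Iv) eqxx scale1r addr0.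
Qed.

(** Tgr and Ygr are the two gradings of the splitting: on the graded pieces Tgr
    induces the Hodge gradings, and the eigenspaces of Ygr split the weight
    filtration of the cone, which is centred at 0 instead of w. *)
Definition Tgr : 'M[C]_n := dop (fun i => (i.1 - i.2)%:~R).
Definition Ygr : 'M[C]_n := dop (fun i => (i.1 + i.2 - w)%:~R).

Lemma conj_Tgr : conjmx Tgr = - Tgr.
Proof.
rewrite dop_conj -scaleN1r dopZ; congr dop; apply/funext => i /=.
by rewrite rmorph_int -opprB mulrNz mulN1r.
Qed.

Lemma conj_Ygr : conjmx Ygr = Ygr.
Proof.
by rewrite dop_conj; congr dop; apply/funext => i /=; rewrite rmorph_int [i.2 + _]addrC.
Qed.

Variable A : 'M[R]_n.
Hypothesis AF : forall p v, F p v -> F (p - 1) (toC A *m v).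
Hypothesis AW : forall l v, W l v -> W (l - 2) (A *m v).
Hypothesis hA : is_weight_filtration A (fun l => W (l + w)).

Let N : 'M[C]_n := toC A.

Lemma N_shift p q v : I p q v -> I (p - 1) (q - 1) (N *m v).
Proof. exact: deligne_shift. Qed.

Definition wproj (l : int) : 'M[C]_n := dop (fun i => (i.1 + i.2 - w == l)%:R).

Lemma wproj_N l : N *m wproj l = wproj (l - 2) *m N.
Proof.
rewrite [RHS](dop_shift (a := -1) (b := -1)); last exact: N_shift.
congr (_ *m dop _); apply/funext => -[p q] /=; congr (_%:R : C); congr nat_of_bool.
by apply/eqP/eqP; lia.
Qed.

Lemma wproj_NX l (j : nat) : N ^+ j *m wproj l = wproj (l - j%:Z * 2) *m N ^+ j.
Proof.
elim: j l => [|j ih] l; first by rewrite mul0r subr0 expr0 mul1mx mulmx1.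
rewrite exprS mx_mulE -mulmxA ih mulmxA wproj_N -mulmxA.
by congr (wproj _ *m _); lia.
Qed.

Lemma wproj_idem l : wproj l *m wproj l = wproj l.
Proof.
rewrite dop_mul; congr dop; apply/funext => i.
by case: eqP => _; rewrite ?mulr1 ?mulr0.
Qed.

Lemma wproj_W l v : WC (l + w) (wproj l *m v).
Proof.
have [B hB] := deligne_bounded hM hR.
have [f If ->] := deligne_box_span hM hR hB v.
rewrite mulmx_sumr; apply: subspace_sum; first exact: (mhs_Wsub hM).
move=> [p q] _; rewrite (dopE _ (If (p, q))) /=.
have [<-|_] := eqVneq; last first.
  by rewrite scale0r; exact: subspace0 (mhs_Wsub hM _).
by rewrite scale1r subrK; exact: deligne_W (If (p, q)).
Qed.

Lemma wproj_W0 l l' v : l' < l -> WC (l' + w) v -> wproj l *m v = 0.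
Proof.
move=> ll' /(deligne_W_span hM hR)[s [f [hf ->]]].
rewrite mulmx_sumr big1_seq// => -[p q] /andP[_ /hf[/= pq If]].
rewrite (dopE _ If) /=; have [e|_] := eqVneq; last by rewrite scale0r.
lia.
Qed.

Lemma toC_exp (X : 'M[R]_n) (j : nat) : toC (X ^+ j) = toC X ^+ j.
Proof.
elim: j => [|j ih]; first by rewrite !expr0 toC1.
by rewrite !exprS !mx_mulE toC_mul ih.
Qed.

Lemma NX_split (j : nat) (v : 'cV[C]_n) : N ^+ j *m v =
  toC (A ^+ j *m reC v) + 'i *: toC (A ^+ j *m imC v).
Proof. by rewrite {1}[v]toCE mulmxDr -scalemxAr /N -toC_exp -!toC_mul. Qed.

(** This lemma and the next are the hard Lefschetz property of the weight
    filtration, read on the eigenspaces of Ygr, which represent its graded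
    pieces. *)
Lemma lefschetz_inj (l : nat) (v : 'cV[C]_n) :
  N ^+ l *m (wproj l%:Z *m v) = 0 -> wproj l%:Z *m v = 0.
Proof.
move=> Nv0; set u := wproj _ *m v in Nv0 *.
have [_ _ hinj _] := hA.
have Wsub j : is_subspace (W j) by case: hM => -[].
have /cplxP[W1 W2] : WC (l%:Z + w) u by exact: wproj_W.
move: Nv0; rewrite NX_split => Nv0.
have n1 : A ^+ l *m reC u = 0.
  by rewrite -[LHS](reC_toC _ (A ^+ l *m imC u)) Nv0; apply/matrixP => a b; rewrite !mxE.
have n2 : A ^+ l *m imC u = 0.
  by rewrite -[LHS](imC_toC (A ^+ l *m reC u)) Nv0; apply/matrixP => a b; rewrite !mxE.
have h1 : W (l%:Z - 1 + w) (reC u).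
  by apply: hinj => //; rewrite n1; exact: subspace0 (Wsub _).
have h2 : W (l%:Z - 1 + w) (imC u).
  by apply: hinj => //; rewrite n2; exact: subspace0 (Wsub _).
rewrite /u -wproj_idem -mulmxA -/u; apply: (@wproj_W0 _ (l%:Z - 1)); first by lia.
exact/cplxP.
Qed.

Lemma lefschetz_surj (l : nat) (v : 'cV[C]_n) :
  exists u, N ^+ l *m (wproj l%:Z *m u) = wproj (- l%:Z) *m v.
Proof.
have [_ _ _ hsurj] := hA.
set v' := wproj _ *m v.
have /cplxP[W1 W2] : WC (- l%:Z + w) v' by exact: wproj_W.
have [x1 _ Wx1] := hsurj _ _ W1; have [x2 _ Wx2] := hsurj _ _ W2.
exists (toC x1 + 'i *: toC x2); rewrite mulmxA wproj_NX -mulmxA.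
have -> : l%:Z - l%:Z * 2 = - l%:Z by lia.
rewrite NX_split reC_toC imC_toC; apply/esym/eqP; rewrite -subr_eq0; apply/eqP.
have Pv : wproj (- l%:Z) *m v' = v' by rewrite /v' mulmxA wproj_idem.
rewrite -{1}Pv -mulmxBr; apply: (@wproj_W0 _ (- l%:Z - 1)); first by lia.
apply/cplxP; rewrite [v']toCE opprD addrACA -scalerBr -!toCB reC_toC imC_toC.
by split.
Qed.

(** N^l is an isomorphism between the eigenspaces of Ygr for l and - l that
    commutes with Z. *)
Lemma wproj_trace (l : nat) (Z : 'M[C]_n) : N *m Z = Z *m N ->
  \tr (wproj l%:Z *m Z) = \tr (wproj (- l%:Z) *m Z).
Proof.
move=> NZ; pose P := wproj l%:Z; pose P' := wproj (- l%:Z); pose B := N ^+ l *m P.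
have BE : B = P' *m N ^+ l.
  by rewrite /B wproj_NX /P'; congr (wproj _ *m _); lia.
have PP : P *m P = P by exact: wproj_idem.
have P'P' : P' *m P' = P' by exact: wproj_idem.
have /choice[g hg] : forall j : 'I_n, exists u : 'cV[C]_n, B *m u = col j P'.
  move=> j; have [u hu] := lefschetz_surj l (delta_mx j 0).
  by exists u; rewrite /B -mulmxA hu colE.
pose M := P *m \matrix_(a, j) g j a 0.
have BM : B *m M = P'.
  rewrite /M mulmxA -[_ *m P]mulmxA PP; apply/matrixP => a j.
  have := congr1 (fun x : 'cV[C]_n => x a 0) (hg j); rewrite [RHS]mxE => <-.
  by rewrite -/B mxE [RHS]mxE; apply: eq_bigr => b _; congr (_ * _); rewrite mxE.
have PM : P *m M = M by rewrite /M mulmxA PP.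
have MB : M *m B = P.
  apply/eqP; rewrite -subr_eq0; apply/eqP/matrixP => a b.
  have PX : P *m (M *m B - P) = M *m B - P by rewrite mulmxBr mulmxA PM PP.
  have BX : B *m (M *m B - P) = 0.
    by rewrite mulmxBr mulmxA BM {1}BE mulmxA P'P' -BE /B -mulmxA PP subrr.
  move: (M *m B - P) PX BX => D PX BX.
  have : P *m (D *m delta_mx b (0 : 'I_1)) = 0.
    by apply: lefschetz_inj; rewrite mulmxA -/P -/B mulmxA BX mul0mx.
  rewrite mulmxA PX -colE => /(congr1 (fun x : 'cV[C]_n => x a 0)).
  by rewrite mxE => ->; rewrite !mxE.
have NZl : N ^+ l *m Z = Z *m N ^+ l.
  by rewrite -!mx_mulE; apply/esym; apply: commrX; rewrite /GRing.comm !mx_mulE.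
have BZP : B *m (Z *m P) = P' *m (Z *m B).
  by rewrite {1}BE /B -!mulmxA [N ^+ l *m (Z *m _)]mulmxA NZl -!mulmxA.
exact: (trace_intertwine MB BM PP P'P' BZP).
Qed.

(** The contributions of the eigenvalues l and - l cancel. *)
Lemma Ygr_trace (Z : 'M[C]_n) : N *m Z = Z *m N -> \tr (Ygr *m Z) = 0.
Proof.
move=> NZ; have [B hB] := deligne_bounded hM hR.
(* s contains all the eigenvalues of Ygr. *)
pose s := int_box (B.*2 + absz w).
pose t l := \tr (wproj l *m Z).
have tN l : t (- l) = t l.
  case: l => l; first by rewrite /t wproj_trace.
  by rewrite NegzE opprK; exact: wproj_trace.
have YE : Ygr = \sum_(l <- s) l%:~R *: wproj l.
  under eq_bigr do rewrite dopZ.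
  rewrite dop_sum; apply: deligne_eq => p q v Iv; rewrite !(dopE _ Iv) /=.
  have [->|v0] := eqVneq v 0; first by rewrite !scaler0.
  have := hB (p, q) v Iv v0; rewrite mem_box /= => /andP[pB qB].
  congr (_ *: _); rewrite (bigD1_seq (p + q - w))/=; last 2 first.
    by rewrite mem_int_box; lia.
    exact: int_box_uniq.
  rewrite eqxx mulr1 big1 ?addr0// => l /negPf lpq.
  by rewrite eq_sym lpq mulr0.
have tE : \tr (Ygr *m Z) = \sum_(l <- s) l%:~R * t l.
  rewrite YE mulmx_suml raddf_sum/=; apply: eq_bigr => l _.
  by rewrite -scalemxAl mxtraceZ.
have tE' : \sum_(l <- s) l%:~R * t l = - \sum_(l <- s) l%:~R * t l.
  have ps : perm_eq s (map -%R s).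
    apply: uniq_perm; first exact: int_box_uniq.
      by rewrite map_inj_uniq ?int_box_uniq//; exact: oppr_inj.
    move=> l; apply/idP/mapP => [ls|[l' l's ->]]; last by move: l's; rewrite !mem_int_box normrN.
    by exists (- l); rewrite ?opprK//; move: ls; rewrite !mem_int_box normrN.
  rewrite {1}(perm_big _ ps) big_map -sumrN; apply: eq_bigr => l _.
  by rewrite tN mulrNz mulNr.
rewrite tE; apply/eqP; move/eqP: tE'; rewrite -addr_eq0 -mulr2n -mulr_natl mulf_eq0.
by rewrite pnatr_eq0.
Qed.

(** A form of the Jacobson-Morozov theorem compatible with the splitting.  By
    duality for the trace form, Ygr_trace says that [X, N] = Ygr is solvable.
    Since N has type (-1,-1) and Ygr has type (0,0), the component of X of type
    (1,1) is a solution, and since N and Ygr are real, so is the average of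
    this component with its conjugate. *)
Lemma exists_sl2_raising : exists Np : 'M[R]_n,
  (forall p q v, I p q v -> I (p + 1) (q + 1) (toC Np *m v)) /\
  toC Np *m N - N *m toC Np = Ygr.
Proof.
have [X hX] : exists X : 'M[C]_n, X *m N - N *m X = Ygr.
  pose f := mulmxr N \- mulmx N.
  have [|X hX] := @trace_fredholm _ _ (f : {linear 'M[C]_n -> 'M[C]_n}) Ygr; last first.
    by exists X; rewrite -hX.
  move=> Z hZ; apply: Ygr_trace; apply/eqP; rewrite -subr_eq0; apply/eqP.
  apply: mxtrace_nondegenerate => X; have := hZ X.
  rewrite /f /= mulmxBl raddfB/= mulmxBr raddfB/= [X in _ - X]mxtrace_mulC.
  by rewrite -mulmxA [Z *m _]mulmxA [\tr (_ *m X)]mxtrace_mulC.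
have [X1 X1E'] := deligne_component (1, 1) X.
have X1E p q v : I p q v -> X1 *m v = proj_I (p + 1, q + 1) *m (X *m v).
  by move=> Iv; rewrite (X1E' _ _ _ Iv) /= [1 + p]addrC [1 + q]addrC.
have X1shift p q v : I p q v -> I (p + 1) (q + 1) (X1 *m v).
  by move=> Iv; rewrite (X1E _ _ _ Iv); exact: (proj_I_mem (p + 1, q + 1)).
have X1N : X1 *m N - N *m X1 = Ygr.
  apply: deligne_eq => p q v Iv; rewrite mulmxBl -!mulmxA.
  rewrite (X1E _ _ _ (N_shift Iv)) (X1E _ _ _ Iv) !subrK.
  have sh : proj_I (p, q) *m N = N *m proj_I (p + 1, q + 1).
    rewrite (dop_shift (a := -1) (b := -1)); last exact: N_shift.
    congr (_ *m dop _); apply/funext => -[p' q'] /=; congr (_%:R : C); congr nat_of_bool.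
    by apply/eqP/eqP => -[e1 e2]; congr pair; lia.
  have -> : N *m (proj_I (p + 1, q + 1) *m (X *m v)) =
      proj_I (p, q) *m (N *m (X *m v)) by rewrite mulmxA -sh -mulmxA.
  rewrite -mulmxBr [X *m _]mulmxA [N *m _]mulmxA -mulmxBl hX.
  by rewrite (dopE _ Iv) -scalemxAr (dopE _ Iv) eqxx scale1r.
pose X2 := 2^-1 *: (X1 + conjmx X1).
have X2c : conjmx X2 = X2.
  by rewrite /X2 conjmxZ conjmxD conjmxK addrC conj_Creal// rpredV realn.
have X2N : X2 *m N - N *m X2 = Ygr.
  have e : conjmx X1 *m N - N *m conjmx X1 = Ygr.
    by rewrite -[RHS]conj_Ygr -X1N conjmxD conjmxN !conjmx_mul conjmx_toC.
  rewrite /X2 -scalemxAl -scalemxAr -scalerBr mulmxDl mulmxDr opprD addrACA X1N e.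
  rewrite scalerDr -scalerDl (_ : 2^-1 + 2^-1 = 1) ?scale1r//; by field.
exists (reC X2); rewrite conjmx_real//; split=> // p q v Iv.
rewrite /X2 -scalemxAl; apply: subspaceZ; first exact: deligne_subspace.
rewrite mulmxDl; apply: subspaceD; first exact: deligne_subspace.
  exact: X1shift.
rewrite -[v]conjmxK -conjmx_mul; apply: (deligne_conj hR).
by apply: X1shift; exact: deligne_conj.
Qed.

End Lefschetz.

(** * Conjugation by the exponential of the lowering operator *)

Section Sl2Exponential.
Context {K : numFieldType} {n : nat}.
Variables (T Y N Np : 'M[K]_n).
Hypothesis TN : T *m N = N *m T.
Hypothesis YN : Y *m N - N *m Y = - 2 *: N.
Hypothesis NpN : Np *m N - N *m Np = Y.
Hypothesis Nn : N ^+ n = 0.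

Lemma nilp_exp_ge j : (n <= j)%N -> N ^+ j = 0.
Proof. by move=> /subnK <-; rewrite exprD Nn mulr0. Qed.

Lemma sl2_NpNX j : Np *m N ^+ j.+1 =
  N ^+ j.+1 *m Np + j.+1%:R *: (N ^+ j *m (Y - j%:R%:M)).
Proof.
have NpN' : Np *m N = N *m Np + Y by rewrite -NpN addrC subrK.
have YN' : Y *m N = N *m Y - 2 *: N by rewrite -[LHS](subrK (N *m Y)) YN addrC scaleNr.
elim: j => [|j ih].
  by rewrite !expr1 expr0 NpN' scale1r mul1mx raddf0 subr0.
rewrite exprSr mx_mulE mulmxA ih mulmxDl -[N ^+ j.+1 *m Np *m N]mulmxA NpN'.
rewrite mulmxDr mulmxA -[N ^+ j.+1 *m N]mx_mulE -exprSr -addrA; congr (_ + _).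
rewrite -scalemxAl -mulmxA mulmxBl YN' mul_scalar_mx -addrA -opprD -scalerDl.
have -> : N *m Y - (2 + j%:R) *: N = N *m (Y - (j.+2)%:R%:M).
  by rewrite mulmxBr mul_mx_scalar -natrD.
rewrite mulmxA -[N ^+ j *m N]mx_mulE -exprSr !mulmxBr !mul_mx_scalar !scalerBr !scalerA.
rewrite addrA -{1}[_ *m Y]scale1r -scalerDl nat1r; congr (_ - _ *: _).
by rewrite -!natrM; congr _%:R; lia.
Qed.

Lemma expnilE (s : K) : expnil (s *: N) =
  \sum_(j < n.+1) (s ^+ j / j`!%:R) *: N ^+ j.
Proof.
by apply: eq_bigr => j _; rewrite mx_exprZ scalerA mulrC.
Qed.

(** The expansion exp(- s ad N) Np = Np + s Y - s^2 N, which stops there because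
    (ad N)^3 Np = 0. *)
Lemma expnil_sl2 (s : K) : Np *m expnil (s *: N) =
  expnil (s *: N) *m (Np + s *: Y - s ^+ 2 *: N).
Proof.
pose e (j : nat) : 'M[K]_n := (s ^+ j / j`!%:R) *: N ^+ j.
have EE : expnil (s *: N) = \sum_(0 <= j < n.+3) e j.
  have n3 : (n.+1 <= n.+3)%N by lia.
  rewrite expnilE -(big_mkord xpredT e) [RHS](big_cat_nat (leq0n _) n3)/= /e.
  rewrite [X in _ + X]big_nat_cond [X in _ + X]big1 ?addr0// => j /andP[/andP[nj _] _].
  by rewrite nilp_exp_ge ?scaler0// ltnW.
have EE1 : expnil (s *: N) = \sum_(0 <= j < n.+2) e j.
  by rewrite EE big_nat_recr//= {2}/e nilp_exp_ge ?scaler0 ?addr0// ltnW// ltnW.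
have EE2 : expnil (s *: N) = \sum_(0 <= j < n.+1) e j.
  by rewrite EE1 big_nat_recr//= {2}/e nilp_exp_ge ?scaler0 ?addr0// ltnW.
have fact_neq0 (j : nat) : (j`!%:R : K) != 0 by rewrite pnatr_eq0 -lt0n fact_gt0.
have nat_neq0 (j : nat) : (j.+1%:R : K) != 0 by rewrite pnatr_eq0.
have e0 : Np *m e 0%N = e 0%N *m Np.
  by rewrite /e expr0 -scalemxAl -scalemxAr mulmx1 mul1mx.
have e1 : Np *m e 1%N = e 1%N *m Np + s *: (e 0%N *m Y).
  rewrite /e -scalemxAr sl2_NpNX raddf0 subr0 !expr1 !expr0 !divr1.
  by rewrite !scale1r !mul1mx scalerDr scalemxAl.
have e2 j : Np *m e j.+2 = e j.+2 *m Np + s *: (e j.+1 *m Y) - s ^+ 2 *: (e j *m N).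
  rewrite /e -scalemxAr sl2_NpNX mulmxBr mul_mx_scalar !scalerDr !scalerN !scalerA.
  rewrite -!scalemxAl !scalerA addrA -[N ^+ j *m N]mx_mulE -exprSr.
  congr (_ + _ *: _ - _ *: _).
    rewrite factS natrM exprS; move: (fact_neq0 j.+1) (nat_neq0 j.+1).
    by move: (s ^+ j.+1) (j.+1`!%:R : K) (j.+2%:R : K) => x y z y0 z0; field; rewrite y0 z0.
  rewrite !factS !natrM !exprS expr0; move: (fact_neq0 j) (nat_neq0 j) (nat_neq0 j.+1).
  move: (s ^+ j) (j`!%:R : K) (j.+1%:R : K) (j.+2%:R : K) => x y z t y0 z0 t0.
  by field; rewrite y0 z0 t0.
rewrite {1}EE !mulmxDr mulmxN -!scalemxAr {1}EE {1}EE1 {1}EE2.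
rewrite !mulmx_suml mulmx_sumr !big_nat_recl//= e0 e1.
under [in LHS]eq_bigr do rewrite e2.
rewrite sumrB big_split/= -!scaler_sumr.
rewrite (e2 0%N); move: e (\sum_(0 <= i < n) _) {e0 e1 e2 EE EE1 EE2} => e S1.
move: (\sum_(0 <= i < n) _) (\sum_(0 <= i < n) _) => S2 S3.
apply/matrixP => a b; rewrite !mxE; ring.
Qed.

(** In terms of the exponential, which carries F to a point of the orbit, the
    lowering operator disappears; the remaining operator T + Y + a^-1 Np is
    2 p - w on F^p modulo F^(p+1). *)
Lemma Hgr_expnil (a : K) : a != 0 ->
  (T + a^-1 *: Np + a *: N) *m expnil (a *: N) =
  expnil (a *: N) *m (T + Y + a^-1 *: Np).
Proof.
move=> a0.
have NX j : N *m N ^+ j = N ^+ j *m N by rewrite -!mx_mulE -exprS -exprSr.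
have TE : T *m expnil (a *: N) = expnil (a *: N) *m T.
  rewrite expnilE mulmx_sumr mulmx_suml; apply: eq_bigr => j _.
  rewrite -scalemxAl -scalemxAr -!mx_mulE; congr (_ *: _).
  by apply: commrX; rewrite /GRing.comm !mx_mulE.
have NE : N *m expnil (a *: N) = expnil (a *: N) *m N.
  rewrite expnilE mulmx_sumr mulmx_suml; apply: eq_bigr => j _.
  by rewrite -scalemxAl -scalemxAr NX.
rewrite 2!mulmxDl -!scalemxAl TE NE expnil_sl2 [in RHS]mulmxDr [in RHS]mulmxDr.
rewrite mulmxBr [_ *m (Np + _)]mulmxDr -!scalemxAr !scalerBr !scalerDr !scalerA.
rewrite mulVf// scale1r expr2 mulKf//.
by rewrite -[RHS]addrA [X in _ = _ + X]addrC addrA -!addrA addNr addr0.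
Qed.

End Sl2Exponential.

(** * Hodge gradings along a nilpotent orbit *)

(** The minimal polynomial divides a power of 'X and has degree at most n. *)
Lemma nilpotent_exp_dim (K : fieldType) n (A : 'M[K]_n) j : A ^+ j = 0 -> A ^+ n = 0.
Proof.
case: n A => [|n] A Aj; first by rewrite [_ ^+ _]flatmx0 [RHS]flatmx0.
have hdvd : mxminpoly A %| ('X - 0%:P) ^+ j.
  by apply: mxminpoly_min; rewrite subr0 rmorphXn/= horner_mx_X.
have [i _ pi_] := dvdp_exp_XsubCP hdvd.
have ni : (i <= n.+1)%N.
  have : (size (mxminpoly A) <= size (char_poly A))%N.
    by apply: dvdp_leq (mxminpoly_dvd_char A); rewrite -size_poly_gt0 size_char_poly.
  by rewrite (eqp_size pi_) size_char_poly size_exp_XsubC.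
have Ai : A ^+ i = 0.
  have : mxminpoly A %| 'X^i by rewrite (eqp_dvdl _ pi_) subr0.
  move=> /dvdpP[q qE]; have := congr1 (horner_mx A) qE.
  by rewrite rmorphXn rmorphM/= horner_mx_X mx_root_minpoly mulr0.
have -> : A ^+ n.+1 = A ^+ (n.+1 - i) * A ^+ i by rewrite -exprD subnK.
by rewrite Ai mulr0.
Qed.

Lemma toC_sum (R : realType) m n (I : Type) (r : seq I) (P : pred I)
    (F : I -> 'M[R]_(m, n)) :
  toC (\sum_(i <- r | P i) F i) = \sum_(i <- r | P i) toC (F i).
Proof. exact: (big_morph _ (@toCD R m n) (@toC0 R m n)). Qed.

(** Two values of y separate the terms of y |-> T + Np / y - y A. *)
Lemma solve_pencil (R : realType) n (y1 y2 : R) (T : 'M[R[i]]_n)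
    (Np A a1 a2 : 'M[R]_n) : y1 != 0 -> y2 != 0 -> y1 != y2 ->
  T + (y1^-1)%:C%C *: toC Np - y1%:C%C *: toC A = toC a1 ->
  T + (y2^-1)%:C%C *: toC Np - y2%:C%C *: toC A = toC a2 ->
  [/\ y1^-1 - y2^-1 != 0,
    (y1^-1 - y2^-1)^-1 *: (a1 - a2 + (y1 - y2) *: A) = Np &
    toC (a1 - y1^-1 *: Np + y1 *: A) = T].
Proof.
move=> y10 y20 y12 E1 E2.
have d0 : y1^-1 - y2^-1 != 0 by rewrite subr_eq0; apply: contraNneq y12 => /invr_inj ->.
split=> //.
  have -> : a1 - a2 + (y1 - y2) *: A = (y1^-1 - y2^-1) *: Np.
    apply: (@toC_inj R); rewrite toCD toCB -E1 -E2 !toCZ !rmorphB/= !scalerBl.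
    move: (_ *: toC Np) (_ *: toC Np) (_ *: toC A) (_ *: toC A) => b c d e.
    by apply/matrixP => x y; rewrite !mxE; ring.
  by rewrite scalerA mulVf// scale1r.
by rewrite toCD toCB !toCZ -E1 addrAC subrK addrK.
Qed.

Section HodgeOrbit.
Context {R : realType} {k n m : nat} (H : hodge_datum R k n).
Variables (F : int -> set 'cV[R[i]]_n) (N : 'I_m -> 'M[R]_k) (W : int -> set 'cV[R]_n).
Hypothesis hG : is_algebraic_group (hd_G H).
Hypothesis hH : is_hodge_representation H.
Hypothesis hF : is_Rsplit_nilpotent_orbit H F N W.

Local Notation C := R[i].
Local Notation w := (hd_wt H).
Local Notation drho := (hd_drho H).
Local Notation rho := (regR (hd_rho H)).

Lemma drho_lin : linear_mx drho.
Proof. exact: regdiff_linear. Qed.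

Lemma orbit_mhs : is_mixed_hodge F W.
Proof. by case: hF. Qed.

Lemma orbit_Rsplit p q : conjset (deligne F W p q) = deligne F W q p.
Proof. by case: hF. Qed.

Let hM := orbit_mhs.
Let hR := orbit_Rsplit.

Lemma hodge_space_subspace p q : p + q = w -> is_subspace (hodge_space H p q).
Proof.
move=> pq; split=> [|a u v [_ hu] [_ hv]]; split=> // z z1.
  by rewrite mulmx0 scaler0.
by rewrite mulmxDr -scalemxAr hu// hv// scalerDr !scalerA mulrC.
Qed.

Lemma hodge_space_diag_subspace p : is_subspace (hodge_space H p (w - p)).
Proof. by apply: hodge_space_subspace; rewrite addrC subrK. Qed.

Lemma hodge_space_conj p q v : hodge_space H p q v -> hodge_space H q p (conjmx v).
Proof.
by case: hH => _ _ _ hc _ hv; rewrite -hc; exists v.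
Qed.

Lemma hodge_flag_subspace p : is_subspace (hodge_flag H p).
Proof. by apply: sumset_subspace => r; exact: hodge_space_diag_subspace. Qed.

(** v has components only in the V^(r,w-r) with r >= p, and, by conjugation, only
    in those with r <= w - q < p. *)
Lemma hodge_flag_disjoint p q v : w < p + q -> hodge_flag H p v ->
  hodge_flag H q (conjmx v) -> v = 0.
Proof.
have [_ _ [_ ind] _ _] := hH.
move=> wpq /(sumset_uniq hodge_space_diag_subspace)[s [f [us hf ve]]].
move=> /(sumset_uniq hodge_space_diag_subspace)[t [g [ut hg cve]]].
pose t' := map (fun r => w - r) t.
pose g' r := conjmx (g (w - r)).
have ve' : v = \sum_(r <- t') g' r.
  rewrite -[v]conjmxK cve conjmx_sum /t' big_map; apply: eq_bigr => r _.
  by rewrite /g' subKr.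
have st r : r \in s -> r \in t' -> false.
  move=> /hf[pr _] /mapP[r' /hg[qr' _] rE]; lia.
have ust : uniq (s ++ t').
  rewrite cat_uniq us /= map_inj_uniq ?ut ?andbT; last first.
    by move=> x y; lia.
  by apply/hasPn => r rt; apply/negP => rs; have := st _ rs rt.
pose h r := if r \in s then f r else - g' r.
have := ind (s ++ t') h ust _ _.
have hE r : r \in s ++ t' -> hodge_space H r (w - r) (h r).
  rewrite mem_cat /h; case: (boolP (r \in s)) => [/hf[]//|_ /= /mapP[r' r't ->]].
  apply: subspaceN; first exact: hodge_space_diag_subspace.
  by rewrite /g' subKr; apply: hodge_space_conj; have [] := hg _ r't.
have sumh : \sum_(r <- s ++ t') h r = 0.
  rewrite big_cat/= [X in X + _ = _](_ : _ = v); last first.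
    by rewrite ve !big_seq; apply: eq_bigr => r rs; rewrite /h rs.
  rewrite [X in _ + X = _](_ : _ = - v) ?subrr// ve' -sumrN !big_seq.
  by apply: eq_bigr => r rt; rewrite /h; case: ifPn => // rs; have := st _ rs rt.
move=> /(_ hE sumh) h0; rewrite ve big1_seq// => r /andP[_ rs].
by have := h0 r; rewrite mem_cat rs /h rs; exact.
Qed.

Variable A : 'M[R]_k.
Hypothesis hA : nilpotent_cone N A.

Let NC : 'M[C]_n := toC (drho A).

Lemma cone_drho (t : 'I_m -> R) : drho (\sum_i t i *: N i) = \sum_i t i *: drho (N i).
Proof.
rewrite linear_mx_sum; last exact: drho_lin.
by apply: eq_bigr => i _; rewrite linear_mxZ//; exact: drho_lin.
Qed.

Lemma orbit_g i : hd_g H (N i).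
Proof. by case: hF => -[_ h _ _ _] _ _ _; have [] := h i. Qed.

Lemma cone_g : hd_g H A.
Proof.
have [t _ <-] := hA; have [h0 hlin] := lie_of_subspace hG.
elim/big_rec: _ => // i x _ hx; exact: hlin (orbit_g i) hx.
Qed.

Lemma orbit_F i p v : F p v -> F (p - 1) (toC (drho (N i)) *m v).
Proof. by case: hF => -[_ _ _ h _] _ _ _; exact: h. Qed.

Lemma cone_F p v : F p v -> F (p - 1) (NC *m v).
Proof.
have [t _ At] := hA; rewrite /NC -At cone_drho => Fv.
rewrite toC_sum mulmx_suml; apply: subspace_sum; first exact: mhs_Fsub hM _.
move=> i _; rewrite toCZ -scalemxAl; apply: subspaceZ; first exact: mhs_Fsub hM _.
exact: orbit_F.
Qed.

Lemma cone_weight : is_weight_filtration (drho A) (fun l => W (l + w)).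
Proof. by case: hF => _ h _ _; exact: h. Qed.

Lemma cone_W l v : W l v -> W (l - 2) (drho A *m v).
Proof.
have [_ h _ _] := cone_weight; move=> Wv.
have := h (l - w) v; rewrite subrK => /(_ Wv).
by have -> : l - w - 2 + w = l - 2 by lia.
Qed.

Lemma cone_shift p q v : deligne F W p q v -> deligne F W (p - 1) (q - 1) (NC *m v).
Proof. by apply: deligne_shift => //; [exact: cone_F | exact: cone_W]. Qed.

Lemma cone_nilpotent : NC ^+ n = 0.
Proof.
have [B hB] := deligne_bounded hM hR.
apply: (@nilpotent_exp_dim _ _ _ B.*2.+1); apply: (deligne_eq hM hR) => p q v Iv.
have sh (j : nat) : deligne F W (p - j%:Z) (q - j%:Z) (NC ^+ j *m v).
  elim: j => [|j ih]; first by rewrite !subr0 expr0 mul1mx.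
  rewrite exprS mx_mulE -mulmxA.
  have -> : p - j.+1%:Z = p - j%:Z - 1 by lia.
  have -> : q - j.+1%:Z = q - j%:Z - 1 by lia.
  exact: cone_shift.
rewrite mul0mx; apply/eqP; apply/negPn/negP => nz.
have v0 : v != 0 by apply: contraNneq nz => ->; rewrite mulmx0.
have := hB (_, _) _ (sh _) nz; have := hB (_, _) _ Iv v0.
rewrite !mem_box /=; lia.
Qed.

Variable Np : 'M[R]_n.
Hypothesis Np_shift : forall p q v, deligne F W p q v ->
  deligne F W (p + 1) (q + 1) (toC Np *m v).
Local Notation T := (Tgr hM hR).
Local Notation Y := (Ygr w hM hR).
Hypothesis NpN : toC Np *m NC - NC *m toC Np = Y.

Lemma Tgr_comm : T *m NC = NC *m T.
Proof.
rewrite /Tgr (@dop_shift _ _ _ _ hM hR NC (-1) (-1) _ cone_shift).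
by congr (_ *m dop _ _ _); apply/funext => i /=; congr _%:~R; lia.
Qed.

Lemma Ygr_comm : Y *m NC - NC *m Y = - 2 *: NC.
Proof.
apply: (deligne_eq hM hR) => p q v Iv.
rewrite mulmxBl -!mulmxA (dopE _ _ _ (cone_shift Iv)) (dopE _ _ _ Iv) /=.
rewrite -scalemxAr -scalerBl -scalemxAl -rmorphB/=; congr (_ *: _).
have -> : p - 1 + (q - 1) - w - (p + q - w) = - 2 by lia.
by rewrite rmorphN.
Qed.

(** The Hodge grading of the point exp(i y N) F of D, for large y (Hgr_mem). *)
Definition Hgr (y : R) : 'M[C]_n :=
  T + ('i * y%:C%C)^-1 *: toC Np + ('i * y%:C%C) *: NC.

Lemma conj_Hgr y : conjmx (Hgr y) = - Hgr y.
Proof.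
have conjiy : ('i * y%:C%C : C)^* = - ('i * y%:C%C).
  by rewrite rmorphM/= conjCi conj_Creal ?complex_real// mulNr.
rewrite /Hgr !conjmxD !conjmxZ !conjmx_toC conj_Tgr !opprD -!scaleNr.
have -> : ('i * y%:C%C : C)^-1^* = - ('i * y%:C%C)^-1 by rewrite fmorphV/= conjiy invrN.
by rewrite conjiy.
Qed.

Let iy (y : R) : C := 'i * y%:C%C.

Lemma iy_neq0 (y : R) : y != 0 -> iy y != 0.
Proof.
move=> y0; rewrite mulf_neq0 ?neq0Ci//.
by apply: contraNneq y0 => /(congr1 (@complex.Re R)) /= ->.
Qed.

Lemma Hgr_filtration y p v : y != 0 -> F p v ->
  exists2 x, F (p + 1) x &
    Hgr y *m (expnil (iy y *: NC) *m v) =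
    (2 * p - w)%:~R *: (expnil (iy y *: NC) *m v) + expnil (iy y *: NC) *m x.
Proof.
move=> y0 Fv.
(* The operator T + Y acts on I^(a,b) by 2 a - w, which is 2 p - w for a = p. *)
pose x := (T + Y + (iy y)^-1 *: toC Np) *m v - (2 * p - w)%:~R *: v.
exists x; last first.
  rewrite mulmxA (Hgr_expnil Tgr_comm Ygr_comm NpN cone_nilpotent); last exact: iy_neq0.
  by rewrite /x mulmxBr -scalemxAr [RHS]addrC subrK mulmxA.
have Fsub := mhs_Fsub hM (p + 1).
have [s [f [hf ve]]] := deligne_F_span hM hR Fv.
have -> : x = \sum_(i <- s) ((T + Y + (iy y)^-1 *: toC Np) *m f i - (2 * p - w)%:~R *: f i).
  by rewrite sumrB -mulmx_sumr -scaler_sumr -ve.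
rewrite big_seq; apply: subspace_sum => // -[a b] /hf/= [pa If].
rewrite !mulmxDl /Tgr /Ygr !(dopE _ _ _ If) /= -scalemxAl -scalerDl addrAC -scalerBl.
apply: subspaceD => //; last first.
  have pa1 : p + 1 <= a + 1 by rewrite lerD2r.
  by apply: subspaceZ => //; exact: (mhs_Fle hM pa1 (deligne_F hR (Np_shift If))).
rewrite -rmorphD -rmorphB/=.
have [->|ap] := eqVneq a p.
  rewrite (_ : p - b + (p + b - w) - (2 * p - w) = 0) ?scale0r; last by lia.
  exact: subspace0.
have pa1 : p + 1 <= a by lia.
by apply: subspaceZ => //; exact: (mhs_Fle hM pa1 (deligne_F hR If)).
Qed.

Lemma orbit_mem : exists c : R, forall y, c < y -> 0 < y ->
  mt_domain H (act_flag (expnil (iy y *: NC)) F).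
Proof.
have [t t0 At] := hA.
case: hF => -[_ _ _ _ [c hc]] _ _ _.
exists (\sum_i `|c| / t i) => y cy y0.
have := hc (fun i => iy (y * t i)); rewrite /NC -At cone_drho toC_sum scaler_sumr.
rewrite [X in expnil X](eq_bigr (fun i => iy y *: toC (t i *: drho (N i)))); last first.
  by move=> i _; rewrite toCZ scalerA /iy -mulrA -rmorphM.
apply => i; rewrite /iy imaginaryE /=.
have : `|c| / t i <= \sum_i `|c| / t i.
  rewrite (bigD1 i)//= lerDl; apply: sumr_ge0 => j _.
  by rewrite divr_ge0// ltW//; exact: t0.
rewrite ler_pdivrMr; last exact: t0.
move=> h; have : `|c| < y * t i.
  by apply: le_lt_trans h _; rewrite ltr_pM2r//; exact: t0.
have := ler_norm c; lra.
Qed.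

(** At the point rho(g) F_phi, the operator Hgr y maps each V^(p,q) to itself by
    p - q up to a term one step higher in the Hodge flag.  As it is the opposite
    of its conjugate, the same holds for the conjugate flag, and the error term
    vanishes.  So Hgr y is the conjugate by rho(g) of the Hodge grading at the
    base point. *)
Lemma Hgr_mem y : y != 0 -> mt_domain H (act_flag (expnil (iy y *: NC)) F) ->
  exists2 X, hd_g H X & toC (drho X) = 'i *: Hgr y.
Proof.
move=> y0 [g Gg gF]; set E := expnil _ in gF; pose r : 'M[C]_n := toC (rho g).
have gFp p : [set r *m v | v in hodge_flag H p] = [set E *m v | v in F p].
  exact: (congr1 (fun Fl => Fl p) gF).
have [X GX hX] := hodge_generator hG hH.
have rU : rho g \in unitmx by apply: hodge_regR_unit Gg.
have rK (v : 'cV[C]_n) : toC (invmx (rho g)) *m (r *m v) = v.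
  by rewrite mulmxA -toC_mul mulVmx// toC1 mul1mx.
have up p v : hodge_flag H p v -> exists2 x, hodge_flag H (p + 1) x &
    Hgr y *m (r *m v) = (2 * p - w)%:~R *: (r *m v) + r *m x.
  move=> Fv; have : [set E *m v | v in F p] (r *m v) by rewrite -gFp; exists v.
  move=> [x Fx <-]; have [z Fz ->] := Hgr_filtration y0 Fx.
  have : [set r *m v | v in hodge_flag H (p + 1)] (E *m z) by rewrite gFp; exists z.
  by move=> [t Ft <-]; exists t.
have key p q v : p + q = w -> hodge_space H p q v ->
    Hgr y *m (r *m v) = (p - q)%:~R *: (r *m v).
  move=> pq hv.
  have mem_flag a b u : a + b = w -> hodge_space H a b u -> hodge_flag H a u.
    move=> ab hu; apply: (@sumset_mem _ _ _ _ _ a) => //.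
    by have -> : w - a = b by rewrite -ab addrC addKr.
  have [x Fx ex] := up p v (mem_flag _ _ _ pq hv).
  have qp : q + p = w by rewrite addrC.
  have [z Fz ez] := up q _ (mem_flag _ _ _ qp (hodge_space_conj hv)).
  have ez' : Hgr y *m (r *m v) = (p - q)%:~R *: (r *m v) - r *m conjmx z.
    have := congr1 (@conjmx R n 1) ez.
    rewrite conjmxD conjmxZ !conjmx_mul conjmxK conjmx_toC conj_Hgr rmorph_int.
    rewrite mulNmx => /(congr1 -%R); rewrite opprK => ->.
    rewrite opprD -scaleNr -rmorphN/=; congr (_%:~R *: _ - _); lia.
  have pqw : 2 * p - w = p - q by lia.
  have x0 : x = 0.
    apply: (@hodge_flag_disjoint (p + 1) (q + 1) x); [lia|by []|].
    have -> : x = - conjmx z.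
      rewrite -[x]rK -[conjmx z]rK -mulmxN; congr (_ *m _).
      by apply: (addrI ((p - q)%:~R *: (r *m v))); rewrite -ez' ex pqw.
    rewrite conjmxN conjmxK; apply: subspaceN => //; exact: hodge_flag_subspace.
  by rewrite ex x0 mulmx0 addr0 pqw.
exists (g *m X *m invmx g).
  by apply: lie_of_conj => //; case: hG.
rewrite /hd_drho (regdiff_conj hG (hodge_regRM hH) (hodge_regR_unit hH) Gg GX).
have conjE : 'i *: Hgr y *m r = r *m toC (drho X).
  have [_ _ [span _] _ _] := hH.
  have agree (v : 'cV[C]_n) : ('i *: Hgr y *m r) *m v = r *m toC (drho X) *m v.
    have [s [f [hf ->]]] : sumset (fun=> True) (fun p => hodge_space H p (w - p)) v.
      by rewrite -span.
    rewrite [LHS]mulmx_sumr [RHS]mulmx_sumr [LHS]big_seq [RHS]big_seq.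
    apply: eq_bigr => p /hf[_ hp].
    rewrite -!mulmxA (hX _ _ _ hp) -scalemxAl -scalemxAr.
    by rewrite (key p (w - p)) ?scalerA//; lia.
  apply/matrixP => a b; have := agree (delta_mx b 0).
  by rewrite -!colE => /(congr1 (fun u : 'cV[C]_n => u a 0)); rewrite [LHS]mxE [RHS]mxE.
by rewrite !toC_mul -/r -conjE -mulmxA -toC_mul mulmxV// toC1 mulmx1.
Qed.

Lemma iHgr y : y != 0 ->
  'i *: Hgr y = 'i *: T + (y^-1)%:C%C *: toC Np - y%:C%C *: NC.
Proof.
move=> y0; have yC : (y%:C%C : C) != 0.
  by apply: contraNneq y0 => /(congr1 (@complex.Re R)) /= ->.
rewrite /Hgr; move: (Tgr hM hR) (toC Np) NC => a b c.
rewrite 2!scalerDr 2!scalerA mulrA -expr2 sqrCi mulN1r scaleNr; congr (_ + _ *: _ - _).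
have -> : ((y^-1)%:C%C : C) = (y%:C%C)^-1 by exact: fmorphV.
move: (y%:C%C : C) yC => x x0.
by rewrite invfM mulrA mulfV ?neq0Ci// mul1r.
Qed.

(** Solve for T and Np from Hgr y for two values of y. *)
Lemma orbit_grading_elements : exists N' T',
  [/\ hd_g H N', hd_g H T', drho N' = Np & toC (drho T') = 'i *: T].
Proof.
have [c hc] := orbit_mem; pose y1 := `|c| + 1; pose y2 := `|c| + 2.
have hy y : `|c| < y -> y != 0 /\ mt_domain H (act_flag (expnil (iy y *: NC)) F).
  move=> cy; have y0 : 0 < y by apply: le_lt_trans cy.
  split; first by rewrite gt_eqF.
  by apply: hc => //; apply: le_lt_trans cy; exact: ler_norm.
have [|y10 /(Hgr_mem y10)[X1 GX1 E1]] := hy y1; first by rewrite ltrDl.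
have [|y20 /(Hgr_mem y20)[X2 GX2 E2]] := hy y2; first by rewrite ltrDl.
have y12 : y1 != y2 by rewrite /y1 /y2; apply/eqP; lra.
have [d0 eN eT] := solve_pencil y10 y20 y12 (etrans (esym (iHgr y10)) (esym E1))
  (etrans (esym (iHgr y20)) (esym E2)).
have lin := drho_lin.
pose N' := (y1^-1 - y2^-1)^-1 *: (X1 - X2 + (y1 - y2) *: A).
have dN' : drho N' = Np.
  by rewrite (linear_mxZ _ _ lin) (linear_mxD _ _ lin) (linear_mxB _ _ lin) (linear_mxZ _ _ lin).
move: N' dN' (lie_of_scale _ (lie_of_add hG (lie_of_sub hG GX1 GX2)
  (lie_of_scale (y1 - y2) cone_g)) : hd_g H N') => {}N' dN' GN'.
exists N', (X1 - y1^-1 *: N' + y1 *: A); split=> //.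
  exact: (lie_of_add hG (lie_of_sub hG GX1 (lie_of_scale _ GN')) (lie_of_scale _ cone_g)).
by rewrite (linear_mxD _ _ lin) (linear_mxB _ _ lin) !(linear_mxZ _ _ lin) dN'.
Qed.

End HodgeOrbit.

(** * Toral subalgebras and the Levi subalgebras of the splitting *)

Section LieBracket.
Context {K : fieldType} {k : nat}.
Implicit Types X Y Z : 'M[K]_k.

Lemma liebDr X Y Z : lieb X (Y + Z) = lieb X Y + lieb X Z.
Proof. by rewrite /lieb mulmxDr mulmxDl opprD addrACA. Qed.

Lemma liebDl X Y Z : lieb (X + Y) Z = lieb X Z + lieb Y Z.
Proof. by rewrite /lieb mulmxDr mulmxDl opprD addrACA. Qed.

Lemma liebZr a X Y : lieb X (a *: Y) = a *: lieb X Y.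
Proof. by rewrite /lieb -scalemxAr -scalemxAl scalerBr. Qed.

Lemma liebZl a X Y : lieb (a *: X) Y = a *: lieb X Y.
Proof. by rewrite /lieb -scalemxAr -scalemxAl scalerBr. Qed.

Lemma liebC X Y : lieb X Y = - lieb Y X.
Proof. by rewrite /lieb opprB. Qed.

Lemma liebxx X : lieb X X = 0.
Proof. by rewrite /lieb subrr. Qed.

Lemma lieb0r X : lieb X 0 = 0.
Proof. by rewrite /lieb mulmx0 mul0mx subrr. Qed.

Lemma lieb_sumr X (I : Type) (r : seq I) (P : pred I) (f : I -> 'M[K]_k) :
  lieb X (\sum_(i <- r | P i) f i) = \sum_(i <- r | P i) lieb X (f i).
Proof. exact: (big_morph _ (@liebDr X) (@lieb0r X)). Qed.

Lemma lieb_jacobi X Y Z : lieb X (lieb Y Z) = lieb (lieb X Y) Z + lieb Y (lieb X Z).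
Proof.
rewrite /lieb !mulmxBr !mulmxBl !mulmxA.
move: (X *m Y *m Z) (X *m Z *m Y) (Y *m Z *m X) (Z *m Y *m X) (Y *m X *m Z) (Z *m X *m Y).
move=> a b c d e f; apply/matrixP => i j; rewrite !mxE; ring.
Qed.

Lemma eigenspace_subspace (g : set 'M[K]_k) X a : is_subspace g ->
  is_subspace [set Z | g Z /\ lieb X Z = a *: Z].
Proof.
move=> [g0 glin]; split=> [|c u v [gu hu] [gv hv]] /=.
  by rewrite lieb0r scaler0.
split; first exact: glin.
by rewrite liebDr liebZr hu hv scalerDr !scalerA mulrC.
Qed.

(** Take a toral subalgebra of maximal dimension among those containing h. *)
Lemma toral_maximal (g : set 'M[K]_k) (h : {vspace 'M[K]_k}) : toral g h ->
  exists2 h1, is_cartan g h1 & (h <= h1)%VS.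
Proof.
have [d] : exists d, (\dim {:'M[K]_k} - \dim h <= d)%N by exists (\dim {:'M[K]_k} - \dim h)%N.
elim: d h => [|d ih] h hd th.
  exists h => //; split=> // h' _ hh'; apply/esym/eqP; rewrite eqEdim hh'/=.
  by apply: leq_trans (dimvS (subvf _)) _; rewrite -subn_eq0 -leqn0.
have [[h' [th' hh' h'h]]|nh] := pselect (exists h', [/\ toral g h', (h <= h')%VS & h' <> h]).
  have dh : (\dim h < \dim h')%N.
    rewrite ltn_neqAle dimvS// andbT; apply/negP => /eqP e.
    by apply: h'h; apply/esym/eqP; rewrite eqEdim hh' e/=.
  have [|h1 c1 h'1] := ih h' _ th'; last by exists h1 => //; exact: subv_trans h'1.
  have := dimvS (subvf h'); lia.
exists h => //; split=> // h' th' hh'; apply: contra_notP nh => ne.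
by exists h'.
Qed.

End LieBracket.

(** Applying c i - D removes the component i from an element of S and multiplies
    the others by nonzero scalars; induct on the number of components. *)
Lemma eigen_components (K : fieldType) (V : lmodType K) (I : eqType) (S : set V)
    (D : V -> V) (c : I -> K) (s : seq I) (x : I -> V) :
  is_subspace S -> (forall a u v, D (a *: u + v) = a *: D u + D v) ->
  (forall v, S v -> S (D v)) -> uniq s -> {in s &, injective c} ->
  (forall i, i \in s -> D (x i) = c i *: x i) -> S (\sum_(i <- s) x i) ->
  forall i, i \in s -> S (x i).
Proof.
move=> hS Dlin SD; have D0 : D 0 = 0.
  by have := Dlin (-1) 0 0; rewrite scaler0 addr0 scaleN1r addNr.
have Dsum (r : seq I) (f : I -> V) : D (\sum_(i <- r) f i) = \sum_(i <- r) D (f i).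
  elim: r => [|i r ih]; first by rewrite !big_nil.
  by rewrite !big_cons -[f i in LHS]scale1r Dlin scale1r ih.
elim: s x => // i s ih x /= /andP[ins us] cinj Dx Sx.
have cinj' : {in s &, injective c}.
  by move=> a b as_ bs; apply: cinj; rewrite inE ?as_ ?bs orbT.
have Dx' j : j \in s -> D (x j) = c j *: x j by move=> js; apply: Dx; rewrite inE js orbT.
have Sj j : j \in s -> S (x j).
  move=> js; have cij : c j - c i != 0.
    rewrite subr_eq0; apply/negP => /eqP /cinj e.
    by move: ins; rewrite -e ?js// inE ?js ?eqxx ?orbT.
  rewrite -[x j]scale1r -(mulVf cij) -scalerA; apply: subspaceZ => //.
  apply: (ih (fun l => (c l - c i) *: x l)) => //.
    move=> l ls; rewrite -[_ *: x l]addr0 Dlin D0 addr0 Dx'// !scalerA mulrC.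
    by rewrite addr0.
  have := SD _ Sx; have := subspaceZ (c i) hS Sx => h1 h2.
  have := subspaceB hS h2 h1; rewrite Dsum !big_cons Dx ?mem_head// scalerDr opprD addrACA.
  rewrite subrr add0r scaler_sumr -sumrB; congr S; apply: eq_big_seq => l ls.
  by rewrite Dx'// -scalerBl.
move=> j; rewrite inE => /orP[/eqP ->|]; last exact: Sj.
have -> : x i = \sum_(j <- i :: s) x j - \sum_(j <- s) x j by rewrite big_cons addrK.
apply: subspaceB => //; rewrite big_seq; exact: subspace_sum.
Qed.

Section ComplexLie.
Context {R : realType} {k n : nat} (H : hodge_datum R k n).
Hypothesis hG : is_algebraic_group (hd_G H).
Hypothesis hH : is_hodge_representation H.

Local Notation C := R[i].
Local Notation gR := (hd_g H).
Local Notation gC := (hd_gC H).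
Local Notation drho := (hd_drho H).
Local Notation drhoC := (hd_drhoC H).

Lemma gR_subspace : is_subspace gR.
Proof. exact: lie_of_subspace. Qed.

Lemma gR_lieb X Y : gR X -> gR Y -> gR (lieb X Y).
Proof. exact: lie_of_lieb. Qed.

Lemma gC_subspace : is_subspace gC.
Proof. exact: cplx_subspace gR_subspace. Qed.

Lemma gC_toC X : gR X -> gC (toC X).
Proof. by move=> gX; apply/(cplx_toC _ gR_subspace). Qed.

Lemma reC_toC0 m p (A : 'M[R]_(m, p)) : reC (toC A) = A.
Proof. by rewrite -[toC A]addr0 -(scaler0 _ 'i) -toC0 reC_toC. Qed.

Lemma imC_toC0 m p (A : 'M[R]_(m, p)) : imC (toC A) = 0.
Proof. by rewrite -[toC A]addr0 -(scaler0 _ 'i) -toC0 imC_toC. Qed.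

Lemma toC_lieb d (X Y : 'M[R]_d) : toC (lieb X Y) = lieb (toC X) (toC Y).
Proof. by rewrite /lieb toCB !toC_mul. Qed.

Lemma lieb_toC_split (X : 'M[R]_k) (z : 'M[C]_k) :
  lieb (toC X) z = toC (lieb X (reC z)) + 'i *: toC (lieb X (imC z)).
Proof. by rewrite {1}[z]toCE liebDr liebZr !toC_lieb. Qed.

Lemma gC_lieb x y : gC x -> gC y -> gC (lieb x y).
Proof.
move=> /cplxP[x1 x2] gy; have [y1 y2] := (cplxP _ _).1 gy.
rewrite [x]toCE liebDl liebZl; apply: subspaceD; first exact: gC_subspace.
  by rewrite lieb_toC_split; apply/cplxP; rewrite reC_toC imC_toC; split; exact: gR_lieb.
apply: subspaceZ; first exact: gC_subspace.
by rewrite lieb_toC_split; apply/cplxP; rewrite reC_toC imC_toC; split; exact: gR_lieb.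
Qed.

Lemma drhoC_toC X : drhoC (toC X) = toC (drho X).
Proof.
rewrite /hd_drhoC /regdiffC -/(reC _) -/(imC _) reC_toC0 imC_toC0.
by rewrite -/(drho 0) (linear_mx0 (drho_lin H)) toC0 scaler0 addr0.
Qed.

Lemma drhoCE x : drhoC x = toC (drho (reC x)) + 'i *: toC (drho (imC x)).
Proof. by []. Qed.

Lemma drhoC_lin a x y : drhoC (a *: x + y) = a *: drhoC x + drhoC y.
Proof.
case: a => a b; rewrite /hd_drhoC /regdiffC -!/(reC _) -!/(imC _) reC_lin imC_lin.
have lin := drho_lin H; rewrite -!/(drho _).
rewrite (linear_mxD (a *: reC x) _ lin) (linear_mxB _ _ lin).
rewrite 2!(linear_mxD _ _ lin) 4!(linear_mxZ _ _ lin).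
move: (drho _) (drho _) (drho _) (drho _) => u v z t.
apply/matrixP => i j; rewrite !mxE imaginaryE; apply/eqP; rewrite eq_complex /=.
by apply/andP; split; apply/eqP; ring.
Qed.

Local Opaque hd_drho hd_drhoC.

Lemma drhoC0 : drhoC 0 = 0.
Proof. by rewrite -toC0 drhoC_toC (linear_mx0 (drho_lin H)) toC0. Qed.

Lemma drhoCZ a x : drhoC (a *: x) = a *: drhoC x.
Proof. by have := drhoC_lin a x 0; rewrite drhoC0 !addr0. Qed.

Lemma drhoCD x y : drhoC (x + y) = drhoC x + drhoC y.
Proof. by have := drhoC_lin 1 x y; rewrite !scale1r. Qed.

Lemma drhoCB x y : drhoC (x - y) = drhoC x - drhoC y.
Proof. by have := drhoCD x (-1 *: y); rewrite drhoCZ !scaleN1r. Qed.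

Lemma drhoC_sum (I : Type) (r : seq I) (P : pred I) (f : I -> 'M[C]_k) :
  drhoC (\sum_(i <- r | P i) f i) = \sum_(i <- r | P i) drhoC (f i).
Proof. exact: (big_morph _ drhoCD drhoC0). Qed.

Lemma drho_inj X Y : gR X -> gR Y -> drho X = drho Y -> X = Y.
Proof.
by have [[_ _ _ _ inj] _ _ _ _] := hH => gX gY; apply: inj; rewrite inE.
Qed.

Lemma drhoC_inj x : gC x -> drhoC x = 0 -> x = 0.
Proof.
move=> /cplxP[x1 x2] dx; have g0 := subspace0 gR_subspace.
have lin := drho_lin H.
have e1 : drho (reC x) = drho 0.
  rewrite (linear_mx0 lin) -[LHS](reC_toC _ (drho (imC x))).
  by rewrite -drhoCE dx -toC0 reC_toC0.
have e2 : drho (imC x) = drho 0.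
  rewrite (linear_mx0 lin) -[LHS](imC_toC (drho (reC x))).
  by rewrite -drhoCE dx -toC0 imC_toC0.
by rewrite [x]toCE (drho_inj x1 g0 e1) (drho_inj x2 g0 e2) toC0 scaler0 addr0.
Qed.

Lemma drhoC_lieb x y : gC x -> gC y -> drhoC (lieb x y) = lieb (drhoC x) (drhoC y).
Proof.
move=> /cplxP[x1 x2] gy; have [y1 y2] := (cplxP _ _).1 gy.
have real X (z : 'M[C]_k) : gR X -> gC z ->
    drhoC (lieb (toC X) z) = lieb (toC (drho X)) (drhoC z).
  move=> gX /cplxP[z1 z2]; rewrite lieb_toC_split drhoCD drhoCZ !drhoC_toC.
  rewrite [drhoC z]drhoCE.
  have dl X1 X2 : gR X1 -> gR X2 -> drho (lieb X1 X2) = lieb (drho X1) (drho X2).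
    exact: (regdiff_lieb hG (hodge_regRM hH) (hodge_regR_unit hH)).
  rewrite (dl _ _ gX z1) (dl _ _ gX z2).
  move: (drho X) (drho (reC z)) (drho (imC z)) => a b c.
  by rewrite liebDr liebZr !toC_lieb.
have e1 := real _ _ x1 gy; have e2 := real _ _ x2 gy.
have -> : lieb x y = lieb (toC (reC x)) y + 'i *: lieb (toC (imC x)) y.
  by rewrite -liebZl -liebDl -toCE.
have key (u v a b c : 'M[C]_n) : u = lieb a c -> v = lieb b c ->
    u + 'i *: v = lieb (a + 'i *: b) c by move=> -> ->; rewrite liebDl liebZl.
have E1 := drhoCD (lieb (toC (reC x)) y) ('i *: lieb (toC (imC x)) y).
have E2 := congr1 (fun z => drhoC (lieb (toC (reC x)) y) + z)
  (drhoCZ 'i (lieb (toC (imC x)) y)).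
have E3 := key _ _ _ _ _ e1 e2.
have E4 := congr1 (fun z => lieb z (drhoC y)) (esym (drhoCE x)).
exact: etrans E1 (etrans E2 (etrans E3 E4)).
Qed.

End ComplexLie.

Section LeviSplitting.
Context {R : realType} {k n : nat} (H : hodge_datum R k n).
Variables (F : int -> set 'cV[R[i]]_n) (W : int -> set 'cV[R]_n).
Hypothesis hG : is_algebraic_group (hd_G H).
Hypothesis hH : is_hodge_representation H.
Hypothesis hM : is_mixed_hodge F W.
Hypothesis hR : forall p q, conjset (deligne F W p q) = deligne F W q p.
Variables T Y : 'M[R]_k.
Hypotheses (gT : hd_g H T) (gY : hd_g H Y).
Hypothesis drhoT : toC (hd_drho H T) = 'i *: Tgr hM hR.
Hypothesis drhoY : toC (hd_drho H Y) = Ygr (hd_wt H) hM hR.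

Local Notation C := R[i].
Local Notation gR := (hd_g H).
Local Notation gC := (hd_gC H).
Local Notation drhoC := (hd_drhoC H).
Local Notation I := (deligne F W).
Local Notation Ig := (deligne_g H F W).

Let gCs : is_subspace gC := gC_subspace hG.

(** The identity can be checked on V, because d rho is injective on g_C. *)
Lemma ad_dop (D : 'M[C]_k) (c : int * int -> C) (a b : int) (d : C) xi :
  gC D -> drhoC D = dop hM hR c ->
  (forall p q, c (a + p, b + q) = d + c (p, q)) -> Ig a b xi ->
  lieb D xi = d *: xi.
Proof.
move=> gD dD cd [gxi hxi]; apply/eqP; rewrite -subr_eq0; apply/eqP.
apply: (drhoC_inj hG hH).
  by apply: subspaceB => //; [exact: (gC_lieb hG)|exact: subspaceZ].
rewrite drhoCB drhoCZ (drhoC_lieb hG hH)// dD.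
apply: (deligne_eq hM hR) => p q v Iv; rewrite mul0mx /lieb !mulmxBl -!mulmxA.
rewrite (dopE _ _ _ (hxi _ _ _ Iv)) (dopE _ _ _ Iv) -scalemxAr -scalemxAl cd scalerDl.
by rewrite addrK subrr.
Qed.

Lemma adY a b xi : Ig a b xi -> lieb (toC Y) xi = (a + b)%:~R *: xi.
Proof.
apply: (@ad_dop _ (fun i => (i.1 + i.2 - hd_wt H)%:~R)).
- exact: (gC_toC hG).
- by rewrite drhoC_toC.
- by move=> p q /=; rewrite -intrD; congr (_%:~R); lia.
Qed.

Lemma adT a b xi : Ig a b xi -> lieb (toC T) xi = ('i * (a - b)%:~R) *: xi.
Proof.
apply: (@ad_dop _ (fun i => 'i * (i.1 - i.2)%:~R)).
- exact: (gC_toC hG).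
- by rewrite drhoC_toC drhoT dopZ.
- by move=> p q /=; rewrite -mulrDr -intrD; congr ('i * _%:~R); lia.
Qed.

(** The coefficient of Y is large enough for the eigenvalues of ad on the
    I_g^(a,b) with |a|, |b| < M to be distinct integers. *)
Definition grading_elt (M : nat) : 'M[C]_k :=
  (4 * M%:Z)%:~R *: toC Y - 'i *: toC T.

Lemma gC_grading_elt M : gC (grading_elt M).
Proof. by apply: subspaceB => //; apply: subspaceZ => //; exact: (gC_toC hG). Qed.

Definition grading_val (M : nat) (i : int * int) : int :=
  4 * M%:Z * (i.1 + i.2) + (i.1 - i.2).

Lemma grading_val_inj M : {in box M &, injective (grading_val M.+1)}.
Proof.
move=> [a b] [c d]; rewrite !mem_box /grading_val /= => /andP[h1 h2] /andP[h3 h4] e.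
have e1 : a + b = c + d.
  have h5 : `|(c - d) - (a - b)| <= 4 * M%:Z by lia.
  have h6 : 4 * M.+1%:Z * ((a + b) - (c + d)) = (c - d) - (a - b) by lia.
  move: h5; rewrite -h6 normrM => h5.
  have [|d0] := eqVneq (a + b - (c + d)) 0; first by lia.
  have d1 : 1 <= `|a + b - (c + d)| by lia.
  have := ler_wpM2l (normr_ge0 (4 * M.+1%:Z)) d1; lia.
have e2 : a - b = c - d by move: e; rewrite e1 => /addrI.
congr pair; lia.
Qed.

Lemma grading_val0 M i : i \in box M -> grading_val M.+1 i = 0 -> i = (0, 0).
Proof.
move=> iM e; apply: (@grading_val_inj M) => //; first by rewrite mem_box /=.
by rewrite e /grading_val /=; lia.
Qed.

Lemma ad_grading_elt M i xi : Ig i.1 i.2 xi ->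
  lieb (grading_elt M) xi = (grading_val M i)%:~R *: xi.
Proof.
move=> hxi; rewrite /grading_elt liebDl -scaleNr !liebZl (adY hxi) (adT hxi).
rewrite !scalerA -scalerDl mulrA mulNr -expr2 sqrCi opprK mul1r.
by rewrite -intrM -intrD.
Qed.

Lemma drhoC_grading_elt M : drhoC (grading_elt M) =
  dop hM hR (fun i => (4 * M%:Z * (i.1 + i.2 - hd_wt H) + (i.1 - i.2))%:~R).
Proof.
have eY : drhoC (toC Y) = Ygr (hd_wt H) hM hR := etrans (drhoC_toC H Y) drhoY.
have eT : drhoC (toC T) = 'i *: Tgr hM hR := etrans (drhoC_toC H T) drhoT.
have -> : drhoC (grading_elt M) = (4 * M%:Z)%:~R *: drhoC (toC Y) - 'i *: drhoC (toC T).
  exact: etrans (drhoCB _ _ _) (congr2 (fun u v => u - v) (drhoCZ _ _ _) (drhoCZ _ _ _)).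
rewrite eY eT scalerA -expr2 sqrCi.
rewrite scaleN1r opprK /Ygr dopZ /Tgr dopD; congr (dop _ _ _); apply/funext => i.
by rewrite -intrM -intrD.
Qed.

Lemma box_diff B i j : i \in box B -> j \in box B ->
  (i.1 - j.1, i.2 - j.2) \in box B.*2.
Proof. by case: i j => a b [c d]; rewrite !mem_box /=; lia. Qed.

(** The component of type (a, b) of the operator d rho(xi) is one of its
    eigencomponents for the bracket with a grading element of g_C, so that it
    is d rho of an element of S, by eigen_components. *)
Lemma gC_decompose : exists M : nat, forall S : set 'M[C]_k,
  is_subspace S -> S `<=` gC ->
  (forall xi, S xi -> S (lieb (grading_elt M.+1) xi)) ->
  forall xi, S xi -> exists2 f : int * int -> 'M[C]_k,
    (forall i, i \in box M -> S (f i) /\ Ig i.1 i.2 (f i)) &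
    xi = \sum_(i <- box M) f i.
Proof.
have [B hB] := deligne_bounded hM hR; exists B.*2 => S hS SgC SE xi Sxi.
pose Z := drhoC xi.
have [bx bxu [hbx bxd]] : exists2 bx : seq (int * int), uniq bx &
    (forall i v, I i.1 i.2 v -> v != 0 -> i \in bx) /\
    (forall i j, i \in bx -> j \in bx -> (i.1 - j.1, i.2 - j.2) \in box B.*2).
  by exists (box B); [exact: box_uniq|split=> //; exact: box_diff].
have injv := @grading_val_inj B.*2.
move: (box B.*2) (box_uniq B.*2) bxd injv (grading_elt B.*2.+1)
  (gC_grading_elt B.*2.+1) (drhoC_grading_elt B.*2.+1) SE => dx dxu bxd injv E gE dE SE.
pose proj := proj_I hM hR.
have /choice[Zc ZcE] := fun a : int * int => deligne_component hM hR a Z.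
have Zc_shift a p q v : I p q v -> I (a.1 + p) (a.2 + q) (Zc a *m v).
  by move=> Iv; rewrite (ZcE _ _ _ _ Iv); exact: (proj_I_mem hM hR (_, _)).
have Zsum : Z = \sum_(a <- dx) Zc a.
  apply: (deligne_eq hM hR) => p q v Iv; rewrite mulmx_suml.
  have [->|v0] := eqVneq v 0; first by rewrite mulmx0 big1// => a _; rewrite mulmx0.
  under eq_bigr do rewrite (ZcE _ _ _ _ Iv).
  rewrite -mulmx_suml -[LHS]mul1mx; move: (Z *m v) => u; congr (_ *m _).
  apply: (deligne_eq hM hR) => r s x Ix; rewrite mul1mx mulmx_suml.
  have [->|x0] := eqVneq x 0; first by rewrite big1// => a _; rewrite mulmx0.
  rewrite (bigD1_seq (r - p, s - q))//=; last first.
    by exact: (bxd (r, s) (p, q) (hbx (r, s) x Ix x0) (hbx (p, q) v Iv v0)).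
  rewrite /proj (dopE _ _ _ Ix) !subrK eqxx scale1r big1 ?addr0// => -[a b] ab.
  rewrite (dopE _ _ _ Ix) -[(_ == _)]negbK (_ : _ != _) ?scale0r//.
  apply: contra ab => /eqP[-> ->]; by rewrite !addrK.
have ZcD a : lieb (drhoC E) (Zc a) = (grading_val B.*2.+1 a)%:~R *: Zc a.
  rewrite dE; apply: (deligne_eq hM hR) => p q v Iv.
  rewrite /lieb mulmxBl -!mulmxA (dopE _ _ _ (Zc_shift a _ _ _ Iv)) (dopE _ _ _ Iv).
  rewrite -scalemxAr -scalemxAl -scalerBl -intrB; congr (_%:~R *: _).
  by rewrite /grading_val /=; lia.
have hSn : is_subspace [set drhoC x | x in S].
  have [S0 Sl] := hS; split; first by exists 0 => //; exact: drhoC0.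
  by move=> c _ _ [x Sx <-] [y Sy <-]; exists (c *: x + y); [exact: Sl|exact: drhoC_lin].
have Dlin (c : C) u v : lieb (drhoC E) (c *: u + v) = c *: lieb (drhoC E) u + lieb (drhoC E) v.
  by rewrite liebDr liebZr.
have SD v : [set drhoC x | x in S] v -> [set drhoC x | x in S] (lieb (drhoC E) v).
  move=> [x Sx <-]; exists (lieb E x); first exact: SE.
  by rewrite (drhoC_lieb hG hH)//; exact: SgC.
have inj' : {in dx &, injective (fun a => (grading_val B.*2.+1 a)%:~R : C)}.
  by move=> a b adx bdx /intr_inj; exact: injv.
have SZ : [set drhoC x | x in S] (\sum_(a <- dx) Zc a) by rewrite -Zsum; exists xi.
have comp := eigen_components hSn Dlin SD dxu inj' (fun a _ => ZcD a) SZ.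
have /choice[f hf] : forall a, exists x, a \in dx -> S x /\ drhoC x = Zc a.
  move=> a; case: (boolP (a \in dx)) => [/comp[x Sx xE]|_]; last by exists 0.
  by exists x.
exists f => [a adx|].
  have [Sf fE] := hf a adx; split=> //; split; first exact: SgC.
  by move=> r s v Iv; rewrite fE; exact: Zc_shift.
apply/eqP; rewrite -subr_eq0; apply/eqP; apply: (drhoC_inj hG hH).
  apply: subspaceB => //; first exact: SgC.
  by rewrite big_seq; apply: subspace_sum => // a /hf[/SgC].
have E1 : drhoC (\sum_(a <- dx) f a) = \sum_(a <- dx) Zc a.
  by rewrite drhoC_sum; apply: eq_big_seq => a /hf[].
by rewrite drhoCB E1 -Zsum subrr.
Qed.

Lemma deligne_g_subspace a b : is_subspace (Ig a b).
Proof.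
split=> [|c u v [gu hu] [gv hv]].
  split=> [|r s v _]; first exact: subspace0.
  by rewrite drhoC0 mul0mx; exact: subspace0 (deligne_subspace hM hR _ _).
split=> [|r s x Ix]; first by have [_] := gCs; apply.
rewrite drhoC_lin mulmxDl -scalemxAl.
by have [_] := deligne_subspace hM hR (a + r) (b + s); apply; [exact: hu|exact: hv].
Qed.

Lemma lieb_TY : lieb T Y = 0.
Proof.
have lin := drho_lin H; have g0 := subspace0 (gR_subspace hG).
apply: (drho_inj hH (gR_lieb hG gT gY) g0); apply: (@toC_inj R).
rewrite (linear_mx0 lin) toC0.
have -> : hd_drho H (lieb T Y) = lieb (hd_drho H T) (hd_drho H Y).
  exact: (regdiff_lieb hG (hodge_regRM hH) (hodge_regR_unit hH) gT gY).
have TY0 : lieb (Tgr hM hR) (Ygr (hd_wt H) hM hR) = 0.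
  rewrite /lieb /Tgr /Ygr !dop_mul; apply/eqP; rewrite subr_eq0; apply/eqP.
  by congr (dop _ _ _); apply/funext => i; exact: mulrC.
have e : lieb ('i *: Tgr hM hR) (Ygr (hd_wt H) hM hR) = 0.
  by rewrite liebZl TY0 scaler0.
exact: etrans (toC_lieb _ _) (etrans (congr2 lieb drhoT drhoY) e).
Qed.

Lemma lieb_T_grading M : lieb (toC T) (grading_elt M) = 0.
Proof.
rewrite /grading_elt liebDr -scaleNr !liebZr liebxx scaler0 addr0.
by rewrite -toC_lieb lieb_TY toC0 scaler0.
Qed.

(** T acts on I_g^(a,b) by i (a - b), which vanishes only if a = b. *)
Lemma levi_lP X : levi_l H F W X <-> gR X /\ lieb T X = 0.
Proof.
split=> [[gX [s [f [hf Xe]]]]|[gX TX]]; split=> //.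
  apply: (@toC_inj R); rewrite toC_lieb Xe lieb_sumr toC0 big1_seq// => p /andP[_ ps].
  by have [_ fp] := hf p ps; rewrite (adT fp) subrr mulr0 scale0r.
have [M hM'] := gC_decompose.
have Sx : [set xi | gC xi /\ lieb (toC T) xi = 0 *: xi] (toC X).
  by split; [exact: (gC_toC hG)|rewrite -toC_lieb TX toC0 scale0r].
have [||f hf Xe] := hM' _ (eigenspace_subspace (toC T) 0 gCs) _ _ _ Sx.
- by move=> xi [].
- move=> xi [gxi]; rewrite scale0r => Txi; split.
    by apply: (gC_lieb hG) => //; exact: gC_grading_elt.
  by rewrite scale0r lieb_jacobi Txi lieb0r addr0 lieb_T_grading liebC lieb0r oppr0.
have dsub p : is_subspace (Ig p p) by exact: deligne_g_subspace.
rewrite Xe big_seq; apply: subspace_sum; first exact: sumset_subspace.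
move=> [a b] /hf[[_]]; rewrite scale0r /= => Tf If.
have [ab|ab] := eqVneq a b; first by apply: (@sumset_mem _ _ _ _ _ a) => //; rewrite {2}ab.
move: Tf; rewrite (adT If) => /eqP; rewrite scaler_eq0 mulf_eq0 (negPf (neq0Ci _))/= intr_eq0.
rewrite subr_eq0 (negPf ab)/= => /eqP ->.
exact: subspace0 (sumset_subspace _ _).
Qed.

Lemma lieb_levi_l (Y0 X : 'M[R]_k) :
  (forall (p : int) (xi : 'M[C]_k), Ig p p xi -> lieb (toC Y0) xi = (2 * p)%:~R *: xi) ->
  levi_l H F W X -> lieb Y0 X = lieb Y X.
Proof.
move=> hY0 [gX [s [f [hf Xe]]]]; apply: (@toC_inj R); rewrite !toC_lieb Xe !lieb_sumr.
apply: eq_big_seq => p /hf[_ If].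
by rewrite (hY0 _ _ If) (adY If); congr (_%:~R *: _); lia.
Qed.

Lemma levi_lYP (Y0 X : 'M[R]_k) :
  (forall (p : int) (xi : 'M[C]_k), Ig p p xi -> lieb (toC Y0) xi = (2 * p)%:~R *: xi) ->
  levi_lY H F W Y0 X <-> [/\ gR X, lieb T X = 0 & lieb Y X = 0].
Proof.
move=> hY0; rewrite /levi_lY /= liebC; split=> [[lX]|[gX TX YX]].
  rewrite (lieb_levi_l hY0 lX) => /eqP; rewrite oppr_eq0 => /eqP YX.
  by have [gX TX] := (levi_lP _).1 lX.
have lX : levi_l H F W X by apply/levi_lP.
by rewrite (lieb_levi_l hY0 lX) YX oppr0.
Qed.

(** The eigenvalues of ad E on g_C are integers, because g_C is spanned by the
    I_g^(a,b); so E spans a toral subalgebra, and the roots of any Cartan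
    subalgebra that contains E are integral on it. *)
Lemma grading_elt_grading M : (forall S : set 'M[C]_k,
    is_subspace S -> S `<=` gC ->
    (forall xi, S xi -> S (lieb (grading_elt M.+1) xi)) ->
    forall xi, S xi -> exists2 f : int * int -> 'M[C]_k,
      (forall i, i \in box M -> S (f i) /\ Ig i.1 i.2 (f i)) &
      xi = \sum_(i <- box M) f i) ->
  is_grading gC (grading_elt M.+1).
Proof.
set E := grading_elt M.+1 => hS; have gE : gC E by exact: gC_grading_elt.
have [|h ch Eh] := @toral_maximal _ _ gC <[E]>%VS.
  split=> [_ /vlineP[c ->]|_ _ /vlineP[c ->] /vlineP[d ->]|_ /vlineP[c ->]].
  - exact: subspaceZ.
  - by rewrite liebZl liebZr liebxx !scaler0.
  apply/seteqP; split=> [xi gxi|_ [s [f [hf ->]]]]; last first.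
    by rewrite big_seq; apply: subspace_sum => // i /hf[_ []].
  have [//||f hf ->] := hS gC gCs _ _ _ gxi; first by move=> x gx; by apply: (gC_lieb hG).
  rewrite big_seq; apply: subspace_sum.
    by apply: sumset_subspace => a; exact: eigenspace_subspace.
  move=> i /hf[gf If]; apply: (@sumset_mem _ _ _ _ _ (c * (grading_val M.+1 i)%:~R)) => //.
  by split=> //; rewrite liebZl (ad_grading_elt M.+1 If) scalerA.
have hE : E \in h by rewrite memvE.
exists h; split=> // alpha [_ [Z [gZ Z0 hZ]]].
have EZ : lieb E Z = alpha E *: Z by exact: hZ.
have [||f hf Ze] := hS _ (eigenspace_subspace E (alpha E) gCs) _ _ _ (conj gZ EZ).
- by move=> xi [].
- move=> xi [gxi Exi]; split; first by apply: (gC_lieb hG).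
  by rewrite Exi liebZr Exi.
have [i ib fi0] : exists2 i, i \in box M & f i != 0.
  apply: contra_notP (negP Z0) => h0; rewrite Ze big1_seq// => i /andP[_ ib].
  by apply/eqP; apply: contra_notT h0 => fi; exists i.
have [[_ Ef] If] := hf i ib; exists (grading_val M.+1 i).
have : ((grading_val M.+1 i)%:~R - alpha E) *: f i = 0.
  by rewrite scalerBl -(ad_grading_elt M.+1 If) Ef subrr.
by move=> /eqP; rewrite scaler_eq0 (negPf fi0) orbF subr_eq0 => /eqP.
Qed.

Lemma lieb_toC_eq0 (X : 'M[R]_k) (z : 'M[C]_k) :
  lieb (toC X) z = 0 <-> lieb X (reC z) = 0 /\ lieb X (imC z) = 0.
Proof.
rewrite lieb_toC_split; split=> [e|[-> ->]]; last by rewrite toC0 scaler0 addr0.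
have r := reC_toC (lieb X (reC z)) (lieb X (imC z)).
have i := imC_toC (lieb X (reC z)) (lieb X (imC z)).
by split; [rewrite -r e -toC0 reC_toC0|rewrite -i e -toC0 imC_toC0].
Qed.

(** The grading element E acts on I_g^(a,b) by an integer that is 0 only for
    (a, b) = (0, 0), so that centralizing E is the same as centralizing both T
    and Y; these two are real. *)
Lemma levi_lY_levi (Y0 : 'M[R]_k) :
  (forall (p : int) (xi : 'M[C]_k), Ig p p xi -> lieb (toC Y0) xi = (2 * p)%:~R *: xi) ->
  is_real_levi gR (levi_lY H F W Y0).
Proof.
move=> hY0; have gs := gR_subspace hG.
have -> : levi_lY H F W Y0 = [set X | [/\ gR X, lieb T X = 0 & lieb Y X = 0]].
  by apply/seteqP; split=> X /(levi_lYP _ hY0).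
split.
- split=> [|c u v [gu Tu Yu] [gv Tv Yv]] /=.
    by rewrite !lieb0r; split=> //; exact: subspace0.
  by rewrite !liebDr !liebZr Tu Yu Tv Yv !scaler0 !addr0; split=> //; case: gs => _; apply.
- move=> u v [gu Tu Yu] [gv Tv Yv]; split; first exact: (gR_lieb hG).
    by rewrite lieb_jacobi Tu Tv lieb0r liebC lieb0r oppr0 addr0.
  by rewrite lieb_jacobi Yu Yv lieb0r liebC lieb0r oppr0 addr0.
- by move=> X [].
have [M hM'] := gC_decompose; exists (grading_elt M.+1); first exact: grading_elt_grading.
have cent x : cplx [set X | [/\ gR X, lieb T X = 0 & lieb Y X = 0]] x <->
    [/\ gC x, lieb (toC T) x = 0 & lieb (toC Y) x = 0].
  split=> [/cplxP[[g1 T1 Y1] [g2 T2 Y2]]|[/cplxP[g1 g2]]].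
    split; [exact/cplxP | |]; first exact: (lieb_toC_eq0 T x).2.
    exact: (lieb_toC_eq0 Y x).2.
  by move=> /(lieb_toC_eq0 T x)[T1 T2] /(lieb_toC_eq0 Y x)[Y1 Y2]; apply/cplxP.
apply/seteqP; split=> x.
  move=> /cent[gx Tx Yx]; split; first exact: gx.
  by rewrite /grading_elt liebDl -scaleNr !liebZl Tx Yx !scaler0 addr0.
move=> [gx Ex]; apply/cent.
have Sx : [set xi | gC xi /\ lieb (grading_elt M.+1) xi = 0 *: xi] x.
  by rewrite /= scale0r.
have [||f hf xe] := hM' _ (eigenspace_subspace _ 0 gCs) _ _ _ Sx.
- by move=> xi [].
- move=> xi [gxi Exi]; split; first by apply: (gC_lieb hG) => //; exact: gC_grading_elt.
  by rewrite Exi !scale0r lieb0r.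
have sum0 D (bx : seq (int * int)) : (forall i, i \in bx -> lieb D (f i) = 0) ->
    lieb D (\sum_(i <- bx) f i) = 0.
  by move=> h; rewrite lieb_sumr big1_seq// => i /andP[_ ib]; exact: h.
have f0 i : i \in box M -> f i = 0 \/ i = (0, 0).
  move=> ib; have [[_ Ef] If] := hf i ib.
  move: Ef; rewrite (ad_grading_elt M.+1 If) scale0r => /eqP.
  rewrite scaler_eq0 intr_eq0 => /orP[/eqP v0|/eqP]; last by left.
  by right; exact: (grading_val0 ib).
have Tf i : i \in box M -> lieb (toC T) (f i) = 0.
  move=> ib; have [_ If] := hf i ib; have [->|i0] := f0 i ib; first exact: lieb0r.
  by rewrite (adT If) i0 subrr mulr0 scale0r.
have Yf i : i \in box M -> lieb (toC Y) (f i) = 0.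
  move=> ib; have [_ If] := hf i ib; have [->|i0] := f0 i ib; first exact: lieb0r.
  by rewrite (adY If) i0 addr0 scale0r.
split; first exact: gx.
  by rewrite xe; exact: sum0 Tf.
by rewrite xe; exact: sum0 Yf.
Qed.

End LeviSplitting.

(** * Lowering operators of sl2-triples and open orbits *)

Section SubspaceEndomorphisms.
Context {K : fieldType} {vT : vectType K}.

Lemma subspace_vspace (S : set vT) : is_subspace S ->
  exists U : {vspace vT}, forall x, x \in U <-> S x.
Proof.
move=> hS; suff [U SU hU] : exists2 U : {vspace vT},
    (forall x, x \in U -> S x) & (forall x, S x -> x \in U).
  by exists U => x; split; [exact: SU|exact: hU].
have [d] : exists d, (\dim {:vT} - \dim (0%VS : {vspace vT}) <= d)%N by eexists.
have : forall x, x \in (0%VS : {vspace vT}) -> S x.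
  by move=> x; rewrite memv0 => /eqP ->; exact: subspace0.
elim: d (0%VS : {vspace vT}) => [|d ih] U US dU.
  exists U => // x _; suff -> : U = fullv by exact: memvf.
  apply/eqP; rewrite eqEdim subvf; lia.
have [[x Sx xU]|nx] := pselect (exists2 x, S x & x \notin U); last first.
  by exists U => // x Sx; apply: contra_notT nx => xU; exists x.
apply: (ih (U + <[x]>)%VS) => [y /memv_addP[u /US Su [z /vlineP[c ->] ->]]|].
  by apply: subspaceD => //; exact: subspaceZ.
have : (\dim U < \dim (U + <[x]>)%VS)%N.
  rewrite ltn_neqAle dimvS ?addvSl// andbT; apply: contra xU => /eqP e.
  suff -> : U = (U + <[x]>)%VS by rewrite memvE addvSr.
  by apply/eqP; rewrite eqEdim addvSl e/=.
lia.
Qed.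

Lemma subspace_inj_surj (S : set vT) (f : vT -> vT) : is_subspace S -> linear f ->
  (forall x, S x -> S (f x)) -> (forall x, S x -> f x = 0 -> x = 0) ->
  forall y, S y -> exists2 x, S x & f x = y.
Proof.
move=> hS lf Sf finj y Sy; have [U hU] := subspace_vspace hS.
pose fL := GRing.isLinear.Build _ _ _ _ f lf.
pose f' : {linear vT -> vT} := HB.pack f fL.
pose phi := linfun f'.
have ker0 : (U :&: lker phi = 0)%VS.
  apply/eqP; rewrite -subv0; apply/subvP => x; rewrite memv_cap => /andP[/hU Sx].
  by rewrite memv_ker lfunE/= memv0 => /eqP fx; apply/eqP; exact: finj.
have imU : (phi @: U = U)%VS.
  apply/eqP; rewrite eqEdim (limg_dim_eq ker0) leqnn andbT.
  by apply/subvP => _ /memv_imgP[x /hU Sx ->]; rewrite lfunE/=; apply/hU/Sf.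
have : y \in (phi @: U)%VS by rewrite imU; apply/hU.
by move=> /memv_imgP[x /hU Sx ->]; exists x => //; rewrite lfunE.
Qed.

End SubspaceEndomorphisms.

(** By the sl2-relations, e f^j v = j (lam - j + 1) f^(j-1) v when f e v = 0, and
    the coefficient is nonzero since lam < 0; so f^j v = 0 implies
    f^(j-1) v = 0. *)
Lemma sl2_negative_weight (R : realType) (V : lmodType R) (e f h : V -> V) (lam : R) v :
  (forall a x, e (a *: x) = a *: e x) ->
  (forall a x, f (a *: x) = a *: f x) ->
  (forall x, e (f x) = f (e x) + h x) ->
  (forall x, h (f x) = f (h x) - 2 *: f x) ->
  h v = lam *: v -> lam < 0 -> f (e v) = 0 ->
  (exists j, iter j f v = 0) -> v = 0.
Proof.
move=> eZ fZ ef hf hv lam0 fev [j].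
have f0 : f 0 = 0 by have := fZ 0 0; rewrite !scale0r.
have e0 : e 0 = 0 by have := eZ 0 0; rewrite !scale0r.
have hX i : h (iter i f v) = (lam - 2 * i%:R) *: iter i f v.
  elim: i => [|i ih]; first by rewrite mulr0 subr0.
  by rewrite /= hf ih fZ -scalerBl -addrA -opprD -[i.+1]addn1 natrD mulrDr mulr1.
have eX i : e (iter i.+1 f v) = (i.+1%:R * (lam - i%:R)) *: iter i f v.
  elim: i => [|i ih]; first by rewrite /= ef fev add0r hv subr0 mul1r.
  rewrite iterS ef ih fZ -iterS hX -scalerDl; congr (_ *: _).
  by rewrite -[i.+2]addn1 -[i.+1]addn1 !natrD; ring.
elim: j => // j ih fj; apply: ih; have := eX j; rewrite fj e0 => /esym /eqP.
rewrite scaler_eq0 mulf_eq0 pnatr_eq0 /= => /orP[/eqP h0|/eqP//].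
exfalso; have := ler0n R j; move: lam0 h0; clear; lra.
Qed.

(** (ad A)^j applied to A^a X A^b is a sum of terms of total degree a + b + j in
    A, and degree 2 n leaves at least n factors A on one side. *)
Lemma ad_nilpotent (K : pzRingType) k (A X : 'M[K]_k) n : A ^+ n = 0 ->
  iter (2 * n) (lieb A) X = 0.
Proof.
move=> An; have gen j a b : (2 * n <= a + b + j)%N ->
    iter j (lieb A) (A ^+ a *m X *m A ^+ b) = 0.
  elim: j a b => [|j ih] a b ab /=.
    have [na|na] := leqP n a.
      by rewrite -(subnK na) exprD An mulr0 !mul0mx.
    have nb : (n <= b)%N by lia.
    by rewrite -(subnKC nb) exprD An mul0r mulmx0.
  have sub (u v : 'M[K]_k) i : iter i (lieb A) (u - v) = iter i (lieb A) u - iter i (lieb A) v.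
    elim: i => //= i ->; rewrite /lieb mulmxBr mulmxBl !opprD opprK.
    by rewrite addrACA.
  rewrite -iterS iterSr.
  have -> : lieb A (A ^+ a *m X *m A ^+ b) =
      A ^+ a.+1 *m X *m A ^+ b - A ^+ a *m X *m A ^+ b.+1.
    by rewrite /lieb exprS exprSr !mx_mulE !mulmxA.
  by rewrite sub !ih ?subrr//; lia.
have := gen (2 * n)%N 0 0; rewrite expr0 mul1mx mulmx1; apply; lia.
Qed.

Section WeightSpaces.
Context {R : realType} {k : nat}.
Variables (g : set 'M[R]_k) (T Y : 'M[R]_k).
Hypothesis hg : is_subspace g.
Hypothesis glieb : forall X Z, g X -> g Z -> g (lieb X Z).

(** If T and Y are the grading elements of the splitting, this is the part of l_R
    on which ad Y is lam. *)
Definition weight_space (lam : R) : set 'M[R]_k :=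
  [set X | [/\ g X, lieb T X = 0 & lieb Y X = lam *: X]].

Lemma weight_space_subspace lam : is_subspace (weight_space lam).
Proof.
split=> [|c u v [gu Tu Yu] [gv Tv Yv]].
  by split; rewrite ?lieb0r ?scaler0//; exact: subspace0.
split; first by case: hg => _; apply.
  by rewrite liebDr liebZr Tu Tv scaler0 addr0.
by rewrite liebDr liebZr Yu Yv scalerDr !scalerA mulrC.
Qed.

Lemma weight_space_lieb lam mu X Z : weight_space lam X -> weight_space mu Z ->
  weight_space (lam + mu) (lieb X Z).
Proof.
move=> [gX TX YX] [gZ TZ YZ]; split; first exact: glieb.
  by rewrite lieb_jacobi TX TZ lieb0r liebC lieb0r oppr0 addr0.
by rewrite lieb_jacobi YX YZ liebZl liebZr scalerDl.
Qed.

(** Put e = ad E and f = ad A.  On the space of weight -2, the map f e is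
    injective by sl2_negative_weight, hence bijective, so that f is onto from
    weight 0. *)
Lemma ad_lowering_surjective (E A : 'M[R]_k) :
  weight_space 2 E -> weight_space (-2) A -> lieb E A = Y ->
  (forall X, g X -> exists j, iter j (lieb A) X = 0) ->
  forall B, weight_space (-2) B -> exists2 X, weight_space 0 X & lieb X A = B.
Proof.
move=> wE wA EA nilA B wB.
have YA : lieb Y A = - 2 *: A by case: wA.
have wfe X : weight_space (-2) X -> weight_space (-2) (lieb A (lieb E X)).
  move=> wX; have := weight_space_lieb wA (weight_space_lieb wE wX).
  by rewrite subrr addr0.
have inj X : weight_space (-2) X -> lieb A (lieb E X) = 0 -> X = 0.
  move=> [gX TX YX] AEX; apply: (@sl2_negative_weight R _ (lieb E) (lieb A) (lieb Y) (-2)) => //.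
  - by move=> *; rewrite liebZr.
  - by move=> *; rewrite liebZr.
  - by move=> Z; rewrite lieb_jacobi EA addrC.
  - by move=> Z; rewrite lieb_jacobi YA liebZl scaleNr addrC.
  - exact: nilA.
have lin : linear (fun X => lieb A (lieb E X)).
  by move=> c u v; rewrite (liebDr E (c *: u) v) (liebZr c E u) liebDr liebZr.
have [X wX <-] := subspace_inj_surj (weight_space_subspace (-2)) lin wfe inj wB.
exists (- lieb E X).
  apply: subspaceN; first exact: weight_space_subspace.
  by have := weight_space_lieb wE wX; rewrite subrr.
by rewrite [RHS]liebC /lieb mulmxN mulNmx opprB opprK addrC.

Qed.

End WeightSpaces.

Section ConjugationRemainder.
Context {R : realType} {k : nat}.
Implicit Types X Y A : 'M[R]_k.

Lemma mx_normM_le (X Y : 'M[R]_k) (a b : R) : `|X| <= a -> `|Y| <= b ->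
  `|X *m Y| <= k.+1%:R * (a * b).
Proof.
move=> Xa Yb; apply: le_trans (mx_normM _ _) _; rewrite mulrCA.
have h : `|X| * `|Y| <= a * b by apply: ler_pM.
apply: ler_pM => //; rewrite ?mulr_ge0 ?ler_nat//.
Qed.

Lemma expmx_sub_le X Y (c : R) : c <= 1 -> k%:R * `|X| <= c -> k%:R * `|Y| <= c ->
  `|expmx X - expmx Y| <= (1 + expR 1) * `|X - Y|.
Proof.
move=> c1 Xc Yc; have h := expmx_lipschitz c1 Xc Yc.
rewrite -[expmx X - expmx Y](subrKC (X - Y)).
apply: le_trans (ler_normD _ _) _; rewrite mulrDl mul1r lerD2l.
apply: le_trans h _; apply: ler_wpM2r => //.
by rewrite -[leRHS]mulr1 ler_wpM2l// expR_ge0.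
Qed.

Lemma conj_remainder (E E' F F' d A : 'M[R]_k) :
  E *m A *m F - E' *m A *m F' - (d *m A - A *m d) =
    d *m (A *m (F - 1)) + (E - E' - d) *m (A *m F) - (E' - 1) *m (A *m d)
    + E' *m (A *m (F - F' - - d)).
Proof.
rewrite -!mx_mulE opprK !(mulrBr, mulrBl, mulrDr, mulrDl, mulr1, mul1r) !mulrA.
move: (E * A * F) (E' * A * F') (d * A) (A * d) (d * A * F) (E' * A * F)
  (E' * A * d) => x1 x2 x3 x4 x5 x6 x7.
by apply/matrixP => i j; rewrite !mxE; ring.
Qed.

(** Up to a map whose Lipschitz constant near 0 is as small as wanted,
    exp(X) A exp(- X) is A + [X, A]. *)
Lemma conj_expmx_lipschitz A : exists2 C : R, 0 <= C & forall c X Y, c <= 1 ->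
  k.+1%:R * `|X| <= c -> k.+1%:R * `|Y| <= c ->
  `|expmx X *m A *m expmx (- X) - expmx Y *m A *m expmx (- Y) - lieb (X - Y) A|
    <= C * c * `|X - Y|.
Proof.
pose e : R := expR 1; have e0 : 0 <= e by exact: expR_ge0.
pose K : R := k.+1%:R; have K1 : 1 <= K by rewrite /K ler1n.
have K0 : 0 <= K by apply: le_trans K1.
pose a := `|A|; have a0 : 0 <= a by exact: normr_ge0.
(* The four terms bound those of the identity conj_remainder. *)
pose C := K * (K * a) * (1 + e) + K * (K * (e * a)) * (2 + e) + K * (K * ((1 + e) * a)) +
  K * (K * ((2 + e) * a)) * e.
have C0 : 0 <= C.
  by rewrite /C !addr_ge0// !mulr_ge0// addr_ge0.
exists C => // c X Y c1 Xc Yc; pose d := X - Y.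
have kK : k%:R <= K by rewrite ler_nat.
have kX : k%:R * `|X| <= c by apply: le_trans Xc; rewrite ler_wpM2r.
have kY : k%:R * `|Y| <= c by apply: le_trans Yc; rewrite ler_wpM2r.
have kNX : k%:R * `|- X| <= c by rewrite normrN.
have kNY : k%:R * `|- Y| <= c by rewrite normrN.
have c0 : 0 <= c by apply: le_trans kX; rewrite mulr_ge0.
have k00 : k%:R * `|0 : 'M[R]_k| <= c by rewrite normr0 mulr0.
have Xc' : `|X| <= c by apply: le_trans Xc; rewrite -[leLHS]mul1r ler_wpM2r.
have Yc' : `|Y| <= c by apply: le_trans Yc; rewrite -[leLHS]mul1r ler_wpM2r.
have F1 : `|expmx (- X) - 1| <= (1 + e) * c.
  have := expmx_sub_le c1 kNX k00; rewrite expmx0 subr0 normrN => h.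
  by apply: le_trans h _; rewrite ler_wpM2l// addr_ge0.
have E1 : `|expmx Y - 1| <= (1 + e) * c.
  have := expmx_sub_le c1 kY k00; rewrite expmx0 subr0 => h.
  by apply: le_trans h _; rewrite ler_wpM2l// addr_ge0.
have bd (B : 'M[R]_k) : `|B - 1| <= (1 + e) * c -> `|B| <= 2 + e.
  move=> h; have -> : B = 1 + (B - 1) by rewrite addrC subrK.
  apply: le_trans (ler_normD _ _) _.
  have h1 : `|1 : 'M[R]_k| <= 1 by exact: mx_norm1.
  have h2 : (1 + e) * c <= 1 + e by rewrite -[leRHS]mulr1 ler_wpM2l// addr_ge0.
  lra.
have F2 := bd _ F1; have E2 := bd _ E1.
have D1 : `|expmx X - expmx Y - d| <= e * c * `|d| by exact: expmx_lipschitz.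
have D2 : `|expmx (- X) - expmx (- Y) - - d| <= e * c * `|d|.
  have -> : - d = - X - - Y by rewrite /d opprB addrC opprK.
  have <- : `|- X - - Y| = `|d| by rewrite -opprD normrN.
  exact: expmx_lipschitz.
move: (expmx X) (expmx Y) (expmx (- X)) (expmx (- Y)) D1 D2 F1 F2 E1 E2.
move=> E E' F F' D1 D2 F1 F2 E1 E2; rewrite -/d /lieb.
have -> : E *m A *m F - E' *m A *m F' - (d *m A - A *m d) =
    d *m (A *m (F - 1)) + (E - E' - d) *m (A *m F) - (E' - 1) *m (A *m d)
    + E' *m (A *m (F - F' - - d)).
  exact: conj_remainder.
have T1 := mx_normM_le (lexx `|d|) (mx_normM_le (lexx a) F1).
have T2 := mx_normM_le D1 (mx_normM_le (lexx a) F2).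
have T3 := mx_normM_le E1 (mx_normM_le (lexx a) (lexx `|d|)).
have T4 := mx_normM_le E2 (mx_normM_le (lexx a) D2).
apply: le_trans (ler_normD _ _) _.
apply: le_trans (lerD (le_trans (ler_normB _ _) (lerD (le_trans (ler_normD _ _)
  (lerD T1 T2)) T3)) T4) _.
rewrite -/K /C le_eqVlt; apply/orP; left; apply/eqP; ring.
Qed.

End ConjugationRemainder.

Section LocalOrbit.
Context {R : realType} {k : nat}.

Lemma linear_section (S0 S1 : set 'M[R]_k) (f : 'M[R]_k -> 'M[R]_k) :
  is_subspace S0 -> is_subspace S1 -> linear_mx f ->
  (forall B, S1 B -> exists2 X, S0 X & f X = B) ->
  exists psi, [/\ linear_mx psi, (forall B, S0 (psi B)) &
    (forall B, S1 B -> f (psi B) = B)].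
Proof.
move=> hS0 hS1 lf surj; have [U hU] := subspace_vspace hS1.
pose b := vbasis U.
have /choice[x hx] : forall i, exists X, S0 X /\ f X = b`_i.
  move=> i; have : S1 b`_i.
    have [si|si] := ltnP i (size b); last by rewrite nth_default//; exact: subspace0.
    by apply/hU/vbasis_mem/mem_nth.
  by move=> /surj[X S0X fX]; exists X.
exists (fun B => \sum_i coord b i B *: x i); split.
- move=> c u v; rewrite scaler_sumr -big_split/=; apply: eq_bigr => i _.
  by rewrite linearP/= scalerDl scalerA.
- by move=> B; apply: subspace_sum => // i _; apply: subspaceZ => //; have [] := hx i.
- move=> B /hU BU; rewrite (linear_mx_sum _ _ lf) [RHS](coord_vbasis BU).
  by apply: eq_bigr => i _; rewrite (linear_mxZ _ _ lf); have [_ ->] := hx i.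
Qed.

(** Let psi be a linear section of X |-> [X, A].  Then exp(psi b) A exp(- psi b) is
    A + b up to a contraction in b, and the equation in b is solved by the
    fixed point theorem for contractions. *)
Lemma local_conj_surjective (S0 S1 : set 'M[R]_k) (A : 'M[R]_k) :
  is_subspace S0 -> is_subspace S1 -> S1 A ->
  (forall X, S0 X -> S1 (lieb X A)) ->
  (forall X, S0 X -> S1 (expmx X *m A *m expmx (- X))) ->
  (forall B, S1 B -> exists2 X, S0 X & lieb X A = B) ->
  exists2 eps : R, 0 < eps & forall B, S1 B -> `|B - A| < eps ->
    exists2 X, S0 X & B = expmx X *m A *m expmx (- X).
Proof.
move=> hS0 hS1 S1A S01 S0exp surj.
have lf : linear_mx (fun X => lieb X A) by move=> c u v; rewrite liebDl liebZl.
have [psi [lpsi psi0 psiK]] := linear_section hS0 hS1 lf surj.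
have [C C0 hC] := conj_expmx_lipschitz A.
have [c c0 hc] := linear_mx_bounded lpsi.
pose K : R := k.+1%:R; have K0 : 0 <= K by rewrite /K ler0n.
(* The remainder Rem below has Lipschitz constant C d c, at most 1 / 2, on the
   ball of radius r. *)
pose d := Num.min 1 (2 * (C * c + 1))^-1.
have Cc : 0 <= C * c by rewrite mulr_ge0.
have d0 : 0 < d by rewrite lt_min ltr01 invr_gt0; lra.
have d1 : d <= 1 by rewrite ge_min lexx.
have Cd : C * d * c <= 2^-1.
  have d2 : d <= (2 * (C * c + 1))^-1 by rewrite ge_min lexx orbT.
  have h : C * c * d <= C * c * (2 * (C * c + 1))^-1 by rewrite ler_wpM2l.
  rewrite mulrAC; apply: le_trans h _.
  have p : 0 < 2 * (C * c + 1) by lra.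
  rewrite ler_pdivrMr//; lra.
have Kc : 0 <= K * c by rewrite mulr_ge0.
pose r := d / (K * c + 1).
have Kc1 : 0 < K * c + 1 by lra.
have r0 : 0 < r by rewrite divr_gt0.
have small b : `|b| <= r -> K * `|psi b| <= d.
  move=> br; have h1 : K * `|psi b| <= K * (c * `|b|) by rewrite ler_wpM2l.
  have h2 : K * c * `|b| <= K * c * r by rewrite ler_wpM2l.
  apply: le_trans h1 _; rewrite mulrA; apply: le_trans h2 _.
  by rewrite /r mulrA ler_pdivrMr// [leRHS]mulrC ler_wpM2r ?ltW//; lra.
pose Phi X := expmx X *m A *m expmx (- X).
pose Rem b := Phi (psi b) - A - lieb (psi b) A.
have psi00 : psi 0 = 0 := linear_mx0 lpsi.
have Rem0 : Rem 0 = 0.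
  have -> : Rem 0 = Phi 0 - A - lieb 0 A by rewrite /Rem psi00.
  have -> : lieb 0 A = 0 := linear_mx0 lf.
  by rewrite subr0 /Phi oppr0 expmx0 -!mx_mulE mul1r mulr1 subrr.
have Rlip b b' : `|b| <= r -> `|b'| <= r -> `|Rem b - Rem b'| <= 2^-1 * `|b - b'|.
  move=> br b'r.
  have -> : Rem b - Rem b' = Phi (psi b) - Phi (psi b') - lieb (psi b - psi b') A.
    rewrite -[- psi b']scaleN1r liebDl liebZl scaleN1r /Rem.
    move: (Phi _) (Phi _) (lieb _ _) (lieb _ _) => x1 x2 x3 x4.
    by apply/matrixP => i j; rewrite !mxE; ring.
  apply: le_trans (hC d _ _ d1 (small _ br) (small _ b'r)) _.
  rewrite -(linear_mxB _ _ lpsi).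
  have Cd0 : 0 <= C * d by rewrite mulr_ge0// ltW.
  apply: le_trans (ler_wpM2l Cd0 (hc _)) _; rewrite mulrA.
  by rewrite ler_wpM2r.
exists (r / 2); first by rewrite divr_gt0.
move=> B S1B BA.
pose U := [set b | S1 b /\ `|b| <= r].
pose Tm b := (B - A) - Rem b.
have TU : {homo Tm : b / U b >-> U b}.
  move=> b [S1b br]; split.
    apply: (subspaceB hS1 (subspaceB hS1 S1B S1A)).
    apply: (subspaceB hS1 (subspaceB hS1 _ S1A)); first exact: (S0exp _ (psi0 b)).
    exact: (S01 _ (psi0 b)).
  have := Rlip b 0 br; rewrite normr0 => /(_ (ltW r0)); rewrite Rem0 !subr0 => h.
  apply: le_trans (ler_normB _ _) _; lra.
have closedU : closed U.
  have -> : U = (fun b => `|lieb (psi b) A - b|) @^-1` [set x | x <= 0] `&`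
      (fun b => `|b|) @^-1` [set x | x <= r].
    apply/seteqP; split=> b [/= h br]; split=> //; first by rewrite psiK ?subrr ?normr0.
    move: h; rewrite normr_le0 subr_eq0 => /eqP <-; exact: (S01 _ (psi0 b)).
  have lin : linear_mx (fun b => lieb (psi b) A - b).
    move=> a u v; rewrite lpsi liebDl liebZl.
    by move: (lieb _ _) (lieb _ _) => x y; rewrite scalerBr opprD addrACA.
  apply: closedI; (apply: closed_comp; last exact: closed_le).
    move=> b _; have cl := @linear_mx_continuous R k _ lin b.
    exact: (@continuous_comp _ _ _ _ (fun x : 'M[R]_k => `|x|) b cl (@norm_continuous _ _ _)).
  by move=> b _; exact: norm_continuous.
have ctr : is_contraction (mkfun TU).
  exists (2^-1)%:nng; split; first by rewrite /=; lra.
  move=> [b b'] [[_ br] [_ b'r]] /=.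
  have -> : mkfun TU b - mkfun TU b' = - (Rem b - Rem b').
    rewrite /mkfun /Tm; move: (B - A) (Rem b) (Rem b') => x1 x2 x3.
    by apply/matrixP => i j; rewrite !mxE; ring.
  by rewrite normrN; exact: Rlip.
have [|b [S1b br] bT] := banach_fixed_point ctr closedU.
  by exists 0; split; [exact: subspace0|rewrite normr0 ltW].
exists (psi b) => //.
have {}bT : b = B - A - (Phi (psi b) - A - lieb (psi b) A) by exact: bT.
move: bT; rewrite (psiK _ S1b) -/(Phi (psi b)); move: (Phi _) => x1 e.
have e0 : b - (B - A - (x1 - A - b)) = 0 by rewrite -e subrr.
apply/eqP; rewrite -subr_eq0 -oppr_eq0 -e0; apply/eqP.
by apply/matrixP => i j; rewrite !mxE; ring.
Qed.

End LocalOrbit.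

Section ConjugacyByExponentials.
Context {R : realType} {k : nat}.

Definition expprod (s : seq 'M[R]_k) : 'M[R]_k := \prod_(X <- s) expmx X.

Lemma expprod_cat s t : expprod (s ++ t) = expprod s *m expprod t.
Proof. by rewrite /expprod big_cat. Qed.

Lemma expprod_cons X s : expprod (X :: s) = expmx X *m expprod s.
Proof. by rewrite /expprod big_cons. Qed.

Lemma expprodV s : expprod s *m expprod (rev [seq - X | X <- s]) = 1%:M.
Proof.
elim: s => [|X s ih]; first by rewrite /expprod !big_nil mulmx1.
rewrite expprod_cons /= rev_cons -cats1 expprod_cat !mulmxA -(mulmxA (expmx X)) ih.
by rewrite mulmx1 expprod_cons /expprod big_nil mulmx1 expmxNr.
Qed.

Lemma expprod_unit s : expprod s \in unitmx.
Proof. by case: (mulmx1_unit (expprodV s)). Qed.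

Lemma invmx_expprod s : invmx (expprod s) = expprod (rev [seq - X | X <- s]).
Proof.
by rewrite -[LHS]mulmx1 -(expprodV s) mulmxA mulVmx ?expprod_unit// mul1mx.
Qed.

Definition expconj (S : set 'M[R]_k) (A B : 'M[R]_k) : Prop :=
  exists2 s, (forall X, X \in s -> S X) & B = expprod s *m A *m invmx (expprod s).

Variable S : set 'M[R]_k.
Hypothesis hS : is_subspace S.

Lemma expconj_refl A : expconj S A A.
Proof.
by exists [::] => //; rewrite /expprod big_nil mul1mx -[X in invmx X]/(1%:M) invmx1 mulmx1.
Qed.

Lemma expconj_sym A B : expconj S A B -> expconj S B A.
Proof.
move=> [s Ss ->]; exists (rev [seq - X | X <- s]) => [X|].
  by rewrite mem_rev => /mapP[Z /Ss SZ ->]; exact: subspaceN.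
rewrite -invmx_expprod invmxK !mulmxA mulVmx ?expprod_unit// mul1mx.
by rewrite -mulmxA mulVmx ?expprod_unit// mulmx1.
Qed.

Lemma expconj_trans A B C : expconj S A B -> expconj S B C -> expconj S A C.
Proof.
move=> [s Ss ->] [t St ->]; exists (t ++ s) => [X|].
  by rewrite mem_cat => /orP[/St|/Ss].
by rewrite !invmx_expprod map_cat rev_cat !expprod_cat !mulmxA.
Qed.

(** The points of a segment that are equivalent to its first point form a subset
    that is open, and closed because the other equivalence classes are open
    too. *)
Lemma expconj_convex (S1 C : set 'M[R]_k) : C `<=` S1 ->
  (forall A B (t : R), C A -> C B -> 0 <= t -> t <= 1 -> C (A + t *: (B - A))) ->
  (forall A, C A -> exists2 eps : R, 0 < eps &
    forall B, S1 B -> `|B - A| < eps -> expconj S A B) ->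
  forall A B, C A -> C B -> expconj S A B.
Proof.
move=> CS1 convC loc A B CA CB.
pose P t := A + t *: (B - A); pose I : set R := `[0, 1]%classic.
have CP t : I t -> C (P t) by rewrite /I /= in_itv /= => /andP[t0 t1]; exact: convC.
have locP t : I t -> exists2 e : R, 0 < e &
    forall t', I t' -> `|t' - t| < e -> expconj S (P t) (P t').
  move=> It; have [e e0 he] := loc _ (CP t It).
  exists (e / (`|B - A| + 1)); first by rewrite divr_gt0// ltr_wpDl.
  move=> t' It' tt'; apply: he; first exact/CS1/CP.
  have -> : P t' - P t = (t' - t) *: (B - A).
    by rewrite /P opprD addrACA subrr add0r -scalerBl.
  rewrite normrZ; move: tt'; rewrite ltr_pdivlMr ?ltr_wpDl//.
  apply: le_lt_trans; rewrite ler_wpM2l// lerDl//.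
have /choice[e he] : forall t, exists e : R, I t -> 0 < e /\
    forall t', I t' -> `|t' - t| < e -> expconj S (P t) (P t').
  move=> t; have [It|It] := pselect (I t); last by exists 0.
  by have [e e0 he] := locP t It; exists e.
pose J := [set t | I t /\ expconj S A (P t)].
have P0 : P 0 = A by rewrite /P scale0r addr0.
have P1 : P 1 = B by rewrite /P scale1r addrC subrK.
have I0 : I 0 by rewrite /I /= in_itv /= lexx ler01.
have I1 : I 1 by rewrite /I /= in_itv /= lexx ler01.
suff JI : J = I by have : J 1 by [rewrite JI]; rewrite /J /= P1 => -[].
apply: (@segment_connected R 0 1).
- by exists 0; split=> //; rewrite P0; exact: expconj_refl.
- exists (\bigcup_(t in J) ball t (e t)).
    by apply: bigcup_open => t _; exact: ball_open.
  apply/seteqP; split=> t.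
    move=> [It At]; split=> //; exists t => //.
    by apply: ballxx; have [] := he t It.
  move=> [It [t' [It' At'] tt']]; split=> //; apply: expconj_trans At' _.
  by have [_ h] := he t' It'; apply: h => //; rewrite distrC.
- exists (~` \bigcup_(t in I `\` J) ball t (e t)).
    apply: open_closedC.
    by apply: bigcup_open => t _; exact: ball_open.
  apply/seteqP; split=> t.
    move=> [It At]; split=> //.
    move=> [t' [It' nJ] tt']; apply: nJ; split=> //; apply: expconj_trans At _.
    apply: expconj_sym.
    by have [_ h] := he t' It'; apply: h => //; rewrite distrC.
  move=> [It nb]; apply: contrapT => nJ; apply: nb; exists t => //.
  by apply: ballxx; have [] := he t It.
Qed.

End ConjugacyByExponentials.

Section ExponentialPaths.
Context {R : realType} {k : nat}.

Lemma expmx_line_continuous (X : 'M[R]_k) : continuous (fun t : R => expmx (t *: X)).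
Proof.
move=> t0; pose e : R := 1 + expR 1.
have e0 : 0 <= e by rewrite addr_ge0 ?expR_ge0.
have h1 : expmx ((t - t0) *: X) @[t --> t0] --> (1%:M : 'M[R]_k).
  apply/cvgrPdist_lt => eps eps0.
  pose d := Num.min (k%:R * `|X| + 1)^-1 (eps / (e * `|X| + 1)).
  have kX : 0 <= k%:R * `|X| by rewrite mulr_ge0.
  have eX : 0 <= e * `|X| by rewrite mulr_ge0.
  have d0 : 0 < d by rewrite lt_min invr_gt0 divr_gt0// ltr_wpDl.
  apply/nbhs_ballP; exists d => // t; rewrite /ball /= distrC lt_min => /andP[td1 td2].
  have c1 : k%:R * `|(t - t0) *: X| <= 1.
    rewrite normrZ mulrCA; move: td1; rewrite -[_^-1]mul1r ltr_pdivlMr ?ltr_wpDl// => td1.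
    by apply: le_trans (ltW td1); rewrite ler_wpM2l// lerDl.
  have c0 : k%:R * `|0 : 'M[R]_k| <= 1 by rewrite normr0 mulr0.
  rewrite distrC; have := expmx_sub_le (lexx 1) c1 c0; rewrite expmx0 subr0 => h.
  apply: le_lt_trans h _; rewrite normrZ mulrCA.
  move: td2; rewrite ltr_pdivlMr ?ltr_wpDl// => td2.
  by apply: le_lt_trans td2; rewrite ler_wpM2l// lerDl.
have tE : (fun t => expmx (t *: X)) = (fun t => expmx (t0 *: X) *m expmx ((t - t0) *: X)).
  apply/funext => t; rewrite -expmxD; first by rewrite -scalerDl addrC subrK.
  by rewrite -!scalemxAl -!scalemxAr scalerA mulrC -scalerA.
have := cvg_mulmx (cvg_cst (expmx (t0 *: X))) h1; rewrite mulmx1.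
by rewrite -tE => h; apply: h; exact: nbhs_filter.
Qed.

Lemma expprod_path_continuous (s : seq 'M[R]_k) :
  continuous (fun t : R => expprod [seq t *: X | X <- s]).
Proof.
move=> t0; elim: s => [|X s ih].
  under eq_fun do rewrite /expprod big_nil.
  exact: cvg_cst.
under eq_fun do rewrite /= expprod_cons.
exact: (cvg_mulmx (@expmx_line_continuous X t0) ih).
Qed.

Lemma expprod_comm (Y : 'M[R]_k) s : (forall X, X \in s -> lieb X Y = 0) ->
  expprod s *m Y *m invmx (expprod s) = Y.
Proof.
move=> sY; suff -> : expprod s *m Y = Y *m expprod s.
  by rewrite -mulmxA mulmxV ?mulmx1// expprod_unit.
elim: s sY => [|X s ih] sY; first by rewrite /expprod big_nil [RHS]mulmx1 [LHS]mul1mx.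
rewrite expprod_cons -mulmxA ih => [|Z Zs]; last by apply: sY; rewrite inE Zs orbT.
rewrite !mulmxA; congr (_ *m _); apply/esym/expmx_comm.
have := sY X (mem_head _ _); rewrite /lieb => /eqP; rewrite subr_eq0 => /eqP ->.
by [].
Qed.

(** Multiplying all the logarithms by t, for t from 0 to 1, joins a product of
    exponentials to the identity inside the stabilizer of Y. *)
Lemma expprod_component (S : set 'M[R]_k) (Y : 'M[R]_k) s :
  (forall t X, S X -> S (t *: X)) ->
  (forall X, X \in s -> S X /\ lieb X Y = 0) ->
  connected_component [set g | connected_lie_subgroup S g /\ g *m Y *m invmx g = Y]
    1%:M (expprod s).
Proof.
move=> SZ hs; pose c t := expprod [seq t *: X | X <- s].
have c1 : c 1 = expprod s.
  by rewrite /c; congr expprod; rewrite -[RHS]map_id; apply: eq_map => X; rewrite scale1r.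
have c0 : c 0 = 1%:M.
  rewrite /c /expprod big_map big1// => X _; by rewrite scale0r expmx0.
rewrite -c1; apply: (@connected_component_max _ _ (c @` `[0, 1]%classic)).
- by exists 0; rewrite /= ?in_itv /= ?lexx ?ler01.
- move=> _ [t _ <-]; split.
    exists [seq t *: X | X <- s]; split=> // _ /mapP[X /hs[SX _] ->]; exact: SZ.
  apply: expprod_comm => _ /mapP[X /hs[_ XY] ->]; by rewrite liebZl XY scaler0.
- apply: connected_continuous_connected; first exact: segment_connected.
  by apply: continuous_subspaceT => t; exact: expprod_path_continuous.
- by exists 1; rewrite /= ?in_itv /= ?lexx ?ler01.
Qed.

End ExponentialPaths.

(** * The nilpotent cone lies in one orbit *)

Section ConeOrbit.
Context {R : realType} {k n m : nat} (H : hodge_datum R k n).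
Variables (F : int -> set 'cV[R[i]]_n) (N : 'I_m -> 'M[R]_k) (W : int -> set 'cV[R]_n).
Hypothesis hG : is_algebraic_group (hd_G H).
Hypothesis hH : is_hodge_representation H.
Hypothesis hF : is_Rsplit_nilpotent_orbit H F N W.

Let hM := orbit_mhs hF.
Let hR := orbit_Rsplit hF.
Local Notation gR := (hd_g H).
Local Notation drho := (hd_drho H).
Local Notation wt := (hd_wt H).

(** T and Y are determined by the splitting, as d rho is injective: the triples of
    all the elements of the cone share the same Y. *)
Lemma cone_sl2 A : nilpotent_cone N A -> exists E T Y,
  [/\ gR T, gR Y, toC (drho T) = 'i *: Tgr hM hR, toC (drho Y) = Ygr wt hM hR &
   [/\ weight_space gR T Y 2 E, weight_space gR T Y (- 2) A & lieb E A = Y]].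
Proof.
move=> hA; have gA := cone_g hG hF hA.
have [Np [Np_shift NpN]] := exists_sl2_raising hM hR (cone_F hF hA) (cone_W hF hA)
  (cone_weight hF hA).
have [E [T [gE gT dE dT]]] := orbit_grading_elements hG hH hA Np_shift NpN.
have gY : gR (lieb E A) := gR_lieb hG gE gA.
have dY : toC (drho (lieb E A)) = Ygr wt hM hR.
  have dl : drho (lieb E A) = lieb (drho E) (drho A).
    exact: (regdiff_lieb hG (hodge_regRM hH) (hodge_regR_unit hH) gE gA).
  by rewrite dl dE toC_lieb.
exists E, T, (lieb E A); split=> //.
have IA : deligne_g H F W (- 1) (- 1) (toC A).
  split; first exact: (gC_toC hG).
  by move=> r s v Iv; rewrite drhoC_toC addrC [- 1 + s]addrC; exact: (cone_shift hF hA).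
have IE : deligne_g H F W 1 1 (toC E).
  split; first exact: (gC_toC hG).
  by move=> r s v Iv; rewrite drhoC_toC dE addrC [1 + s]addrC; exact: Np_shift.
split=> //; split=> //; apply: (@toC_inj R); rewrite toC_lieb.
- by rewrite (adT hG hH gT dT IE) subrr mulr0 scale0r toC0.
- by rewrite (adY hG hH gY dY IE) toCZ; congr (_ *: _); rewrite rmorph_nat.
- by rewrite (adT hG hH gT dT IA) subrr mulr0 scale0r toC0.
- by rewrite (adY hG hH gY dY IA) toCZ; congr (_ *: _); rewrite rmorphN rmorph_nat.
Qed.

Lemma lieb_conj_expmx (D X A : 'M[R]_k) : lieb D X = 0 ->
  lieb D (expmx X *m A *m expmx (- X)) = expmx X *m lieb D A *m expmx (- X).
Proof.
move=> /eqP; rewrite subr_eq0 => /eqP DX; have DX' : D *m - X = - X *m D.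
  by rewrite mulmxN mulNmx DX.
have e1 := expmx_comm DX; have e2 := expmx_comm DX'; move: (expmx X) (expmx (- X)) e1 e2.
move=> e f e1 e2; rewrite /lieb mulmxBr mulmxBl !mulmxA e1.
by rewrite -[e *m A *m f *m D]mulmxA -e2 !mulmxA.
Qed.

Lemma weight_space_conj T Y lam X A : weight_space gR T Y 0 X ->
  weight_space gR T Y lam A -> weight_space gR T Y lam (expmx X *m A *m expmx (- X)).
Proof.
move=> [gX TX YX] [gA TA YA]; rewrite scale0r in YX; split.
- rewrite -invmx_expmx; apply: (lie_of_conj _ _ gA); first by case: hG.
  by have := gX 1; rewrite scale1r.
- by rewrite lieb_conj_expmx// TA mulmx0 mul0mx.
- by rewrite lieb_conj_expmx// YA -scalemxAr -scalemxAl.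
Qed.

Lemma cone_convex A B (t : R) : nilpotent_cone N A -> nilpotent_cone N B ->
  0 <= t -> t <= 1 -> nilpotent_cone N (A + t *: (B - A)).
Proof.
move=> [a a0 <-] [b b0 <-] t0 t1; exists (fun i => a i + t * (b i - a i)).
  move=> i /=; have ai := a0 i; have bi := b0 i; rewrite /= in ai bi.
  have [t_lt1|t_ge1] := ltP t 1; first by nra.
  have -> : t = 1 by lra.
  by rewrite mul1r addrC subrK.
rewrite -sumrB scaler_sumr -big_split/=; apply: eq_bigr => i _.
by rewrite scalerDl -scalerA scalerBl.
Qed.

Lemma cone_expconj T Y : gR T -> gR Y ->
  toC (drho T) = 'i *: Tgr hM hR -> toC (drho Y) = Ygr wt hM hR ->
  nilpotent_cone N `<=` weight_space gR T Y (- 2) /\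
  forall A B, nilpotent_cone N A -> nilpotent_cone N B ->
    expconj (weight_space gR T Y 0) A B.
Proof.
move=> gT gY dT dY; have gs := gR_subspace hG; have gl := gR_lieb hG.
have triple A : nilpotent_cone N A -> exists E,
    [/\ weight_space gR T Y 2 E, weight_space gR T Y (- 2) A & lieb E A = Y].
  move=> /cone_sl2[E [T' [Y' [gT' gY' dT' dY' h]]]]; exists E.
  have -> : T = T' := drho_inj hH gT gT' (toC_inj (etrans dT (esym dT'))).
  by have -> : Y = Y' := drho_inj hH gY gY' (toC_inj (etrans dY (esym dY'))).
have CS1 : nilpotent_cone N `<=` weight_space gR T Y (- 2) by move=> A /triple[E []].
split=> //; have hS0 := weight_space_subspace T Y gs 0.
have hS1 := weight_space_subspace T Y gs (- 2).
apply: (expconj_convex hS0 CS1) => [A B t|A CA]; first exact: cone_convex.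
have [E [wE wA EA]] := triple A CA.
have nil X : gR X -> exists j, iter j (lieb A) X = 0.
  move=> gX; have An : drho A ^+ n = 0.
    by apply: (@toC_inj R); rewrite toC_exp toC0; exact: (cone_nilpotent hF CA).
  have gA := cone_g hG hF CA.
  exists (2 * n)%N; have [gi di] : gR (iter (2 * n) (lieb A) X) /\
      drho (iter (2 * n) (lieb A) X) = iter (2 * n) (lieb (drho A)) (drho X).
    elim: (2 * n)%N => //= j [gj dj]; split; first exact: gl.
    rewrite -dj; exact: (regdiff_lieb hG (hodge_regRM hH) (hodge_regR_unit hH) gA gj).
  apply: (drho_inj hH gi (subspace0 gs)).
  by rewrite di (linear_mx0 (drho_lin H)) ad_nilpotent.
have [eps eps0 heps] := local_conj_surjective hS0 hS1 wA
  (fun X wX => eq_ind _ (fun c => weight_space gR T Y c (lieb X A))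
     (weight_space_lieb gl wX wA) _ (add0r _))
  (fun X wX => weight_space_conj wX wA)
  (ad_lowering_surjective gs gl wE wA EA nil).
exists eps => // B wB BA; have [X wX ->] := heps B wB BA.
exists [:: X]; first by move=> Z; rewrite inE => /eqP ->.
by rewrite expprod_cons /expprod big_nil [_ *m 1]mulmx1 invmx_expmx.
Qed.

End ConeOrbit.

Theorem corollary4p9 (R : realType) (k n m : nat) (H : hodge_datum R k n)
    (F : int -> set 'cV[R[i]]_n) (N : 'I_m -> 'M[R]_k)
    (W : int -> set 'cV[R]_n) (Y : 'M[R]_k)
    (hG : admissible_group (hd_G H))
    (hH : is_hodge_representation H)
    (hF : is_Rsplit_nilpotent_orbit H F N W)
    (hY : levi_l H F W Y)
    (hYgr : is_grading (hd_gC H) (toC Y))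
    (hYad : forall (p : int) (xi : 'M[R[i]]_k), deligne_g H F W p p xi ->
       lieb (toC Y) xi = (2 * p)%:~R *: xi) :
  is_real_levi (hd_g H) (levi_lY H F W Y) /\
  nilpotent_cone N `<=` Nilp H (levi_l H F W) /\
  exists2 N0 : 'M[R]_k, levi_l H F W N0 &
    nilpotent_cone N `<=` [set g *m N0 *m invmx g | g in levi_LY H F W Y].
Proof.
have {}hG : is_algebraic_group (hd_G H) by case: hG.
pose N0 := \sum_i (1 : R) *: N i.
have cN0 : nilpotent_cone N N0 by exists (fun=> 1) => // i; exact: ltr01.
have [_ [T [Y' [gT gY' dT dY' _]]]] := cone_sl2 hG hH hF cN0.
have [CS1 orb] := cone_expconj hG hH gT gY' dT dY'.
have lP X := levi_lP hG hH gT gY' dT dY' X.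
have cone_l A : nilpotent_cone N A -> levi_l H F W A.
  by move=> /CS1[gA TA _]; apply/lP.
split; first exact: (levi_lY_levi hG hH gT gY' dT dY' hYad).
split=> [A cA|].
  split; first exact: cone_l.
  exists n; apply: (@toC_inj R); rewrite toC_exp toC0.
  exact: (cone_nilpotent hF cA).
exists N0; first exact: cone_l.
move=> B cB; have [s hs ->] := orb _ _ cN0 cB; exists (expprod s) => //.
apply: expprod_component => [t X /lP[gX TX]|X /hs[gX TX YX]].
  apply/lP; split; first exact: lie_of_scale.
  by rewrite liebZr TX scaler0.
rewrite scale0r in YX.
exact: (levi_lYP hG hH gT gY' dT dY' X hYad).2.
Qed.
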